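(* Let $w_1,w_2:\mathbb{R}\to\mathbb{R}$ be fixed smooth, compactly supported functions, with the support of $w_1$ contained in $(0,\infty)$. For every $\varepsilon>0$ and every constant $c_0>0$ there is a constant $C=C(\varepsilon,c_0,w_1,w_2)>0$ such that for all real numbers $N\ge 1$ and $X>0$ with $N\ge c_0X^{1/2}$, setting $M=N^{2/3}$, we have $$\Big|C_S(N,X)-\frac{XM}{N}\,\frac{\widehat{w_1}(0)\,\widehat{w_2}(0)}{\zeta(5)}\Big|\le C\big(N^{1/3+\varepsilon}+X^{1/2}N^{\varepsilon}\big).$$
   Context: For real $N\ge1$, $X>0$, put $M=N^{2/3}$ and $Z=N/X$. Define $$C_S(N,X)=\sum_{m,n\in\mathbb{Z}}w_1\Big(\frac{m}{M}\Big)\,w_2\big(Z(n-m^{3/2})\big)\sum_{\substack{d\ge 1\\ d^2\mid m,\ d^3\mid n}}\mu(d),$$ where $\mu$ is the Möbius function and terms with $m\le0$ contribute $0$ because $w_1$ is supported in $(0,\infty)$. (The inner sum is the indicator function of the condition that $d^2\mid m$ and $d^3\mid n$ with $d\geq 1$ force $d=1$.) Here $\widehat{w_i}(0)=\int_{-\infty}^{\infty}w_i(x)\,dx$ and $\zeta$ is the Riemann zeta function. *)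

(* Defs.v *)
From mathcomp Require Import all_boot all_order all_algebra.
From mathcomp Require Import all_classical all_reals all_analysis.

Set Implicit Arguments.
Unset Strict Implicit.
Unset Printing Implicit Defensive.

Import Order.TTheory GRing.Theory Num.Theory.
Import numFieldNormedType.Exports.

Local Open Scope classical_set_scope.
Local Open Scope ring_scope.

Definition smooth (R : realType) (w : R -> R) : Prop :=
  forall (k : nat) (x : R), derivable (derive1n k w) x 1.

Definition fun_support (R : realType) (w : R -> R) : set R :=
  closure [set x | w x != 0].

Definition compactly_supported (R : realType) (w : R -> R) : Prop :=
  compact (fun_support w).

(* \hat w (0) = \int w(x) dx, with respect to the Lebesgue measure *)
Definition fourier_at0 (R : realType) (w : R -> R) : R :=
  Rintegral (@lebesgue_measure R) setT w.

(* meaningful for n >= 1 only; at n = 0 the value 1 is never used below *)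
Definition moebius (n : nat) : int :=
  if all (fun p => logn p n == 1%N) (primes n) then (-1) ^+ size (primes n)
  else 0.

(* the Dirichlet series \sum_{n >= 1} n^(-s), which is zeta(s) for real s > 1 *)
Definition zeta (R : realType) (s : R) : R :=
  limn (series (fun n : nat => n.+1%:R `^ (- s))).

(* For (m, n) <> (0, 0) the index set is finite; at m = n = 0 it is infinite and
   the finitely supported sum defaults to 0. *)
Definition moebius_sum (m n : int) : int :=
  \sum_(d \in [set d : nat | [/\ (0 < d)%N,
                                 (d%:Z ^+ 2 %| m)%Z & (d%:Z ^+ 3 %| n)%Z]])
    moebius d.

(* When w1 and w2 are compactly supported and the support of w1 is contained in
   (0, +oo), only finitely many (m, n) contribute, all with m > 0, so the
   finitely supported sum is the full sum over Z^2 and the convention for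
   m `^ (3 / 2) at m <= 0 is immaterial. *)
Definition C_S (R : realType) (w1 w2 : R -> R) (N X : R) : R :=
  let M := N `^ (2 / 3) in
  let Z := N / X in
  \sum_(p \in [set: (int * int)%type])
    (w1 (p.1%:~R / M) * w2 (Z * (p.2%:~R - p.1%:~R `^ (3 / 2)))
     * (moebius_sum p.1 p.2)%:~R).

(* Main.v *)
(* Grouping the terms by the common divisor d, i.e. (m, n) = (d^2 x, d^3 y), turns
   C_S into the sum over d of mu(d) S(T, H), where T = N^(1/3) / d, H = N d^3 / X and
   S(T, H) sums w1(x / T^2) w2(H (y - x^(3/2))) over all x, y.  The expected value
   T^2 / H = X M / N d^-5 produces 1 / zeta(5).  For H <= T, Poisson summation in y
   reduces the error to the exponential sums over x of w1(x / T^2) e(h x^(3/2)),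
   weighted by O(min(1, (H / h)^2)) / H; for H > T one bounds w2(H z) by a majorant
   at scale T; for small T the sum S(T, H) vanishes.

   The exponential sum is O((T^(3/2) h^(-1/2) + T^(1/2) h^(1/2)) E(h)) with E(h) bounded
   on average.  After Poisson summation in x, the k-th integral has its stationary point
   where x^(1/2) = 2 k / (3 h T) and there the phase equals -4 k^3 / (27 h^2).  Writing
   k = k' + 3 h j, this is, modulo 1, linear in j with slope -4 k'^2 / (3 h), so Abel
   summation against a geometric sum saves a factor depending on the distance r of
   4 k'^2 to the multiples of 3 h.  Summing the savings over k' and h amounts to
   counting factorizations of 4 k^2 + l, which the divisor bound controls. *)

(* Absolute values lose a factor [H]. After Poisson summation in x there are about [h T] stationary
   terms of size [T^(1/2) h^(-1/2)], in all [T^(3/2) h^(1/2)]; summed over [h] up to [H] with weight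
   [1 / H] this is [T^(3/2) H^(1/2)], whereas [T^(3/2) H^(-1/2)] is required. The saving cannot be
   had for each [h], since [E(h)] may reach [h^(1/2)]: if [3 h = s^2], every multiple [k] of [s] has
   [3 h | 4 k^2]. So [E] is only controlled through the series of [h^(-1-e) E(h)], and the decay
   [min(1, (H / h)^2)] is weakened to powers [(H / h)^s] that produce this very weight.

   In the original parameters [T^(3/2) H^(-1/2) = X^(1/2) d^-3] and [T^(1+e) <= N^(1/3+e) d^(-1-e)].
   Both converge over [d] and give the two error terms. The hypothesis [c0 X^(1/2) <= N] says
   [1 / H <= X^(1/2) d^-3 / c0]; it pays for the errors of order [1 / H], which come from the
   frequency [h = 0] and from the expected value when [T] is so small that the sum is empty. *)
Require Import Defs.
From mathcomp Require Import all_boot all_order all_algebra.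
From mathcomp Require Import all_classical all_reals all_analysis.
From mathcomp Require Import ring lra zify.
Import Order.TTheory GRing.Theory Num.Theory.
Import numFieldNormedType.Exports.
Set Implicit Arguments.
Unset Strict Implicit.
Unset Printing Implicit Defensive.
Local Open Scope classical_set_scope.
Local Open Scope ring_scope.

(** * Derivatives and integrals *)

(* A copy of [is_derive] that is not subject to type class resolution. *)
Definition has_der (R : realType) (f : R -> R) (x l : R) : Prop := is_derive x 1 f l.

Section Derivatives.
Context {R : realType}.
Implicit Types (f g : R -> R) (x l m a b c K : R).

Lemma der_eq f x l m : has_der f x l -> l = m -> has_der f x m.
Proof. by move=> h <-. Qed.

Lemma der_cst x (c : R) : has_der (fun=> c) x 0.
Proof. exact: is_derive_cst. Qed.

Lemma der_id x : has_der (fun y : R => y) x 1.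
Proof. exact: is_derive_id. Qed.

Lemma der_add f g x l m : has_der f x l -> has_der g x m ->
  has_der (fun y => f y + g y) x (l + m).
Proof. by move=> hf hg; exact: is_deriveD. Qed.

Lemma der_sub f g x l m : has_der f x l -> has_der g x m ->
  has_der (fun y => f y - g y) x (l - m).
Proof. by move=> hf hg; exact: is_deriveB. Qed.

Lemma der_opp f x l : has_der f x l -> has_der (fun y => - f y) x (- l).
Proof. by move=> hf; exact: is_deriveN. Qed.

Lemma der_mul f g x l m : has_der f x l -> has_der g x m ->
  has_der (fun y => f y * g y) x (l * g x + f x * m).
Proof.
move=> hf hg; apply: (der_eq (@is_deriveM _ _ f g x 1 l m hf hg)).
by rewrite /GRing.scale /= addrC [g x * _]mulrC.
Qed.

Lemma der_pow f n x l : has_der f x l ->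
  has_der (fun y => f y ^+ n.+1) x (n.+1%:R * f x ^+ n * l).
Proof.
move=> hf; elim: n => [|n ih]; first by apply: der_eq hf _; rewrite !expr0 !mul1r.
rewrite (_ : (fun y => _) = (fun y => f y * f y ^+ n.+1)); last first.
  by apply/funext => y; rewrite exprS.
apply: (der_eq (der_mul hf ih)); rewrite [in RHS]mulrSr exprS; ring.
Qed.

Lemma der_comp f g x l m : has_der f (g x) l -> has_der g x m ->
  has_der (fun y => f (g y)) x (l * m).
Proof. by move=> hf hg; exact: (@is_derive1_comp _ f g). Qed.

Lemma der_inv f x l : has_der f x l -> f x != 0 ->
  has_der (fun y => (f y)^-1) x (- l / f x ^+ 2).
Proof.
move=> hf h0; apply: (der_eq (is_deriveV h0 hf)).
by rewrite /GRing.scale /= mulNr mulrC mulNr.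
Qed.

Lemma der_sin f x l : has_der f x l ->
  has_der (fun y => sin (f y)) x (cos (f x) * l).
Proof. by move=> hf; apply: (der_comp (f := sin)) => //; exact: is_derive_sin. Qed.

Lemma der_cos f x l : has_der f x l ->
  has_der (fun y => cos (f y)) x (- sin (f x) * l).
Proof. by move=> hf; apply: (der_comp (f := cos)) => //; exact: is_derive_cos. Qed.

Lemma der_atan f x l : has_der f x l ->
  has_der (fun y => atan (f y)) x ((1 + f x ^+ 2)^-1 * l).
Proof. by move=> hf; apply: (der_comp (f := atan)) => //; exact: is_derive1_atan. Qed.

Lemma der_sqrt x : 0 < x -> has_der (Num.sqrt : R -> R) x (2 * Num.sqrt x)^-1.
Proof. by move=> x0; exact: is_derive1_sqrt. Qed.

Lemma der_mulc c x : has_der ( *%R c) x c.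
Proof. by apply: (der_eq (der_mul (der_cst x c) (der_id x))); rewrite mul0r add0r mulr1. Qed.

Lemma der_addc c x : has_der ( +%R c) x 1.
Proof. by apply: (der_eq (der_add (der_cst x c) (der_id x))); rewrite add0r. Qed.

Lemma der_cont f x l : has_der f x l -> {for x, continuous f}.
Proof.
by move=> h; apply: differentiable_continuous; apply/derivable1_diffP; exact: (@ex_derive _ _ _ _ _ _ _ h).
Qed.

Lemma der_within f (f' : R -> R) a b :
  (forall x, a <= x <= b -> has_der f x (f' x)) -> {within `[a, b], continuous f}.
Proof.
move=> h; apply: derivable_within_continuous => x; rewrite in_itv /= => hx.
exact: (@ex_derive _ _ _ _ _ _ _ (h x hx)).
Qed.

Lemma der_mono f (f' : R -> R) a b : a <= b ->
  (forall x, a <= x <= b -> has_der f x (f' x)) ->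
  (forall x, a <= x <= b -> 0 <= f' x) -> f a <= f b.
Proof.
move=> ab hd h0.
have hd' x : x \in `]a, b[%R -> has_der f x (f' x).
  by rewrite in_itv /= => /andP[/ltW h1 /ltW h2]; apply: hd; rewrite h1.
have [c cab e] := MVT_segment ab hd' (der_within hd).
by rewrite -subr_ge0 e mulr_ge0 ?subr_ge0 // h0 // -in_itv.
Qed.

(** Both [B - (F - P)] and [B + (F - P)] have a nonnegative derivative. The integral estimates below
    rest on this inequality: an approximate primitive [P] and a primitive [B] of the error replace
    any manipulation of integrals. *)
Lemma der_close (F F' P P' B B' : R -> R) a b : a <= b ->
  (forall x, a <= x <= b -> has_der F x (F' x)) ->
  (forall x, a <= x <= b -> has_der P x (P' x)) ->
  (forall x, a <= x <= b -> has_der B x (B' x)) ->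
  (forall x, a <= x <= b -> `|F' x - P' x| <= B' x) ->
  `|(F b - F a) - (P b - P a)| <= B b - B a.
Proof.
move=> ab hF hP hB h.
have h1 : B a - (F a - P a) <= B b - (F b - P b).
  apply: (der_mono (f := fun x => B x - (F x - P x))
    (f' := fun x => B' x - (F' x - P' x)) ab) => x hx.
    by apply: der_sub; [exact: hB|apply: der_sub; [exact: hF|exact: hP]].
  by rewrite subr_ge0; apply: le_trans (h x hx); exact: ler_norm.
have h2 : B a + (F a - P a) <= B b + (F b - P b).
  apply: (der_mono (f := fun x => B x + (F x - P x))
    (f' := fun x => B' x + (F' x - P' x)) ab) => x hx.
    by apply: der_add; [exact: hB|apply: der_sub; [exact: hF|exact: hP]].
  by rewrite addrC -lerBlDr sub0r; have := h x hx; rewrite ler_norml => /andP[].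
by rewrite ler_norml; apply/andP; split; lra.
Qed.

Lemma der_lip (f f' : R -> R) a b K x y :
  (forall x, a <= x <= b -> has_der f x (f' x)) ->
  (forall x, a <= x <= b -> `|f' x| <= K) ->
  a <= x <= b -> a <= y <= b -> `|f y - f x| <= K * `|y - x|.
Proof.
move=> hd hK; wlog xy : x y / x <= y.
  move=> hw hx hy; case: (leP x y) => [|/ltW] xy; first exact: hw.
  by rewrite distrC [`|y - x|]distrC; exact: hw.
move=> /andP[ax xb] /andP[ay yb].
have hin z : x <= z <= y -> a <= z <= b.
  by move=> /andP[h1 h2]; rewrite (le_trans ax h1) (le_trans h2 yb).
have := @der_close f f' (fun=> 0) (fun=> 0) (fun z => K * z) (fun=> K) x y xy.
rewrite !subr0 [`|y - x|]ger0_norm ?subr_ge0 // mulrBr; apply.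
- by move=> z /hin; exact: hd.
- by move=> z _; exact: (der_cst z 0).
- by move=> z _; exact: der_mulc.
- by move=> z /hin hz; rewrite subr0; exact: hK.
Qed.

(** The difference quotient differs from [l] by at most [K |t|]. This serves where the rules of
    calculus do not apply: under the integral sign, and for the square of a positive part. *)
Lemma der_quad f x l K : (forall t, `|t| <= 1 -> `|f (x + t) - f x - t * l| <= K * t ^+ 2) ->
  has_der f x l.
Proof.
move=> h; have K0 : 0 <= K.
  by have := h 1; rewrite normr1 lexx expr1n mulr1 => /(_ isT); apply: le_trans.
suff hc : t^-1 *: (f (t + x) - f x) @[t --> 0^'] --> l.
  split; last first.
    rewrite -derive1E /derive1; apply/cvg_lim => //.
  apply/cvg_ex; exists l; rewrite (_ : (fun _ => _) = (fun t => t^-1 *: (f (t + x) - f x))) //.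
  by apply/funext => t /=; rewrite /GRing.scale /= mulr1.
apply/cvgrPdist_le => e e0.
exists (Num.min 1 (e / (K + 1))) => /=.
  by rewrite lt_min ltr01 divr_gt0 // ltr_wpDl.
move=> t; rewrite /ball /= sub0r normrN lt_min => /andP[t1 te] t0.
have := h t (ltW t1).
rewrite (_ : l - _ = - (t^-1 * (f (x + t) - f x - t * l))); last first.
  by rewrite /GRing.scale /= (addrC x); field.
rewrite normrN normrM normfV => hh.
rewrite ler_pdivrMl ?normr_gt0 //; apply: le_trans hh _.
rewrite -(real_normK (num_real t)) expr2 mulrCA ler_wpM2l //.
move: te; rewrite ltr_pdivlMr ?ltr_wpDl // => /ltW; apply: le_trans.
by rewrite mulrC ler_wpM2l // lerDl.
Qed.

End Derivatives.

Ltac der1 := first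
  [ eassumption | exact: der_cst | exact: der_id | exact: der_mulc | exact: der_addc | apply: der_add | apply: der_sub
  | apply: der_opp | apply: der_mul | apply: der_pow | apply: der_sin
  | apply: der_cos | apply: der_atan | apply: der_inv | apply: der_sqrt ].
Ltac der := apply: der_eq; [by repeat der1 | cbn beta].

Section Integrals.
Context {R : realType}.
Implicit Types (f g : R -> R) (a b c d u v K : R).

Definition itg a b f : R := \int[@lebesgue_measure R]_(x in `[a, b]) f x.

Lemma itg_integrable f a b : continuous f ->
  (@lebesgue_measure R).-integrable `[a, b] (EFin \o f).
Proof.
move=> cf; apply: continuous_compact_integrable; first exact: segment_compact.
exact: continuous_subspaceT.
Qed.

Lemma itg_der f F a b : a <= b -> continuous f ->
  (forall x, a <= x <= b -> has_der F x (f x)) -> itg a b f = F b - F a.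
Proof.
rewrite le_eqVlt => /predU1P[<- _ _|ab cf hF].
  by rewrite /itg set_itv1 Rintegral_set1 subrr.
rewrite /itg /Rintegral (@continuous_FTC2 _ f F) //.
- exact: continuous_subspaceT.
- split.
  + move=> x; rewrite in_itv /= => /andP[/ltW h1 /ltW h2].
    by have [] := hF x; rewrite ?h1.
  + apply: cvg_at_right_filter; apply: der_cont.
    by apply: hF; rewrite lexx ltW.
  + apply: cvg_at_left_filter; apply: der_cont.
    by apply: hF; rewrite lexx ltW.
- move=> x; rewrite in_itv /= => /andP[/ltW h1 /ltW h2].
  have hd : has_der F x (f x) by apply: hF; rewrite h1.
  by rewrite derive1E; exact: (@derive_val _ _ _ _ _ _ _ hd).
Qed.

Lemma itg_der_ub f a b x : continuous f -> a < x < b ->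
  has_der (fun y => itg a y f) x (f x).
Proof.
move=> cf /andP[ax xb].
have := @continuous_FTC1_closed R f a x b xb (itg_integrable _ _ cf) ax (cf x).
rewrite /= -/(itg _ _ _) => -[d1 d2].
split; first exact: d1. rewrite -derive1E. exact: d2.
Qed.

Lemma primitive f a b : continuous f ->
  exists2 F : R -> R, (forall x, a <= x <= b -> has_der F x (f x))
    & forall u v, a <= u -> u <= v -> v <= b -> itg u v f = F v - F u.
Proof.
(* Starting at [a - 1] makes both end points interior, so that the derivative there is two-sided. *)
move=> cf; exists (fun x => itg (a - 1) x f).
  move=> x /andP[ax xb]; apply: (itg_der_ub (b := b + 1)) => //.
  by apply/andP; split; lra.
move=> u v au uv vb; apply: (itg_der (F := fun x => itg (a - 1) x f)) => // x /andP[ux xv].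
apply: (itg_der_ub (b := b + 1)) => //.
by apply/andP; split; lra.
Qed.

Lemma itg_close f a b (P P' B B' : R -> R) : a <= b -> continuous f ->
  (forall x, a <= x <= b -> has_der P x (P' x)) ->
  (forall x, a <= x <= b -> has_der B x (B' x)) ->
  (forall x, a <= x <= b -> `|f x - P' x| <= B' x) ->
  `|itg a b f - (P b - P a)| <= B b - B a.
Proof.
move=> ab cf hP hB h; have [F hF1 hF2] := primitive a b cf.
by rewrite hF2 //; exact: der_close h.
Qed.

Lemma itg_bound f a b K : a <= b -> continuous f ->
  (forall x, a <= x <= b -> `|f x| <= K) -> `|itg a b f| <= K * (b - a).
Proof.
move=> ab cf h.
have := @itg_close f a b (fun=> 0) (fun=> 0) (fun z => K * z) (fun=> K) ab cf.
rewrite !subr0 mulrBr; apply.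
- by move=> z _; exact: (der_cst z 0).
- by move=> z _; exact: der_mulc.
- by move=> z /h; rewrite subr0.
Qed.

Lemma itgD f g a b : continuous f -> continuous g ->
  itg a b (fun x => f x + g x) = itg a b f + itg a b g.
Proof.
by move=> cf cg; rewrite /itg RintegralD //; exact: itg_integrable.
Qed.

Lemma itgB f g a b : continuous f -> continuous g ->
  itg a b (fun x => f x - g x) = itg a b f - itg a b g.
Proof.
by move=> cf cg; rewrite /itg RintegralB //; exact: itg_integrable.
Qed.

Lemma itgZ f c a b : continuous f -> itg a b (fun x => c * f x) = c * itg a b f.
Proof.
by move=> cf; rewrite /itg RintegralZl //; exact: itg_integrable.
Qed.

Lemma itg_le f g a b : continuous f -> continuous g ->
  (forall x, a <= x <= b -> f x <= g x) -> itg a b f <= itg a b g.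
Proof.
move=> cf cg h; rewrite /itg; apply: le_Rintegral => //; try exact: itg_integrable.
Qed.

Lemma itg_eq f g a b : (forall x, a <= x <= b -> f x = g x) -> itg a b f = itg a b g.
Proof.
move=> h; apply: eq_Rintegral => x; rewrite inE /= in_itv /=; exact: h.
Qed.

Lemma itg_cat f a b c : continuous f -> a <= b -> b <= c ->
  itg a c f = itg a b f + itg b c f.
Proof.
move=> cf ab bc; have [F _ hF] := primitive a c cf.
by rewrite !hF ?(le_trans ab bc) //; ring.
Qed.

Lemma itg_affine f a b c d : continuous f -> 0 < c -> a <= b ->
  itg a b (fun x => f (c * x + d)) = c^-1 * itg (c * a + d) (c * b + d) f.
Proof.
move=> cf c0 ab; have [F hF1 hF2] := primitive (c * a + d) (c * b + d) cf.
rewrite hF2 // ?lerD2r ?ler_pM2l // mulrBr.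
apply: (itg_der (F := fun x => c^-1 * F (c * x + d))) => //.
  move=> x; apply: (@continuous_comp _ _ _ (fun x => c * x + d) f); last exact: cf.
  by apply: (der_cont (l := c)); der; ring.
move=> x /andP[ax xb].
apply: der_eq.
  apply: der_mul; first exact: der_cst.
  apply: (der_comp (f := F) (g := fun x => c * x + d)).
    by apply: hF1; rewrite !lerD2r !ler_pM2l // ax.
  by repeat der1.
by cbn beta; field; rewrite gt_eqF.
Qed.

End Integrals.

(** * Oscillatory integrals *)

Section Oscillation.
Context {R : realType}.
Implicit Types (f g : R -> R) (a b c K L x be ga al M : R).

Lemma norm_mul_le (x y A B : R) : `|x| <= A -> `|y| <= B -> `|x * y| <= A * B.
Proof. by move=> hx hy; rewrite normrM ler_pM. Qed.

Lemma norm_add_le (x y A B : R) : `|x| <= A -> `|y| <= B -> `|x + y| <= A + B.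
Proof. by move=> hx hy; apply: le_trans (ler_normD _ _) _; exact: lerD. Qed.

(* [osc f a b K] certifies [|\int_a^b f| <= K] by an approximate primitive [P]
   and a majorant [B] of the total error. *)
Definition osc f a b K := exists P P' B B' : R -> R,
  [/\ forall x, a <= x <= b -> has_der P x (P' x),
      forall x, a <= x <= b -> has_der B x (B' x),
      forall x, a <= x <= b -> `|f x - P' x| <= B' x
    & `|P b - P a| + (B b - B a) <= K].

Lemma osc_itg f a b K : a <= b -> continuous f -> osc f a b K -> `|itg a b f| <= K.
Proof.
move=> ab cf [P [P' [B [B' [h1 h2 h3 h4]]]]].
apply: le_trans h4; have := itg_close ab cf h1 h2 h3.
move: (itg a b f) (P b - P a) => u v h.
rewrite -(subrK v u) addrC; apply: le_trans (ler_normD _ _) _.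
by rewrite lerD2l.
Qed.

Lemma osc_eq f g a b K : (forall x, a <= x <= b -> f x = g x) -> osc f a b K -> osc g a b K.
Proof.
move=> e [P [P' [B [B' [h1 h2 h3 h4]]]]]; exists P, P', B, B'; split=> // x hx.
by rewrite -e // h3.
Qed.

Lemma osc_le f a b K K' : K <= K' -> osc f a b K -> osc f a b K'.
Proof.
move=> e [P [P' [B [B' [h1 h2 h3 h4]]]]]; exists P, P', B, B'; split=> //.
exact: le_trans e.
Qed.

Lemma osc_add f g a b K K' : osc f a b K -> osc g a b K' ->
  osc (fun x => f x + g x) a b (K + K').
Proof.
move=> [P [P' [B [B' [h1 h2 h3 h4]]]]] [Q [Q' [D [D' [k1 k2 k3 k4]]]]].
exists (fun x => P x + Q x), (fun x => P' x + Q' x),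
  (fun x => B x + D x), (fun x => B' x + D' x); split.
- by move=> x hx; exact: (der_add (h1 x hx) (k1 x hx)).
- by move=> x hx; exact: (der_add (h2 x hx) (k2 x hx)).
- move=> x hx; rewrite opprD addrACA; apply: norm_add_le; [exact: h3|exact: k3].
- apply: le_trans (lerD h4 k4).
  rewrite opprD addrACA [X in _ + X](_ : _ = (B b - B a) + (D b - D a)); last by ring.
  by rewrite [leRHS]addrACA lerD2r; exact: ler_normD.
Qed.

Lemma osc_scale f a b K c : osc f a b K -> osc (fun x => c * f x) a b (`|c| * K).
Proof.
move=> [P [P' [B [B' [h1 h2 h3 h4]]]]].
exists (fun x => c * P x), (fun x => c * P' x),
  (fun x => `|c| * B x), (fun x => `|c| * B' x); split.
- by move=> x hx; have := h1 x hx => hd; der; ring.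
- by move=> x hx; have := h2 x hx => hd; der; ring.
- by move=> x hx; rewrite -mulrBr normrM ler_wpM2l // h3.
- by rewrite -!mulrBr normrM -mulrDr ler_wpM2l.
Qed.

Lemma osc_primitive f F a b K : (forall x, a <= x <= b -> has_der F x (f x)) ->
  `|F b - F a| <= K -> osc f a b K.
Proof.
move=> h hK; exists F, f, (fun=> 0), (fun=> 0); split=> //.
- by move=> x _; exact: der_cst.
- by move=> x _; rewrite subrr normr0.
- by rewrite subrr addr0.
Qed.

(** With [L = 2 pi h T^3], [be = k / (h T)] and [ga = al = 0] this is [2 pi (h X^(3/2) - k X)] at
    [X = T^2 x], the phase that Poisson summation in x produces. The constant [ga] normalises the
    value at the stationary point; [al] is a free shift that treats cosine and sine at once. *)
Definition phase L (be ga al : R) (x : R) := L * (x * Num.sqrt x - be * x + ga) + al.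

Definition dphase (be : R) (x : R) := 3 / 2 * Num.sqrt x - be.

Lemma der_xsqrt (x : R) : 0 < x -> has_der (fun y => y * Num.sqrt y) x (3 / 2 * Num.sqrt x).
Proof.
move=> x0; have s0 : 0 < Num.sqrt x by rewrite sqrtr_gt0.
der; rewrite -{2}(sqr_sqrtr (ltW x0)); field; exact: lt0r_neq0.
Qed.

Lemma der_phase L be ga al (x : R) : 0 < x ->
  has_der (phase L be ga al) x (L * dphase be x).
Proof.
move=> x0; have h := der_xsqrt x0; rewrite /phase; der.
by rewrite /dphase; ring.
Qed.

Lemma der_dphase be (x : R) : 0 < x -> has_der (dphase be) x (3 / 4 / Num.sqrt x).
Proof.
move=> x0; have s0 : 0 < Num.sqrt x by rewrite sqrtr_gt0.
by rewrite /dphase; der; field; exact: lt0r_neq0.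
Qed.

(** Here [4 / 3 * Num.sqrt b] is the reciprocal of the least value of [3 / 4 / Num.sqrt x], the
    derivative of [dphase], on the interval, and [pi] bounds the variation of an arctangent. *)
Definition osc_const a b : R := (4 / 3 * Num.sqrt b + 1) * pi + (b - a).

(* Second derivative test; the multiplier [p / (p^2 + de^2)], [p] the derivative
   of the phase, avoids splitting at the stationary point. *)
Lemma osc_second (G G' : R -> R) a b M0 M1 L (be ga al : R) : 0 < a -> a < b -> 0 < L ->
  (forall x, a <= x <= b -> has_der G x (G' x)) ->
  (forall x, a <= x <= b -> `|G x| <= M0) ->
  (forall x, a <= x <= b -> `|G' x| <= M1) ->
  G a = 0 -> G b = 0 ->
  osc (fun x => G x * cos (phase L be ga al x)) a b
    (osc_const a b * (M0 + M1) / Num.sqrt L).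
Proof.
move=> a0 ab L0 dG hG hG' Ga Gb.
have M00 : 0 <= M0 by apply: le_trans (hG a _); rewrite // lexx ltW.
have M10 : 0 <= M1 by apply: le_trans (hG' a _); rewrite // lexx ltW.
pose de : R := (Num.sqrt L)^-1.
have de0 : 0 < de by rewrite invr_gt0 sqrtr_gt0.
have Lde : L^-1 = de ^+ 2 by rewrite exprVn sqr_sqrtr // ltW.
pose p : R -> R := dphase be; pose p' x : R := 3 / 4 / Num.sqrt x.
pose q x : R := p x ^+ 2 + de ^+ 2.
have q0 x : 0 < q x by rewrite ltr_wpDl ?sqr_ge0 // exprn_gt0.
pose c : R := 4 / 3 * Num.sqrt b.
exists (fun x => G x * (p x / q x) * sin (phase L be ga al x) / L),
 (fun x => (G' x * (p x / q x) + G x * (p' x * (de ^+ 2 - p x ^+ 2) / q x ^+ 2))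
     * sin (phase L be ga al x) / L + G x * (p x ^+ 2 / q x) * cos (phase L be ga al x)),
 (* The error terms carry [de^2 / q], and [p' de^2 / q] is the derivative of [de * atan (p / de)].
    One factor [p'] is supplied by [1 <= c p'], the other by differentiating [p / q]. The term with
    [G'] uses [2 de |p| <= q]. *)
 (fun x => de * ((M0 * c + M0) * atan (p x / de) + M1 / 2 * x)),
 (fun x => M0 * (c * p' x) * (de ^+ 2 / q x) + M0 * p' x * (de ^+ 2 / q x) + M1 * de / 2).
have pos x : a <= x <= b -> 0 < x by move=> /andP[h _]; exact: lt_le_trans h.
split.
- move=> x hx; have x0 := pos _ hx; have h1 := dG x hx.
  have h2 := der_phase L be ga al x0; have h3 := der_dphase be x0.
  rewrite -/p -/(p' x) in h3; have q1 := q0 x.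
  have h4 : has_der q x (2 * p x * p' x) by rewrite /q; der; ring.
  have q2 : q x != 0 := lt0r_neq0 q1.
  der; rewrite -/p /q; field.
  by apply/andP; split; [exact: q2|exact: lt0r_neq0].
- move=> x hx; have x0 := pos _ hx.
  have h3 := der_dphase be x0; rewrite -/p -/(p' x) in h3.
  der; rewrite /q.
  have := q0 x; rewrite /q => q1; field.
  by apply/andP; split; exact: lt0r_neq0.
- move=> x hx; have x0 := pos _ hx; have q1 := q0 x.
  have s0 : 0 < Num.sqrt x by rewrite sqrtr_gt0.
  have p'0 : 0 < p' x by rewrite divr_gt0.
  have cp : 1 <= c * p' x.
    rewrite /c /p' (_ : _ * _ = Num.sqrt b / Num.sqrt x); last by field; exact: lt0r_neq0.
    by rewrite ler_pdivlMr // mul1r ler_wsqrtr //; case/andP: hx.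
  set C := cos _; set S := sin _.
  have -> : G x * C - ((G' x * (p x / q x) + G x * (p' x * (de ^+ 2 - p x ^+ 2) / q x ^+ 2)) * S / L
      + G x * (p x ^+ 2 / q x) * C) =
    G x * (de ^+ 2 / q x) * C + - (G x * (p' x * (de ^+ 2 / q x) * ((de ^+ 2 - p x ^+ 2) / q x)) * S)
      + - (G' x * (p x / q x * de ^+ 2) * S).
    rewrite Lde /q; field; exact: lt0r_neq0.
  have C1 : `|C| <= 1 by exact: cos_max.
  have S1 : `|S| <= 1 by exact: sin_max.
  have dq : 0 <= de ^+ 2 / q x by rewrite divr_ge0 ?sqr_ge0 // ltW.
  apply: norm_add_le; first apply: norm_add_le.
  + apply: (le_trans (norm_mul_le _ C1)).
      apply: (norm_mul_le (hG x hx)); exact: lexx.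
    rewrite mulr1 (ger0_norm dq) ler_wpM2r // -{1}[M0]mulr1 ler_wpM2l //.
  + rewrite normrN; apply: (le_trans (norm_mul_le _ S1)).
      apply: (norm_mul_le (hG x hx)); exact: lexx.
    rewrite mulr1 -[leRHS]mulrA ler_wpM2l // normrM ger0_norm; last by rewrite mulr_ge0 // ltW.
    rewrite -[leRHS]mulr1 ler_wpM2l //; first by rewrite mulr_ge0 // ltW.
    rewrite normrM normfV (gtr0_norm q1) ler_pdivrMr // mul1r /q ler_norml.
    by have := sqr_ge0 (p x); have := sqr_ge0 de => h1 h2; apply/andP; split; lra.
  + rewrite normrN; apply: (le_trans (norm_mul_le _ S1)).
      apply: (norm_mul_le (hG' x hx)); exact: lexx.
    rewrite mulr1 -[leRHS]mulrA ler_wpM2l //.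
    rewrite normrM (ger0_norm (sqr_ge0 de)) normrM normfV (gtr0_norm q1) mulrAC ler_pdivrMr //.
    have : 2 * de * `|p x| <= q x.
      rewrite /q -(real_normK (num_real (p x))).
      by rewrite -subr_ge0 (_ : _ - _ = (`|p x| - de) ^+ 2) ?sqr_ge0 //; ring.
    rewrite -subr_ge0 => /(mulr_ge0 (ltW de0)) h; lra.
- rewrite Ga Gb !mul0r subrr normr0 add0r.
  set A := M0 * c + M0.
  have c0 : 0 <= c by rewrite /c mulr_ge0 // sqrtr_ge0.
  have A0 : 0 <= A by rewrite addr_ge0 ?mulr_ge0.
  have hat (u v : R) : atan u - atan v <= pi.
    have := atan_ltpi2 u; have := atan_gtNpi2 v => h1 h2; lra.
  have -> : de * (A * atan (p b / de) + M1 / 2 * b) - de * (A * atan (p a / de) + M1 / 2 * a)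
     = de * (A * (atan (p b / de) - atan (p a / de)) + M1 / 2 * (b - a)) by ring.
  rewrite mulrC ler_pM2r // /osc_const -/c.
  apply: (@le_trans _ _ (A * pi + M1 * (b - a))).
    apply: lerD; first by rewrite ler_wpM2l.
    by rewrite ler_wpM2r ?subr_ge0 ?(ltW ab) //; lra.
  rewrite /A; have := pi_gt0 R => pi0.
  have h1 : 0 <= M1 * ((c + 1) * pi) by exact: (mulr_ge0 M10 (mulr_ge0 (addr_ge0 c0 ler01) (ltW pi0))).
  have h2 : 0 <= M0 * (b - a) by apply: mulr_ge0 => //; rewrite subr_ge0 ltW.
  lra.
Qed.

End Oscillation.

Section Continuity.
Context {R : realType}.
Implicit Types (f g : R -> R) (c : R).

Lemma cont_cst c : continuous (fun _ : R => c).
Proof. by move=> x; exact: cvg_cst. Qed.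

Lemma cont_id : continuous (fun x : R => x).
Proof. by move=> x; exact: cvg_id. Qed.

Lemma cont_add f g : continuous f -> continuous g -> continuous (fun x => f x + g x).
Proof. by move=> cf cg x; exact: (continuousD (cf x) (cg x)). Qed.

Lemma cont_opp f : continuous f -> continuous (fun x => - f x).
Proof. by move=> cf x; exact: (continuousN (cf x)). Qed.

Lemma cont_mul f g : continuous f -> continuous g -> continuous (fun x => f x * g x).
Proof. by move=> cf cg x; exact: (continuousM (cf x) (cg x)). Qed.

Lemma cont_comp f g : continuous f -> continuous g -> continuous (fun x => f (g x)).
Proof. by move=> cf cg x; exact: (continuous_comp (cg x) (cf (g x))). Qed.

Lemma cont_cos f : continuous f -> continuous (fun x => cos (f x)).
Proof. by apply: cont_comp; exact: continuous_cos. Qed.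

Lemma cont_sin f : continuous f -> continuous (fun x => sin (f x)).
Proof. by apply: cont_comp; exact: continuous_sin. Qed.

Lemma cont_sqrt f : continuous f -> continuous (fun x => Num.sqrt (f x)).
Proof. by apply: cont_comp; exact: sqrt_continuous. Qed.

Lemma cont_mulc c : continuous ( *%R c).
Proof. by apply: cont_mul; [exact: cont_cst|exact: cont_id]. Qed.

Lemma cont_der f f' : (forall x, has_der f x (f' x)) -> continuous f.
Proof. by move=> h x; exact: der_cont (h x). Qed.

Lemma cont_phase L be ga al : continuous (phase L be ga al : R -> R).
Proof.
rewrite /phase; apply: cont_add; last exact: cont_cst.
apply: cont_mul; first exact: cont_cst.
apply: cont_add; last exact: cont_cst.
apply: cont_add; last by apply: cont_opp; exact: cont_mulc.
by apply: cont_mul; [exact: cont_id|exact: sqrt_continuous].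
Qed.

End Continuity.

Ltac cont := lazymatch goal with
  | |- continuous (fun _ => ?c) => exact: cont_cst
  | |- continuous (fun y => y) => exact: cont_id
  | |- continuous ( *%R ?c) => exact: cont_mulc
  | |- continuous (phase _ _ _ _) => exact: cont_phase
  | |- continuous (fun y => phase _ _ _ _ y) => exact: cont_phase
  | |- continuous (fun y => cos (@?f y)) => apply: (@cont_cos _ f); cont
  | |- continuous (fun y => sin (@?f y)) => apply: (@cont_sin _ f); cont
  | |- continuous (fun y => Num.sqrt (@?f y)) => apply: (@cont_sqrt _ f); cont
  | |- continuous (fun y => - (@?f y)) => apply: (@cont_opp _ f); cont
  | |- continuous (fun y => @?f y + @?g y) => apply: (@cont_add _ f g); cont
  | |- continuous (fun y => @?f y * @?g y) => apply: (@cont_mul _ f g); cont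
  | _ => eassumption
  end.

(** * Twice differentiable weights and integrals without a stationary point *)

Section Bump.
Context {R : realType}.
Implicit Types (w f g : R -> R) (a b c K L x be ga al M t u : R).

(** Two derivatives allow two integrations by parts, whose boundary terms vanish with [w] and [w1]
    at the end points; two is also what the cubes in [bump_majorant] have. One common bound [M]
    keeps the constants simple. *)
Record bumpC2 w w1 w2 a b M : Prop := Bump {
  bump_ab : a < b;
  bump_der1 : forall x, has_der w x (w1 x);
  bump_der2 : forall x, has_der w1 x (w2 x);
  bump_le0 : forall x, `|w x| <= M;
  bump_le1 : forall x, `|w1 x| <= M;
  bump_le2 : forall x, `|w2 x| <= M;
  bump_out0 : forall x, ~~ (a < x < b) -> w x = 0;
  bump_out1 : forall x, ~~ (a < x < b) -> w1 x = 0 }.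

Lemma bump_M w w1 w2 a b M : bumpC2 w w1 w2 a b M -> 0 <= M.
Proof. by move=> h; exact: le_trans (bump_le0 h 0). Qed.

Lemma bump_cont w w1 w2 a b M : bumpC2 w w1 w2 a b M -> continuous w.
Proof. by move=> h; exact: cont_der (bump_der1 h). Qed.

Lemma bump_ends w w1 w2 a b M : bumpC2 w w1 w2 a b M ->
  [/\ w a = 0, w b = 0, w1 a = 0 & w1 b = 0].
Proof.
move=> h; split; first [apply: (bump_out0 h) | apply: (bump_out1 h)];
  by rewrite ltxx // andbF.
Qed.

Lemma cos_Lip (x y : R) : `|cos y - cos x| <= `|y - x|.
Proof.
have := @der_lip R cos (fun x => - sin x) (Num.min x y) (Num.max x y) 1 x y.
rewrite mul1r; apply.
- by move=> z _; exact: is_derive_cos.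
- by move=> z _; rewrite normrN sin_max.
- by rewrite ge_min le_max lexx.
- by rewrite ge_min le_max lexx !orbT.
Qed.

Lemma sin_Lip (x y : R) : `|sin y - sin x| <= `|y - x|.
Proof.
by rewrite -(cosBpihalf y) -(cosBpihalf x); apply: le_trans (cos_Lip _ _) _;
  rewrite opprD addrACA opprK addNr addr0.
Qed.

Lemma cos_taylor (A u : R) : `|cos (A + u) - cos A + u * sin A| <= u ^+ 2.
Proof.
wlog u0 : A u / 0 <= u.
  move=> hw; case: (leP 0 u) => [|/ltW] u0; first exact: hw.
  have := hw (- A) (- u); rewrite oppr_ge0 -opprD !cosN sinN mulrNN sqrrN.
  by apply.
have := @der_close R (fun u => cos (A + u) + u * sin A) (fun u => - sin (A + u) + sin A)
  (fun=> 0) (fun=> 0) (fun u => u ^+ 2) (fun u => 2 * u) 0 u u0.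
rewrite !addr0 mul0r addr0 expr0n /= !subr0 [in X in _ -> X]addrAC; apply.
- by move=> x _; der; ring.
- by move=> x _; exact: der_cst.
- by move=> x _; der; ring.
- move=> x /andP[x0 _]; rewrite subr0 addrC -[_ - _]opprB normrN.
  apply: le_trans (sin_Lip _ _) _.
  by rewrite addrAC subrr add0r ger0_norm // ler_peMl // ler1n.
Qed.

Lemma fourier_decay w w1 w2 a b M L al : bumpC2 w w1 w2 a b M -> 0 < L ->
  `|itg a b (fun x => w x * cos (L * x + al))| <= M * (b - a) / L ^+ 2.
Proof.
move=> hw L0; have ab := bump_ab hw; have [wa wb w1a w1b] := bump_ends hw.
have cw := bump_cont hw.
apply: osc_itg; [exact: ltW|by cont|].
exists (fun x => w x * sin (L * x + al) / L + w1 x * cos (L * x + al) / L ^+ 2),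
 (fun x => w x * cos (L * x + al) + w2 x * cos (L * x + al) / L ^+ 2),
 (fun x => M / L ^+ 2 * x), (fun=> M / L ^+ 2); split.
- move=> x _; have h1 := bump_der1 hw x; have h2 := bump_der2 hw x.
  by der; field; exact: lt0r_neq0.
- by move=> x _; exact: der_mulc.
- move=> x _; rewrite opprD addrA subrr add0r normrN normrM normfV normrX (gtr0_norm L0).
  rewrite ler_wpM2r ?invr_ge0 ?exprn_ge0 ?(ltW L0) // -[M]mulr1.
  by apply: norm_mul_le; [exact: bump_le2 hw x|exact: cos_max].
- by rewrite wa wb w1a w1b !mul0r !addr0 subrr normr0 add0r -mulrBr mulrAC.
Qed.

(** In [phase_tail], [r] bounds the reciprocal of [dphase], [A] and [B] bound its first and second
    derivatives, and the factor 4 comes from [|dphase| >= |be| / 2]. *)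
Definition tail_const a b M : R :=
  let r := 2 / (3 * Num.sqrt b) in let A := 3 / 4 / Num.sqrt a in
  let B := 3 / 8 / (a * Num.sqrt a) in
  4 * (M * (1 + 3 * A * r + B * r + 3 * A ^+ 2 * r ^+ 2)) * (b - a).

(** As [3 / 2 * Num.sqrt x <= |be| / 2] on the support, [dphase] never gets below [|be| / 2] in
    absolute value. Two integrations by parts then gain [(L be)^2]. *)
Lemma phase_tail w w1 w2 a b M L be ga al : bumpC2 w w1 w2 a b M -> 0 < a -> 0 < L ->
  3 * Num.sqrt b <= `|be| ->
  `|itg a b (fun x => w x * cos (phase L be ga al x))| <= tail_const a b M / (L * be) ^+ 2.
Proof.
move=> hw a0 L0 hbe; have ab := bump_ab hw; have [wa wb w1a w1b] := bump_ends hw.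
have cw := bump_cont hw; have M0 := bump_M hw.
have b0 : 0 < b by exact: lt_trans ab.
have sb0 : 0 < Num.sqrt b by rewrite sqrtr_gt0.
have sa0 : 0 < Num.sqrt a by rewrite sqrtr_gt0.
have be0 : 0 < `|be| by apply: lt_le_trans hbe; rewrite mulr_gt0.
have be1 : be != 0 by rewrite -normr_gt0.
have pos x : a <= x <= b -> 0 < x by move=> /andP[h _]; exact: lt_le_trans h.
have hp x : a <= x <= b -> `|be| / 2 <= `|dphase be x|.
  move=> /andP[_ xb]; rewrite /dphase distrC.
  apply: le_trans (lerB_dist _ _).
  rewrite [X in _ - X]ger0_norm ?mulr_ge0 ?sqrtr_ge0 //.
  have : Num.sqrt x <= Num.sqrt b by rewrite ler_wsqrtr.
  lra.
have p0 x : a <= x <= b -> dphase be x != 0.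
  by move=> hx; rewrite -normr_gt0; apply: lt_le_trans (hp x hx); rewrite divr_gt0.
pose u x := (dphase be x)^-1.
pose p' x := 3 / 4 / Num.sqrt x.
pose p2 x := - (3 / 8) / (x * Num.sqrt x).
(* The amplitude that remains after the second integration by parts, with [u] the reciprocal of
   [dphase], and [p'], [p2] its first two derivatives. *)
pose E x := w2 x * u x ^+ 2 - 3 * w1 x * p' x * u x ^+ 3 - w x * p2 x * u x ^+ 3
   + 3 * w x * p' x ^+ 2 * u x ^+ 4.
pose r := 2 / (3 * Num.sqrt b); pose A := 3 / 4 / Num.sqrt a.
pose B := 3 / 8 / (a * Num.sqrt a).
pose K := M * (1 + 3 * A * r + B * r + 3 * A ^+ 2 * r ^+ 2).
pose D := K * (4 / (L * be) ^+ 2).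
apply: osc_itg; [exact: ltW|by cont|].
exists (fun x => w x * u x * sin (phase L be ga al x) / L
      + (w1 x * u x ^+ 2 - w x * p' x * u x ^+ 3) * cos (phase L be ga al x) / L ^+ 2),
 (fun x => w x * cos (phase L be ga al x) + E x * cos (phase L be ga al x) / L ^+ 2),
 (fun x => D * x), (fun=> D); split.
- move=> x hx; have h1 := bump_der1 hw x; have h2 := bump_der2 hw x.
  have x0 := pos _ hx; have s0 : 0 < Num.sqrt x by rewrite sqrtr_gt0.
  have h3 := der_dphase be x0; rewrite -/(p' x) in h3.
  have h4 := der_phase L be ga al x0.
  have q0 := p0 x hx.
  have h5 : has_der u x (- p' x * u x ^+ 2) by rewrite /u; der; field.
  have h6 : has_der p' x (p2 x).
    have sn0 : Num.sqrt x != 0 by exact: lt0r_neq0.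
    have xs : x = Num.sqrt x ^+ 2 by rewrite sqr_sqrtr // ltW.
    by rewrite /p' /p2; der; rewrite [in RHS]xs sqrtr_sqr ger0_norm ?(ltW s0) //; field.
  der; rewrite /E; have e : dphase be x = (u x)^-1 by rewrite /u invrK.
  have un0 : u x != 0 by rewrite /u invr_eq0.
  by rewrite e; field; rewrite un0 lt0r_neq0.
- by move=> x _; exact: der_mulc.
- move=> x hx; have x0 := pos _ hx; have s0 : 0 < Num.sqrt x by rewrite sqrtr_gt0.
  have /andP[ax xb] := hx.
  have sax : Num.sqrt a <= Num.sqrt x by rewrite ler_wsqrtr.
  rewrite opprD addrA subrr add0r normrN normrM normfV normrX (gtr0_norm L0).
  have hu : `|u x| <= 2 / `|be|.
    rewrite /u normfV -[2 / _]invf_div lef_pV2 ?posrE ?hp ?divr_gt0 //.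
    by rewrite normr_gt0 p0.
  have hr : `|u x| <= r.
    apply: le_trans hu _; rewrite /r ler_pM2l // lef_pV2 ?posrE //.
    by rewrite mulr_gt0.
  have hA : `|p' x| <= A.
    rewrite /p' /A ger0_norm ?divr_ge0 // ?(ltW s0) //.
    by rewrite ler_pM2l // lef_pV2 ?posrE.
  have hB : `|p2 x| <= B.
    rewrite /p2 /B mulNr normrN ger0_norm ?divr_ge0 ?mulr_ge0 // ?(ltW s0) ?(ltW x0) //.
    rewrite ler_pM2l // lef_pV2 ?posrE ?mulr_gt0 //.
    by rewrite ler_pM // ltW.
  have A0 : 0 <= A by exact: le_trans hA.
  have B0 : 0 <= B by exact: le_trans hB.
  have r0 : 0 <= r by exact: le_trans hr.
  have hE : `|E x| <= K * (2 / `|be|) ^+ 2.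
    have -> : E x = (w2 x + - (3 * w1 x * p' x * u x) + - (w x * p2 x * u x)
      + 3 * w x * p' x ^+ 2 * u x ^+ 2) * u x ^+ 2 by rewrite /E; ring.
    apply: norm_mul_le; last by rewrite normrX lerXn2r ?nnegrE // divr_ge0 // ltW.
    rewrite /K !mulrDr mulr1.
    apply: norm_add_le; first apply: norm_add_le; first apply: norm_add_le.
    + exact: bump_le2 hw x.
    + rewrite normrN (_ : M * (3 * A * r) = 3 * M * A * r); last by ring.
      apply: norm_mul_le => //; apply: norm_mul_le => //.
      by apply: norm_mul_le; [rewrite ger0_norm|exact: bump_le1 hw x].
    + rewrite normrN (_ : M * (B * r) = M * B * r); last by ring.
      apply: norm_mul_le => //; apply: norm_mul_le => //.
      exact: bump_le0 hw x.
    + rewrite (_ : M * (3 * A ^+ 2 * r ^+ 2) = 3 * M * A ^+ 2 * r ^+ 2); last by ring.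
      apply: norm_mul_le; last by rewrite normrX lerXn2r ?nnegrE.
      apply: norm_mul_le; last by rewrite normrX lerXn2r ?nnegrE.
      by apply: norm_mul_le; [rewrite ger0_norm|exact: bump_le0 hw x].
  apply: (@le_trans _ _ (K * (2 / `|be|) ^+ 2 / L ^+ 2)).
    rewrite ler_wpM2r ?invr_ge0 ?exprn_ge0 ?(ltW L0) //.
    by rewrite -[leRHS]mulr1; apply: norm_mul_le => //; exact: cos_max.
  rewrite /D -mulrA ler_wpM2l //.
    rewrite /K mulr_ge0 //; have h1 := mulr_ge0 A0 r0; have h2 := mulr_ge0 B0 r0.
    have h3 := sqr_ge0 (A * r); lra.
  rewrite expr_div_n (real_normK (num_real be)) le_eqVlt; apply/orP; left; apply/eqP.
  by field; rewrite be1 lt0r_neq0.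
- rewrite wa wb w1a w1b !(mul0r, subr0, addr0) normr0 add0r -mulrBr /D.
  by rewrite /tail_const -/r -/A -/B -/K le_eqVlt; apply/orP; left; apply/eqP; ring.
Qed.

End Bump.

(** * Stationary phase integrals and their dependence on the frequency *)

Section Stationary.
Context {R : realType}.
Implicit Types (w f g : R -> R) (a b c K L x be ga al M t u B : R).

(* With [y0 = 2 be / 3] the phase [x^(3/2) - be x + 4 be^3 / 27] vanishes at its
   stationary point [x = y0^2]. *)
Definition statint w a b L al be : R :=
  itg a b (fun x => w x * cos (phase L be (4 / 27 * be ^+ 3) al x)).

(** The derivative of [statint] in [be]. Owing to the normalisation of the phase the new factor
    [x - 4/9 be^2] vanishes at the stationary point, which compensates the factor [L]. *)
Definition dstatint w a b L al be : R :=
  itg a b (fun x => w x * (L * (x - 4 / 9 * be ^+ 2) *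
    sin (phase L be (4 / 27 * be ^+ 3) al x))).

Lemma taylor_split (W c0 c1 s L D Q t : R) :
  W * c1 - W * c0 - t * (W * (L * (- D) * s)) =
  W * ((c1 - c0 + L * (t * D + t ^+ 2 * Q) * s) - L * (t ^+ 2 * Q) * s).
Proof. ring. Qed.

(** [cos_taylor] bounds the second order remainder of the integrand uniformly in [x], so that
    [der_quad] applies to the integral. *)
Lemma statint_der w w1 w2 a b M L al be : bumpC2 w w1 w2 a b M -> 0 < L ->
  has_der (statint w a b L al) be (dstatint w a b L al be).
Proof.
move=> hw L0; have ab := bump_ab hw; have cw := bump_cont hw; have M0 := bump_M hw.
pose X := `|a| + `|b|.
pose K1 := X + 4 / 9 * be ^+ 2; pose K2 := 4 / 9 * `|be| + 4 / 27.
pose C := M * (L ^+ 2 * (K1 + K2) ^+ 2 + L * K2).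
apply: (@der_quad _ _ _ _ (C * (b - a))) => t t1.
rewrite /statint /dstatint -itgB; [|by cont..].
rewrite -itgZ; last by cont.
rewrite -itgB; [|by cont..].
have h : C * (b - a) * t ^+ 2 = C * t ^+ 2 * (b - a) by ring.
rewrite h; apply: itg_bound; [exact: ltW|by cont|] => x /andP[ax xb].
pose A := phase L be (4 / 27 * be ^+ 3) al x.
pose D := - (x - 4 / 9 * be ^+ 2); pose Q := 4 / 9 * be + 4 / 27 * t.
have e : phase L (be + t) (4 / 27 * (be + t) ^+ 3) al x = A + L * (t * D + t ^+ 2 * Q).
  by rewrite /A /phase /D /Q; field.
rewrite e -/A.
have -> : x - 4 / 9 * be ^+ 2 = - D by rewrite opprK.
rewrite (taylor_split _ _ _ _ _ _ Q).
rewrite (_ : C * t ^+ 2 = M * ((L ^+ 2 * (K1 + K2) ^+ 2 + L * K2) * t ^+ 2)); last first.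
  by rewrite /C mulrA.
apply: norm_mul_le; first exact: bump_le0 hw x.
have hD : `|D| <= K1.
  rewrite /D normrN; apply: norm_add_le; last by rewrite normrN ger0_norm // mulr_ge0 // sqr_ge0.
  rewrite /X ler_norml; apply/andP; split.
    have := ler_norm (- a); rewrite normrN => h1; have := normr_ge0 b; lra.
  by have := ler_norm b => h1; have := normr_ge0 a; lra.
have hQ : `|Q| <= K2.
  rewrite /Q /K2; apply: norm_add_le; first by rewrite normrM ger0_norm.
  by rewrite normrM ger0_norm // ler_piMr.
have hu : `|L * (t * D + t ^+ 2 * Q)| <= L * (K1 + K2) * `|t|.
  have -> : L * (t * D + t ^+ 2 * Q) = L * (D + t * Q) * t by ring.
  rewrite normrM ler_wpM2r //; apply: norm_mul_le; first by rewrite ger0_norm // ltW.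
  apply: norm_add_le => //; rewrite -[K2]mul1r; exact: norm_mul_le.
rewrite [leRHS]mulrDl; apply: norm_add_le.
  apply: le_trans (cos_taylor _ _) _.
  rewrite -(real_normK (num_real _)).
  apply: (@le_trans _ _ ((L * (K1 + K2) * `|t|) ^+ 2)).
    by rewrite lerXn2r // nnegrE // (le_trans (normr_ge0 _) hu).
  by rewrite !exprMn (real_normK (num_real _)).
rewrite normrN -[leRHS]mulr1; apply: norm_mul_le; last exact: sin_max.
rewrite -mulrA; apply: norm_mul_le; first by rewrite ger0_norm // ltW.
by rewrite mulrC; apply: norm_mul_le => //; rewrite ger0_norm // sqr_ge0.
Qed.

Lemma statint_bound w w1 w2 a b M L al be : bumpC2 w w1 w2 a b M -> 0 < a -> 0 < L ->
  `|statint w a b L al be| <= osc_const a b * (M + M) / Num.sqrt L.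
Proof.
move=> hw a0 L0; have ab := bump_ab hw; have [wa wb _ _] := bump_ends hw.
have cw := bump_cont hw.
apply: osc_itg; [exact: ltW|by cont|].
apply: osc_second => // x _; [exact: (bump_der1 hw)|exact: (bump_le0 hw)|exact: (bump_le1 hw)].
Qed.

Definition lip_const a b M B : R :=
  osc_const a b * (M * (2 * (Num.sqrt b + 2 / 3 * B + 1 + (Num.sqrt a)^-1
     + (a * Num.sqrt a)^-1))).

(** Factoring [x - 4/9 be^2] as [(Num.sqrt x - 2/3 be) * s x], the first factor is
    [2/3 * dphase be x]. Together with [L] and the sine it is an exact derivative of a cosine; one
    integration by parts removes [L] and leaves an integral for [osc_second]. So [statint] has a
    Lipschitz constant of the same order [L^(-1/2)] as its size, as partial summation demands. *)
Lemma dstatint_bound w w1 w2 a b M L al be B : bumpC2 w w1 w2 a b M -> 0 < a -> 0 < L ->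
  `|be| <= B -> `|dstatint w a b L al be| <= lip_const a b M B / Num.sqrt L.
Proof.
move=> hw a0 L0 hB; have ab := bump_ab hw; have [wa wb w1a w1b] := bump_ends hw.
have cw := bump_cont hw; have M0 := bump_M hw.
have b0 : 0 < b by exact: lt_trans ab.
have sb0 : 0 < Num.sqrt b by rewrite sqrtr_gt0.
have sa0 : 0 < Num.sqrt a by rewrite sqrtr_gt0.
have B0 : 0 <= B by exact: le_trans hB.
apply: osc_itg; [exact: ltW|by cont|].
have pos x : a <= x <= b -> 0 < x by move=> /andP[h _]; exact: lt_le_trans h.
pose ph := phase L be (4 / 27 * be ^+ 3) al.
pose s x := Num.sqrt x + 2 / 3 * be.
pose g x := w x * s x.
pose s' x := (2 * Num.sqrt x)^-1.
pose g1 x := w1 x * s x + w x * s' x.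
pose s2 x := - (4 * (x * Num.sqrt x))^-1.
pose g2 x := w2 x * s x + 2 * w1 x * s' x + w x * s2 x.
have ds x : 0 < x -> has_der s x (s' x) by move=> x0; rewrite /s /s'; der; ring.
have ds' x : 0 < x -> has_der s' x (s2 x).
  move=> x0; have s0 : 0 < Num.sqrt x by rewrite sqrtr_gt0.
  have sn0 : Num.sqrt x != 0 by exact: lt0r_neq0.
  have sn1 : 2 * Num.sqrt x != 0 by rewrite mulf_neq0.
  have xs : x = Num.sqrt x ^+ 2 by rewrite sqr_sqrtr // ltW.
  by rewrite /s' /s2; der; rewrite [in RHS]xs sqrtr_sqr ger0_norm ?(ltW s0) //; field.
have dg x : 0 < x -> has_der g x (g1 x).
  move=> x0; have h1 := bump_der1 hw x; have h2 := ds x x0.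
  by rewrite /g /g1; der; ring.
have dg1 x : 0 < x -> has_der g1 x (g2 x).
  move=> x0; have h1 := bump_der1 hw x; have h2 := ds x x0; have h3 := bump_der2 hw x.
  by have h4 := ds' x x0; rewrite /g1 /g2; der; ring.
have hs x : a <= x <= b -> `|s x| <= Num.sqrt b + 2 / 3 * B.
  move=> /andP[_ xb]; apply: norm_add_le.
    by rewrite ger0_norm ?sqrtr_ge0 // ler_wsqrtr.
  by rewrite normrM ger0_norm // ler_wpM2l.
have hs' x : a <= x <= b -> `|s' x| <= (Num.sqrt a)^-1.
  move=> hx; have x0 := pos x hx; have s0 : 0 < Num.sqrt x by rewrite sqrtr_gt0.
  rewrite /s' ger0_norm ?invr_ge0 ?mulr_ge0 ?(ltW s0) // lef_pV2 ?posrE ?mulr_gt0 //.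
  apply: (@le_trans _ _ (Num.sqrt x)); first by rewrite ler_wsqrtr; case/andP: hx.
  by rewrite ler_peMl ?(ltW s0) // ler1n.
have hs2 x : a <= x <= b -> `|s2 x| <= (a * Num.sqrt a)^-1.
  move=> hx; have x0 := pos x hx; have s0 : 0 < Num.sqrt x by rewrite sqrtr_gt0.
  rewrite /s2 normrN ger0_norm ?invr_ge0 ?mulr_ge0 ?(ltW s0) ?(ltW x0) //.
  rewrite lef_pV2 ?posrE ?mulr_gt0 //.
  have /andP[ax _] := hx.
  apply: (@le_trans _ _ (x * Num.sqrt x)).
    by apply: ler_pM; [exact: ltW|exact: ltW|exact: ax|exact: ler_wsqrtr].
  by rewrite ler_peMl ?mulr_ge0 ?(ltW s0) ?(ltW x0) // ler1n.
pose S := Num.sqrt b + 2 / 3 * B; pose S' := (Num.sqrt a)^-1; pose S2 := (a * Num.sqrt a)^-1.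
have S0 : 0 <= S by rewrite addr_ge0 ?mulr_ge0 // ltW.
have S'0 : 0 <= S' by rewrite invr_ge0 ltW.
have S20 : 0 <= S2 by rewrite invr_ge0 mulr_ge0 ?ltW.
have hg1 x : a <= x <= b -> `|g1 x| <= M * (S + S').
  move=> hx; rewrite mulrDr; apply: norm_add_le.
    by apply: norm_mul_le; [exact: bump_le1 hw x|exact: hs].
  by apply: norm_mul_le; [exact: bump_le0 hw x|exact: hs'].
have hg2 x : a <= x <= b -> `|g2 x| <= M * (S + 2 * S' + S2).
  move=> hx; rewrite (mulrDr M (S + 2 * S') S2) (mulrDr M S (2 * S')).
  apply: norm_add_le; first apply: norm_add_le.
  - by apply: norm_mul_le; [exact: bump_le2 hw x|exact: hs].
  - rewrite mulrCA mulrA; apply: norm_mul_le; last exact: hs'.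
    by apply: norm_mul_le; [rewrite ger0_norm|exact: bump_le1 hw x].
  - by apply: norm_mul_le; [exact: bump_le0 hw x|exact: hs2].
have g1a : g1 a = 0 by rewrite /g1 wa w1a !mul0r addr0.
have g1b : g1 b = 0 by rewrite /g1 wb w1b !mul0r addr0.
have h1 : osc (fun x => 2 / 3 * (g1 x * cos (ph x))) a b
   (`|2 / 3| * (osc_const a b * (M * (S + S') + M * (S + 2 * S' + S2)) / Num.sqrt L)).
  apply: osc_scale; apply: osc_second => // x hx; first by apply: dg1; exact: pos.
  - exact: hg2.
have h2 : osc (fun x => - (2 / 3) * (g1 x * cos (ph x) - g x * (L * dphase be x) * sin (ph x))) a b
   (`|- (2 / 3)| * 0).
  apply: osc_scale; apply: (@osc_primitive _ _ (fun x => g x * cos (ph x))); last first.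
    by rewrite /g wa wb !mul0r subrr normr0.
  move=> x /pos x0; have k1 := dg x x0; have k2 := der_phase L be (4 / 27 * be ^+ 3) al x0.
  by rewrite -/ph in k2; der; ring.
apply: osc_le (osc_eq _ (osc_add h1 h2)); last first.
  move=> x /pos x0; rewrite /g /s /dphase.
  rewrite -/ph (_ : x - _ = Num.sqrt x ^+ 2 - 4 / 9 * be ^+ 2); last by rewrite sqr_sqrtr // ltW.
  by field.
rewrite mulr0 addr0 mulrA ler_wpM2r ?invr_ge0 ?sqrtr_ge0 // ger0_norm //.
have oc : 0 <= osc_const a b.
  rewrite /osc_const; apply: addr_ge0; last by rewrite subr_ge0 ltW.
  apply: mulr_ge0; last by exact: pi_ge0.
  by rewrite addr_ge0 // mulr_ge0 // ltW.
rewrite mulrCA /lip_const ler_wpM2l // -mulrDr mulrCA ler_wpM2l // -/S -/S' -/S2.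
lra.
Qed.

Lemma statint_Lip w w1 w2 a b M L al B x y : bumpC2 w w1 w2 a b M -> 0 < a -> 0 < L ->
  `|x| <= B -> `|y| <= B ->
  `|statint w a b L al y - statint w a b L al x| <= lip_const a b M B / Num.sqrt L * `|y - x|.
Proof.
move=> hw a0 L0; rewrite (ler_norml x) (ler_norml y) => hx hy.
apply: (der_lip (f' := dstatint w a b L al) (a := - B) (b := B)) => // z hz.
  exact: statint_der hw L0.
by apply: dstatint_bound hw a0 L0 _; rewrite ler_norml.
Qed.

End Stationary.

(** * Poisson summation *)

Section Trig.
Context {R : realType}.
Implicit Types (x y t u A : R) (m n K : nat).

Lemma cos_lower x : 1 - x ^+ 2 <= cos x.
Proof.
have := cos_taylor (0 : R) x; rewrite add0r cos0 sin0 mulr0 addr0 ler_norml => /andP[h _].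
lra.
Qed.

(** Up to [1 / 2] the derivative is at least [1 - x^2 >= 1 / 2]; beyond,
    [sin x >= sin (1 / 2) >= 1 / 4] while [x < 2]. *)
Lemma sin_lower x : 0 <= x <= pi / 2 -> x / 8 <= sin x.
Proof.
have pi2 := pihalf_lt2 R; have pi1 := pihalf_ge1 R.
move=> /andP[x0 xpi].
have base y : 0 <= y <= 1 / 2 -> y / 2 <= sin y.
  move=> /andP[y0 y1].
  have h : sin 0 - 0 / 2 <= sin y - y / 2.
    apply: (der_mono (f := fun z => sin z - z / 2) (f' := fun z => cos z - 1 / 2) y0).
      move=> z _; have hz : has_der sin z (cos z) by exact: is_derive_sin.
      by der; field.
    move=> z /andP[z0 zy]; have hz := cos_lower z.
    have : z ^+ 2 <= (1 / 2) ^+ 2 by rewrite lerXn2r // ?nnegrE //; lra.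
    lra.
  move: h; rewrite sin0; lra.
case: (leP x (1 / 2)) => hx.
  have : x / 2 <= sin x by apply: base; rewrite x0.
  lra.
have h1 := base (1 / 2); rewrite lexx divr_ge0 // in h1; move: h1 => /(_ isT) h1.
have h2 : sin (1 / 2) < sin x.
  by rewrite ltr_sin // in_itv /=; apply/andP; split; lra.
lra.
Qed.

Lemma sinpi_lower x : `|x| <= 1 / 2 -> `|x| / 4 <= `|sin (pi * x)|.
Proof.
wlog x0 : x / 0 <= x.
  move=> hw; case: (leP 0 x) => [|/ltW] x0; first exact: hw.
  by have := hw (- x); rewrite mulrN sinN !normrN oppr_ge0; apply.
rewrite ger0_norm // => hx; apply: le_trans (ler_norm _).
have pi2 := pi_ge2 R; have pi0 := pi_ge0 R.
have h : pi * x / 8 <= sin (pi * x).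
  apply: sin_lower; rewrite mulr_ge0 //=.
  by have := ler_wpM2l pi0 hx; lra.
apply: le_trans h; have := ler_wpM2r x0 pi2; lra.
Qed.

Lemma geometric_cos A t m :
  2 * sin (t / 2) * (\sum_(j < m) cos (A + j%:R * t)) =
  sin (A + m%:R * t - t / 2) - sin (A - t / 2).
Proof.
elim: m => [|m ih]; first by rewrite big_ord0 mulr0 mul0r addr0 subrr.
rewrite big_ord_recr /= mulrDr ih.
have -> : A + m.+1%:R * t - t / 2 = (A + m%:R * t) + t / 2 by rewrite mulrS; field.
rewrite (sinD (A + m%:R * t) (t / 2)) (sinB (A + m%:R * t) (t / 2)).
move: (sin (t / 2)) (cos (t / 2)) (cos _) (sin (A + _)) (sin _) => a b c d e; ring.
Qed.

Lemma geometric_bound A t m :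
  `|sin (t / 2)| * `|\sum_(j < m) cos (A + j%:R * t)| <= 1.
Proof.
have := geometric_cos A t m; move: (\sum_(j < m) _) => S e.
have : `|2 * sin (t / 2) * S| <= 1 + 1.
  rewrite e; apply: norm_add_le; rewrite ?normrN; exact: sin_max.
rewrite !normrM ger0_norm // -mulrA => h; lra.
Qed.

Definition dirichlet m t : R := \sum_(i < (m + m).+1) cos ((i%:R - m%:R) * t).

Lemma dirichletS m t : dirichlet m.+1 t = dirichlet m t + 2 * cos (m.+1%:R * t).
Proof.
rewrite /dirichlet addSn addnS big_ord_recr big_ord_recl /= sub0r mulNr cosN.
rewrite (eq_bigr (fun i : 'I_(m + m).+1 => cos ((i%:R - m%:R) * t))); last first.
  by move=> i _; congr (cos (_ * t)); rewrite /bump /= add1n !mulrSr; ring.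
rewrite (_ : (m + m).+2%:R - m.+1%:R = m.+1%:R :> R); last first.
  by rewrite !mulrSr natrD; ring.
by move: (cos _) (\sum_(i < _) _) => a b; ring.
Qed.

Definition fejer K t : R :=
  K%:R^-1 * ((\sum_(j < K) cos (j%:R * t)) ^+ 2 + (\sum_(j < K) sin (j%:R * t)) ^+ 2).

Lemma dirichlet_conv m t :
  \sum_(j < m) (cos (j%:R * t) * cos (m%:R * t) + sin (j%:R * t) * sin (m%:R * t)) =
  \sum_(j < m) cos (j.+1%:R * t).
Proof.
rewrite (reindex_inj rev_ord_inj) /=; apply: eq_bigr => j _.
rewrite -cosB -cosN opprB -mulrBl; congr (cos (_ * t)).
by rewrite natrB ?ltn_ord //; ring.
Qed.

Lemma dirichletE m t : dirichlet m t = 1 + 2 * \sum_(j < m) cos (j.+1%:R * t).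
Proof.
elim: m => [|m ih].
  by rewrite /dirichlet big_ord_recr !big_ord0 /= subrr mul0r cos0 add0r mulr0 addr0.
by rewrite dirichletS ih big_ord_recr /= mulrDr addrA.
Qed.

Lemma fejerE K t : fejer K t = K%:R^-1 * \sum_(m < K) dirichlet m t.
Proof.
congr (_ * _); elim: K => [|K ih]; first by rewrite !big_ord0 expr0n addr0.
rewrite !big_ord_recr /= -ih dirichletE -dirichlet_conv big_split /= -!mulr_suml.
have := cos2Dsin2 (K%:R * t).
move: (cos _) (sin _) (\sum_(i < K) _) (\sum_(i < K) _) => c s C S e.
transitivity (C ^+ 2 + S ^+ 2 + (c ^+ 2 + s ^+ 2 + 2 * (S * c + C * s))); first by ring.
by rewrite e; ring.
Qed.

Lemma fejer_ge0 K t : 0 <= fejer K t.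
Proof. by rewrite mulr_ge0 ?invr_ge0 // addr_ge0 // sqr_ge0. Qed.

(** Each of the two geometric sums in [fejer] is at most [4 / |x|], by [geometric_bound] and
    [sinpi_lower]; their squares add up to [32 / x^2]. *)
Lemma fejer_upper K x : (0 < K)%N -> `|x| <= 1 / 2 ->
  x ^+ 2 * fejer K (2 * pi * x) <= 32 / K%:R.
Proof.
move=> K0 hx; have K0' : 0 < K%:R :> R by rewrite ltr0n.
rewrite /fejer mulrCA mulrC ler_pM2r ?invr_gt0 //.
have hs := sinpi_lower hx.
have e : 2 * pi * x / 2 = pi * x by field.
have h1 (A : R) : `|x| * `|\sum_(j < K) cos (A + j%:R * (2 * pi * x))| <= 4.
  have := geometric_bound A (2 * pi * x) K; rewrite e.
  move: (`|\sum_(j < K) _|) (normr_ge0 (\sum_(j < K) cos (A + j%:R * (2 * pi * x)))) => S S0 h.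
  have := ler_wpM2r S0 hs; lra.
have h2 : (x * (\sum_(j < K) cos (j%:R * (2 * pi * x)))) ^+ 2 <= 4 ^+ 2.
  rewrite -(real_normK (num_real _)) normrM lerXn2r ?nnegrE ?mulr_ge0 //.
  apply: le_trans (h1 0); rewrite ler_wpM2l // le_eqVlt; apply/orP; left; apply/eqP.
  by congr (`|_|); apply: eq_bigr => j _; rewrite add0r.
have h3 : (x * (\sum_(j < K) sin (j%:R * (2 * pi * x)))) ^+ 2 <= 4 ^+ 2.
  rewrite -(real_normK (num_real _)) normrM lerXn2r ?nnegrE ?mulr_ge0 //.
  apply: le_trans (h1 (- (pi / 2))); rewrite ler_wpM2l // le_eqVlt; apply/orP; left; apply/eqP.
  by congr (`|_|); apply: eq_bigr => j _; rewrite addrC cosBpihalf.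
move: h2 h3; rewrite !exprMn => h2 h3; lra.
Qed.

Lemma cos_period x n : cos (x + n%:R * (2 * pi)) = cos x.
Proof.
elim: n => [|n ih]; first by rewrite mul0r addr0.
have e : 2 * pi = pi *+ 2 :> R by rewrite mulr_natl.
by rewrite mulrSr mulrDl mul1r addrA [X in _ + X]e cosD2pi.
Qed.

Lemma sin_period x n : sin (x + n%:R * (2 * pi)) = sin x.
Proof. by rewrite -!cosBpihalf addrAC cos_period. Qed.

Lemma fejer_period K t n : fejer K (t + n%:R * (2 * pi)) = fejer K t.
Proof.
rewrite /fejer; congr (_ * (_ ^+ 2 + _ ^+ 2)); apply: eq_bigr => j _.
  by rewrite mulrDr mulrA -natrM cos_period.
by rewrite mulrDr mulrA -natrM sin_period.
Qed.

End Trig.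

Section Poisson.
Context {R : realType}.
Implicit Types (f g : R -> R) (a b c d e x y t u L M B : R) (m n K : nat).

Lemma cont_sum n (f : nat -> R -> R) : (forall i, continuous (f i)) ->
  continuous (fun x => \sum_(i < n) f i x).
Proof.
move=> cf; elim: n => [|n ih].
  rewrite (_ : (fun x => _) = (fun=> 0)); first exact: cont_cst.
  by apply/funext => x; rewrite big_ord0.
rewrite (_ : (fun x => _) = (fun x => \sum_(i < n) f i x + f n x)); first exact: cont_add.
by apply/funext => x; rewrite big_ord_recr.
Qed.

Lemma itg_cst c a b : a <= b -> itg a b (fun=> c) = c * (b - a).
Proof.
move=> ab; rewrite (@itg_der _ _ ( *%R c)) ?mulrBr //; first exact: cont_cst.
by move=> x _; exact: der_mulc.
Qed.

Lemma itg_sum n (f : nat -> R -> R) a b : (forall i, continuous (f i)) -> a <= b ->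
  itg a b (fun x => \sum_(i < n) f i x) = \sum_(i < n) itg a b (f i).
Proof.
move=> cf ab; elim: n => [|n ih].
  rewrite big_ord0 -[RHS](mul0r (b - a)) -itg_cst //.
  by apply: itg_eq => x _; rewrite big_ord0.
rewrite big_ord_recr /= -ih -itgD //; last exact: cont_sum.
by apply: itg_eq => x _; rewrite big_ord_recr.
Qed.

Lemma itg_split f c m : continuous f ->
  itg c (c + m%:R) f = \sum_(i < m) itg (c + i%:R) (c + i%:R + 1) f.
Proof.
move=> cf; elim: m => [|m ih].
  by rewrite big_ord0 addr0 /itg set_itv1 Rintegral_set1.
rewrite big_ord_recr /= -ih mulrSr addrA; apply: itg_cat => //.
  by rewrite lerDl.
by rewrite lerDl.
Qed.

Lemma cont_fejer K : continuous (fun x => fejer K (2 * pi * x)).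
Proof.
have cc : continuous (fun x : R => \sum_(j < K) cos (j%:R * (2 * pi * x))).
  by apply: (@cont_sum _ (fun j x => cos (j%:R * (2 * pi * x)))) => j; cont.
have cs : continuous (fun x : R => \sum_(j < K) sin (j%:R * (2 * pi * x))).
  by apply: (@cont_sum _ (fun j x => sin (j%:R * (2 * pi * x)))) => j; cont.
have := cont_mul (@cont_cst R K%:R^-1) (cont_add (cont_mul cc cc) (cont_mul cs cs)).
by under eq_fun do rewrite -!expr2.
Qed.

Lemma itg_cos_period n : itg (- (1 / 2)) (1 / 2) (fun x => cos (n.+1%:R * (2 * pi * x))) = 0 :> R.
Proof.
have p0 := pi_gt0 R.
have c0 : n.+1%:R * (2 * pi) != 0 :> R by rewrite !mulf_neq0 // ?pnatr_eq0 // gt_eqF.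
rewrite (@itg_der _ _ (fun x => sin (n.+1%:R * (2 * pi) * x) / (n.+1%:R * (2 * pi)))).
- have -> : n.+1%:R * (2 * pi) * (1 / 2) = n.+1%:R * (2 * pi) * (- (1 / 2)) + n.+1%:R * (2 * pi) :> R.
    by field.
  by rewrite sin_period subrr.
- lra.
- by cont.
- move=> x _; rewrite (mulrA _ _ x); move: (_ * (2 * pi)) c0 => c c0.
  by der; move: (cos _) => C; field.
Qed.

Lemma itg_fejer K : (0 < K)%N -> itg (- (1 / 2)) (1 / 2) (fun x => fejer K (2 * pi * x)) = 1 :> R.
Proof.
move=> K0; have h2 : - (1 / 2) <= 1 / 2 :> R by lra.
have cc (j : nat) : continuous (fun x : R => cos (j.+1%:R * (2 * pi * x))) by cont.
have cd m : continuous (fun x : R => 1 + 2 * \sum_(j < m) cos (j.+1%:R * (2 * pi * x))).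
  apply: cont_add; first exact: cont_cst.
  apply: cont_mul; first exact: cont_cst.
  exact: (@cont_sum _ (fun j x => cos (j.+1%:R * (2 * pi * x)))).
rewrite (@itg_eq _ _ (fun x => K%:R^-1 * \sum_(m < K) (1 + 2 * \sum_(j < m) cos (j.+1%:R * (2 * pi * x))))); last first.
  by move=> x _; rewrite fejerE; congr (_ * _); apply: eq_bigr => m _; rewrite dirichletE.
rewrite itgZ; last exact: (@cont_sum _ (fun m x => 1 + 2 * \sum_(j < m) cos (j.+1%:R * (2 * pi * x)))).
rewrite (@itg_sum _ (fun m x => 1 + 2 * \sum_(j < m) cos (j.+1%:R * (2 * pi * x)))) //.
rewrite (eq_bigr (fun=> 1)).
  by rewrite sumr_const card_ord mulVf // pnatr_eq0 -lt0n.
move=> m _; rewrite itgD; [|exact: cont_cst|]; last first.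
  apply: cont_mul; first exact: cont_cst.
  exact: (@cont_sum _ (fun j x => cos (j.+1%:R * (2 * pi * x)))).
rewrite itg_cst // itgZ; last exact: (@cont_sum _ (fun j x => cos (j.+1%:R * (2 * pi * x)))).
rewrite (@itg_sum _ (fun j x => cos (j.+1%:R * (2 * pi * x)))) //.
rewrite big1 ?mulr0 ?addr0; first by field.
by move=> j _; exact: itg_cos_period.
Qed.

(** The Lipschitz bound leaves the mean of [|u|] against the kernel. By [2 e |u| <= u^2 + e^2] it is
    controlled by [fejer_upper] and the unit mass, with [e] free. *)
Lemma fejer_approx g L K e x : continuous g -> (forall y z, `|g y - g z| <= L * `|y - z|) ->
  (0 < K)%N -> 0 < e ->
  `|itg (- (1 / 2)) (1 / 2) (fun u => g (x + u) * fejer K (2 * pi * u)) - g x|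
    <= L * (e / 2 + 16 / (K%:R * e)).
Proof.
move=> cg hL K0 e0; have h2 : - (1 / 2) <= 1 / 2 :> R by lra.
have K0' : 0 < K%:R :> R by rewrite ltr0n.
have L0 : 0 <= L.
  by have := hL 1 0; rewrite subr0 normr1 mulr1; exact: le_trans.
have cF := @cont_fejer K.
have cgx : continuous (fun u => g (x + u)).
  by apply: cont_comp => //; apply: cont_add; [exact: cont_cst|exact: cont_id].
have -> : g x = itg (- (1 / 2)) (1 / 2) (fun u => g x * fejer K (2 * pi * u)).
  by rewrite itgZ // itg_fejer // mulr1.
rewrite -itgB; [|exact: cont_mul|by apply: cont_mul => //; exact: cont_cst].
pose h u := L * (e / 2) * fejer K (2 * pi * u) + L * (16 / (K%:R * e)).
have ch : continuous h.
  apply: cont_add; last exact: cont_cst.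
  by apply: cont_mul => //; exact: cont_cst.
have -> : L * (e / 2 + 16 / (K%:R * e)) = itg (- (1 / 2)) (1 / 2) h.
  rewrite itgD; [|by apply: cont_mul => //; exact: cont_cst|exact: cont_cst].
  rewrite itgZ // itg_fejer // itg_cst //; field.
  by rewrite !gt_eqF.
have cd : continuous (fun u => g (x + u) * fejer K (2 * pi * u) - g x * fejer K (2 * pi * u)).
  apply: cont_add; first exact: cont_mul.
  by apply: cont_opp; apply: cont_mul => //; exact: cont_cst.
have key u : - (1 / 2) <= u <= 1 / 2 ->
    `|g (x + u) * fejer K (2 * pi * u) - g x * fejer K (2 * pi * u)| <= h u.
  move=> hu; have F0 := fejer_ge0 K (2 * pi * u).
  have hu' : `|u| <= 1 / 2 by rewrite ler_norml.
  have hF := fejer_upper K0 hu'.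
  rewrite -mulrBl normrM (ger0_norm F0).
  apply: (@le_trans _ _ (L * `|u| * fejer K (2 * pi * u))).
    by rewrite ler_wpM2r //; have := hL (x + u) x; rewrite addrAC subrr add0r.
  rewrite (_ : h u = L * (e / 2 * fejer K (2 * pi * u) + 16 / (K%:R * e))); last first.
    by rewrite /h; move: (fejer _ _) (16 / _) => F G; ring.
  rewrite -(mulrA L) ler_wpM2l //.
  move: (fejer _ _) F0 hF => F F0 hF.
  have h1 : `|u| * F * (2 * e) <= (u ^+ 2 + e ^+ 2) * F.
    rewrite -(real_normK (num_real u)).
    have := mulr_ge0 (sqr_ge0 (`|u| - e)) F0; lra.
  rewrite -(@ler_pM2r _ (2 * e)) ?mulr_gt0 //; apply: (le_trans h1).
  have -> : (e / 2 * F + 16 / (K%:R * e)) * (2 * e) = e ^+ 2 * F + 32 / K%:R.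
    by field; rewrite !gt_eqF.
  by rewrite mulrDl addrC lerD2l.
rewrite ler_norml; apply/andP; split.
  rewrite -[leLHS]mulN1r -itgZ //; apply: itg_le => //.
    by apply: cont_mul => //; exact: cont_cst.
  by move=> u /key; rewrite ler_norml mulN1r => /andP[].
by apply: itg_le => // u /key; rewrite ler_norml => /andP[].
Qed.

(** The window is a union of unit cells centred at the integers from [-n] to [n], one peak of the
    Fejér kernel in each. Cosines suffice because frequencies are summed over symmetric ranges. *)
Definition fourier_int g n c : R :=
  itg (- (n%:R + 1 / 2)) (n%:R + 1 / 2) (fun x => g x * cos (c * (2 * pi * x))).

(* Cesaro form of Poisson summation. *)
Lemma poisson_avg g L n K e : continuous g -> (forall y z, `|g y - g z| <= L * `|y - z|) ->
  (0 < K)%N -> 0 < e ->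
  `|K%:R^-1 * (\sum_(m < K) \sum_(i < (m + m).+1) fourier_int g n (i%:R - m%:R))
     - \sum_(i < (n + n).+1) g (i%:R - n%:R)| <= (n + n).+1%:R * (L * (e / 2 + 16 / (K%:R * e))).
Proof.
move=> cg hL K0 e0.
have cF := @cont_fejer K.
have lh : - (n%:R + 1 / 2) <= n%:R + 1 / 2 :> R by have := ler0n R n; lra.
have cgc c : continuous (fun x => g x * cos (c * (2 * pi * x))) by cont.
have -> : K%:R^-1 * (\sum_(m < K) \sum_(i < (m + m).+1) fourier_int g n (i%:R - m%:R)) =
   itg (- (n%:R + 1 / 2)) (n%:R + 1 / 2) (fun x => g x * fejer K (2 * pi * x)).
  transitivity (itg (- (n%:R + 1 / 2)) (n%:R + 1 / 2) (fun x =>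
     K%:R^-1 * \sum_(m < K) \sum_(i < (m + m).+1) (g x * cos ((i%:R - m%:R) * (2 * pi * x))))).
    have cs (m : nat) : continuous (fun x =>
       \sum_(i < (m + m).+1) (g x * cos ((i%:R - m%:R) * (2 * pi * x)))).
      exact: (@cont_sum _ (fun i x => g x * cos ((i%:R - m%:R) * (2 * pi * x)))).
    rewrite itgZ; last exact: (@cont_sum _ (fun m x =>
       \sum_(i < (m + m).+1) (g x * cos ((i%:R - m%:R) * (2 * pi * x))))).
    rewrite (@itg_sum _ (fun m x =>
       \sum_(i < (m + m).+1) (g x * cos ((i%:R - m%:R) * (2 * pi * x))))) //.
    congr (_ * _); apply: eq_bigr => m _.
    by rewrite (@itg_sum _ (fun i x => g x * cos ((i%:R - m%:R) * (2 * pi * x)))).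
  apply: itg_eq => x _; rewrite fejerE mulrCA; congr (_ * _).
  rewrite mulr_sumr; apply: eq_bigr => m _; rewrite /dirichlet mulr_sumr.
  by [].
rewrite [X in itg _ X](_ : _ = - (n%:R + 1 / 2) + (n + n).+1%:R); last first.
  by rewrite (mulrSr 1 (n + n)) natrD; field.
rewrite itg_split; last exact: cont_mul.
rewrite -sumrB.
apply: le_trans (ler_norm_sum _ _ _) _.
have -> : (n + n).+1%:R * (L * (e / 2 + 16 / (K%:R * e))) =
    \sum_(i < (n + n).+1) (L * (e / 2 + 16 / (K%:R * e))).
  by rewrite sumr_const card_ord mulr_natl.
apply: ler_sum => i _.
have <- : itg (- (1 / 2)) (1 / 2) (fun u => g ((i%:R - n%:R) + u) * fejer K (2 * pi * u)) =
  itg (- (n%:R + 1 / 2) + i%:R) (- (n%:R + 1 / 2) + i%:R + 1) (fun x => g x * fejer K (2 * pi * x)).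
  have -> : - (n%:R + 1 / 2) + i%:R = 1 * (- (1 / 2)) + (i%:R - n%:R) :> R by field.
  have -> : 1 * (- (1 / 2)) + (i%:R - n%:R) + 1 = 1 * (1 / 2) + (i%:R - n%:R) :> R by field.
  have h2 : - (1 / 2) <= 1 / 2 :> R by lra.
  have ha := itg_affine (i%:R - n%:R) (cont_mul cg cF) ltr01 h2.
  rewrite invr1 (mul1r (itg _ _ _)) in ha; rewrite -ha.
  apply: itg_eq => u _; rewrite (mul1r u) (addrC u); congr (_ * _).
  rewrite -(fejer_period _ _ i) -[RHS](fejer_period _ _ n); congr (fejer _ _); ring.
exact: fejer_approx.
Qed.

Lemma poisson_bound g L n M B : continuous g -> (forall y z, `|g y - g z| <= L * `|y - z|) ->
  (forall m, `|\sum_(i < (m + m).+1) fourier_int g n (i%:R - m%:R) - M| <= B) ->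
  `|\sum_(i < (n + n).+1) g (i%:R - n%:R) - M| <= B.
Proof.
move=> cg hL hB; apply/ler_addgt0Pr => d d0.
pose N := (n + n).+1%:R * (L + 1) : R.
have L0 : 0 <= L.
  by have := hL 1 0; rewrite subr0 normr1 mulr1; exact: le_trans.
have N0 : 0 < N by rewrite mulr_gt0 ?ltr0n // ltr_wpDl.
pose e := d / N; have e0 : 0 < e by rewrite divr_gt0.
(* Gives [16 / (K e) <= e / 2], so each of the [2 n + 1] cells costs at most [L e] and all of them
   at most [N e = d]. *)
pose K := (Num.truncn (32 / e ^+ 2)).+1.
have hK : 32 / e ^+ 2 <= K%:R by rewrite ltW // truncnS_gt.
have h := poisson_avg n (K := K) cg hL isT e0.
set S := \sum_(i < _) g _ in h *.
set P := \sum_(m < K) _ in h.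
have hP : `|K%:R^-1 * P - M| <= B.
  have -> : M = K%:R^-1 * \sum_(m < K) M.
    by rewrite sumr_const card_ord -[M *+ _]mulr_natl mulKf // pnatr_eq0.
  rewrite -mulrBr normrM ger0_norm ?invr_ge0 // ler_pdivrMl ?ltr0n // /P -sumrB.
  apply: le_trans (ler_norm_sum _ _ _) _.
  rewrite mulr_natl -[X in _ *+ X]card_ord -sumr_const; apply: ler_sum => m _; exact: hB.
have -> : S - M = (K%:R^-1 * P - M) + - (K%:R^-1 * P - S) by ring.
apply: norm_add_le => //; rewrite normrN; apply: le_trans h _.
have h1 : 16 / (K%:R * e) <= e / 2.
  rewrite ler_pdivrMr; last by apply: mulr_gt0; rewrite ?ltr0n.
  move: hK; rewrite ler_pdivrMr ?exprn_gt0 // => hK; lra.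
apply: (@le_trans _ _ (N * e)); last by rewrite /e mulrC divfK // gt_eqF.
rewrite /N -mulrA ler_wpM2l //; apply: ler_pM => //.
- apply: addr_ge0; apply: divr_ge0 => //; first exact: ltW.
  by apply: mulr_ge0 => //; exact: ltW.
- by rewrite lerDl.
- lra.
Qed.

End Poisson.

(** * Exponential sums *)

Section Sums.
Context {R : realType}.
Implicit Types (c v : nat -> R) (A V d x t : R) (m n l q j h : nat).

Lemma abel_identity c v m :
  \sum_(j < m.+1) c j * v j = (\sum_(j < m.+1) c j) * v m
    - \sum_(j < m) (\sum_(i < j.+1) c i) * (v j.+1 - v j).
Proof.
elim: m => [|m ih]; first by rewrite !big_ord_recr !big_ord0 /= subr0 !add0r.
have e1 : \sum_(j < m.+2) c j = \sum_(j < m.+1) c j + c m.+1 by rewrite big_ord_recr.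
have e2 : \sum_(j < m.+1) (\sum_(i < j.+1) c i) * (v j.+1 - v j) =
    \sum_(j < m) (\sum_(i < j.+1) c i) * (v j.+1 - v j)
    + (\sum_(i < m.+1) c i) * (v m.+1 - v m) by rewrite big_ord_recr.
rewrite big_ord_recr [LHS]/= ih e1 e2.
move: (\sum_(j < m.+1) c j) (\sum_(j < m) _) => S P; ring.
Qed.

Lemma abel_bound c v m A V d : 0 <= A -> 0 <= V -> 0 <= d ->
  (forall l, (l <= m)%N -> `|\sum_(j < l) c j| <= A) ->
  (forall j, (j < m)%N -> `|v j| <= V) ->
  (forall j, (j.+1 < m)%N -> `|v j.+1 - v j| <= d) ->
  `|\sum_(j < m) c j * v j| <= A * (V + m%:R * d).
Proof.
move=> A0 V0 d0 hA hV hd; case: m hA hV hd => [|m] hA hV hd.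
  by rewrite big_ord0 normr0 mulr_ge0 // addr_ge0 // mulr_ge0.
rewrite abel_identity mulrDr; apply: norm_add_le.
  by apply: norm_mul_le; [exact: hA|exact: hV].
rewrite normrN; apply: le_trans (ler_norm_sum _ _ _) _.
apply: (@le_trans _ _ (\sum_(j < m) A * d)).
  apply: ler_sum => j _; have hj := ltn_ord j.
  by apply: norm_mul_le; [apply: hA; exact: ltnW|exact: hd].
rewrite sumr_const card_ord -[leLHS]mulr_natl mulrCA ler_wpM2l // ler_wpM2r //.
by rewrite ler_nat.
Qed.

(** The length [l] of the progression is characterised, not computed: the equivalence is what the
    later size and range estimates use. *)
Lemma sum_class (f : nat -> R) n q r : (0 < q)%N -> (r < q)%N ->
  exists2 l, (forall j, (j < l)%N = (r + q * j < n)%N)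
    & \sum_(i < n | (i %% q == r)%N) f i = \sum_(j < l) f (r + q * j)%N.
Proof.
move=> q0 rq; elim: n => [|n [l hl ih]].
  by exists 0%N; [move=> j; rewrite !ltn0|rewrite !big_ord0].
rewrite big_mkcond big_ord_recr -big_mkcond /= ih.
case: (eqVneq (n %% q)%N r) => hn; last first.
  exists l; last by rewrite addr0.
  move=> j; rewrite hl ltnS [RHS]leq_eqVlt; case: eqVneq => // e.
  by case/eqP: hn; rewrite -e mulnC addnC modnMDl modn_small.
have en : n = (r + q * (n %/ q))%N by rewrite {1}(divn_eq n q) hn addnC mulnC.
have el : l = (n %/ q)%N.
  have h j : (j < l)%N = (j < n %/ q)%N.
    by rewrite hl [X in (_ < X)%N]en ltn_add2l ltn_pmul2l.
  by apply/eqP; rewrite eqn_leq leqNgt h ltnn /= leqNgt -h ltnn.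
exists l.+1; last by rewrite big_ord_recr /= [X in (_ * X)%N]el -en.
by move=> j; rewrite !ltnS [in RHS]en leq_add2l leq_pmul2l // el.
Qed.

Lemma sum_classes (f : nat -> R) n q : (0 < q)%N ->
  \sum_(i < n) f i = \sum_(r < q) \sum_(i < n | (i %% q == r)%N) f i.
Proof.
move=> q0; under [RHS]eq_bigr do rewrite big_mkcond.
rewrite exchange_big /=; apply: eq_bigr => i _.
rewrite -big_mkcond (big_pred1 (Ordinal (ltn_pmod i q0))) //.
Qed.

Lemma sum_periodic (f : nat -> R) q s : (forall k, f (k + q)%N = f k) ->
  \sum_(i < q) f (i + s)%N = \sum_(i < q) f i.
Proof.
move=> hf; elim: s => [|s ih]; first by apply: eq_bigr => i _; rewrite addn0.
rewrite -{}ih; case: q hf => [|q] hf; first by rewrite !big_ord0.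
rewrite big_ord_recr big_ord_recl /= addrC add0n; congr (_ + _).
  by rewrite addnS -addSn addnC hf.
by apply: eq_bigr => i _; rewrite /bump /= add1n addSnnS.
Qed.

Lemma symsumS (f : R -> R) m :
  \sum_(i < (m.+1 + m.+1).+1) f (i%:R - m.+1%:R) =
  \sum_(i < (m + m).+1) f (i%:R - m%:R) + (f m.+1%:R + f (- m.+1%:R)).
Proof.
rewrite addSn addnS big_ord_recr big_ord_recl /= sub0r.
rewrite (eq_bigr (fun i : 'I_(m + m).+1 => f (i%:R - m%:R))); last first.
  by move=> i _; congr f; rewrite /bump /= add1n !mulrSr; ring.
rewrite (_ : (m + m).+2%:R - m.+1%:R = m.+1%:R :> R); last first.
  by rewrite !mulrSr natrD; ring.
by move: (\sum_(i < _) _) => S; ring.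
Qed.

Lemma cos_intperiod x (z : int) : cos (x + z%:~R * (2 * pi)) = cos x.
Proof.
case: z => n; first exact: cos_period.
rewrite NegzE mulrNz mulNr -[LHS](cos_period _ n.+1).
by rewrite -pmulrn subrK.
Qed.

Definition square_res h k : nat := ((4 * k ^ 2) %% (3 * h))%N.

(* [square_weight h k] is comparable with the reciprocal of the distance from
   [4 k^2] to the multiples of [3 h], with [1] for [3 h | 4 k^2]. *)
Definition square_weight h k : R := let r := square_res h k in
  if r == 0%N then 1 else r%:R^-1 + (3 * h - r)%N%:R^-1.

(** This is the factor [E(h)] of the overview, over one full period of residues. *)
Definition square_sum h : R := \sum_(k < (3 * h)%N) square_weight h k.

Lemma square_weight_period h k : square_weight h (k + 3 * h)%N = square_weight h k.
Proof.
rewrite /square_weight /square_res.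
suff -> : (4 * (k + 3 * h) ^ 2 = 4 * k ^ 2 %[mod 3 * h])%N by [].
rewrite (_ : 4 * (k + 3 * h) ^ 2 = (8 * k + 12 * h) * (3 * h) + 4 * k ^ 2)%N ?modnMDl //.
by rewrite !expnS !expn0; ring.
Qed.

Lemma square_weight_ge0 h k : 0 <= square_weight h k.
Proof. by rewrite /square_weight; case: ifP => // _; rewrite addr_ge0 ?invr_ge0. Qed.

Lemma square_sum_ge1 h : (0 < h)%N -> 1 <= square_sum h.
Proof.
move=> h0; have h3 : (0 < 3 * h)%N by rewrite muln_gt0.
rewrite /square_sum (bigD1 (Ordinal h3)) //= {1}/square_weight /square_res /= mod0n /=.
by rewrite lerDl sumr_ge0 // => k _; exact: square_weight_ge0.
Qed.

(** If [3 h | 4 k^2] only the trivial bound [l] is left. Otherwise [sinpi_lower] at the distance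
    [min(r, 3 h - r) / (3 h)] to the nearest integer yields [12 h] times the weight. The integer [z]
    allows the slope to come from any integer congruent to [k] modulo [3 h]. *)
Lemma square_geometric h k l A (z : int) t : (0 < h)%N ->
  t = 2 * pi * (z%:~R + (4 * k ^ 2)%N%:R / (3 * h)%N%:R) ->
  `|\sum_(j < l) cos (A + j%:R * t)| <= (l%:R + 12 * h%:R) * square_weight h k.
Proof.
move=> h0 et; have h3 : (0 < 3 * h)%N by rewrite muln_gt0.
have h0' : 0 < h%:R :> R by rewrite ltr0n.
have q0 : 0 < (3 * h)%N%:R :> R by rewrite ltr0n.
have triv : `|\sum_(j < l) cos (A + j%:R * t)| <= l%:R.
  apply: le_trans (ler_norm_sum _ _ _) _.
  apply: (@le_trans _ _ (\sum_(j < l) 1)); first by apply: ler_sum => j _; exact: cos_max.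
  by rewrite sumr_const card_ord.
rewrite /square_weight; case: eqVneq => [_|r0].
  by rewrite mulr1; apply: le_trans triv _; rewrite lerDl mulr_ge0 // ltW.
set r := square_res h k in r0 *.
have rq : (r < 3 * h)%N by exact: ltn_pmod.
have rgt : (0 < r)%N by rewrite lt0n.
set W := r%:R^-1 + _; have W0 : 0 <= W by rewrite addr_ge0 ?invr_ge0.
apply: (@le_trans _ _ (12 * h%:R * W)); last by rewrite ler_wpM2r // lerDr.
have hsin : (12 * h%:R * W)^-1 <= `|sin (t / 2)|.
  pose u := (4 * k ^ 2 %/ (3 * h))%N.
  have et2 : t / 2 = pi * (r%:R / (3 * h)%N%:R) + (z + u%:Z)%:~R * pi.
    rewrite et [in LHS](divn_eq (4 * k ^ 2) (3 * h)) -/(square_res h k) -/r -/u.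
    rewrite natrD natrM intrD pmulrn; field.
    by rewrite gt_eqF.
  have -> : `|sin (t / 2)| = `|sin (pi * (r%:R / (3 * h)%N%:R))|.
    rewrite et2; move: (pi * _) (z + u%:Z) => y v.
    have p x (n : nat) : `|sin (x + n%:R * pi)| = `|sin x|.
      elim: n => [|n ih]; first by rewrite mul0r addr0.
      by rewrite mulrSr mulrDl mul1r addrA sinDpi normrN.
    case: v => n; first exact: p.
    by rewrite NegzE mulrNz mulNr -[LHS](p _ n.+1) -pmulrn subrK.
  have hr0 : 0 < r%:R :> R by rewrite ltr0n.
  have hr1 : 0 < (3 * h - r)%N%:R :> R by rewrite ltr0n subn_gt0.
  have [hr|hr] := leP (2 * r%:R) ((3 * h)%N%:R : R).
    have hx : `|r%:R / (3 * h)%N%:R| <= 1 / 2 :> R.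
      by rewrite ger0_norm ?divr_ge0 // ler_pdivrMr //; lra.
    apply: le_trans (sinpi_lower hx); rewrite ger0_norm ?divr_ge0 //.
    rewrite -[leRHS]invrK lef_pV2 ?posrE ?invr_gt0 ?divr_gt0 ?mulr_gt0 //; last first.
      by rewrite /W addr_gt0 ?invr_gt0.
    rewrite !invfM !invrK natrM (_ : _ * 4 = 12 * h%:R * r%:R^-1); last by ring.
    by rewrite ler_wpM2l ?mulr_ge0 ?(ltW h0') // /W lerDl invr_ge0.
  have e1 : r%:R = (3 * h)%N%:R - (3 * h - r)%N%:R :> R.
    by rewrite natrB ?(ltnW rq) // opprB addrC subrK.
  have -> : `|sin (pi * (r%:R / (3 * h)%N%:R))| = `|sin (pi * ((3 * h - r)%N%:R / (3 * h)%N%:R))| :> R.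
    rewrite [in LHS]e1 mulrBl divff ?gt_eqF // mulrBr mulr1.
    by rewrite sinB sinpi cospi mul0r mulN1r sub0r opprK.
  have hx : `|(3 * h - r)%N%:R / (3 * h)%N%:R| <= 1 / 2 :> R.
    by rewrite ger0_norm ?divr_ge0 // ler_pdivrMr //; lra.
  apply: le_trans (sinpi_lower hx); rewrite ger0_norm ?divr_ge0 //.
  rewrite -[leRHS]invrK lef_pV2 ?posrE ?invr_gt0 ?divr_gt0 ?mulr_gt0 //; last first.
    by rewrite /W addr_gt0 ?invr_gt0.
  rewrite !invfM !invrK natrM (_ : _ * 4 = 12 * h%:R * (3 * h - r)%N%:R^-1); last by ring.
  by rewrite ler_wpM2l ?mulr_ge0 ?(ltW h0') // /W lerDr invr_ge0.
have Wp : 0 < 12 * h%:R * W.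
  by rewrite !mulr_gt0 // /W addr_gt0 ?invr_gt0 ?ltr0n ?subn_gt0.
have := geometric_bound A t l.
move: (`|\sum_(j < l) _|) (normr_ge0 (\sum_(j < l) cos (A + j%:R * t))) => S S0 hS.
have h1 := ler_wpM2r S0 hsin.
have := le_trans h1 hS; rewrite ler_pdivrMl // mulr1.
by [].
Qed.

End Sums.

Section LipSupport.
Context {R : realType}.
Implicit Types (f g : R -> R) (a b c lo hi L x y z u v t A : R) (m n h : nat).

(** Projecting onto [[lo, hi]] is 1-Lipschitz and does not change the value of [g]. The derivative
    is known on [[lo, hi]] only, because the square root is not differentiable at 0. *)
Lemma lip_support g g' lo hi L : lo <= hi ->
  (forall x, lo <= x <= hi -> has_der g x (g' x)) ->
  (forall x, lo <= x <= hi -> `|g' x| <= L) ->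
  (forall x, ~~ (lo < x < hi) -> g x = 0) ->
  forall y z, `|g y - g z| <= L * `|y - z|.
Proof.
move=> lh hd hL h0.
pose c (x : R) : R := if x <= lo then lo else if hi <= x then hi else x.
have cin x : lo <= c x <= hi.
  rewrite /c; case: (leP x lo) => [_|h1]; first by rewrite lexx lh.
  by case: (leP hi x) => [_|h2]; rewrite ?lexx ?lh ?(ltW h1) ?(ltW h2).
have gc x : g (c x) = g x.
  rewrite /c; case: (leP x lo) => [h1|h1].
    by rewrite !h0 // ?ltxx // [lo < x]le_gtF.
  case: (leP hi x) => [h2|h2] //.
  by rewrite !h0 // ?ltxx ?andbF // [x < hi]le_gtF // andbF.
have L0 : 0 <= L by apply: le_trans (hL lo _); rewrite // lexx lh.
move=> y z; rewrite -(gc y) -(gc z).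
apply: le_trans (der_lip hd hL (cin z) (cin y)) _.
rewrite ler_wpM2l // /c.
have t1 := ler_norm (y - z); have t2 := ler_norm (z - y); rewrite distrC in t2.
move: `|y - z| t1 t2 (normr_ge0 (y - z)) => t t1 t2 t0.
case: (leP y lo) => h1; case: (leP z lo) => h2;
  try case: (leP hi y) => h3; try case: (leP hi z) => h4;
  by rewrite ler_norml; apply/andP; split; lra.
Qed.

Lemma lip_continuous g L : (forall y z, `|g y - g z| <= L * `|y - z|) -> continuous g.
Proof.
move=> hL x; have L0 : 0 <= L.
  by have := hL 1 0; rewrite subr0 normr1 mulr1; exact: le_trans.
apply/cvgrPdist_le => e e0; near=> y.
apply: le_trans (hL _ _) _.
have h : `|x - y| <= e / (L + 1).
  near: y; apply: cvgr_dist_le => //; rewrite divr_gt0 // ltr_wpDl //.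
apply: le_trans (ler_wpM2l L0 h) _.
by rewrite mulrA ler_pdivrMr ?ltr_wpDl // mulrC ler_wpM2l ?lerDl // ltW.
Unshelve. all: by end_near. Qed.

Lemma itg_zero f a b : a <= b -> (forall x, a <= x <= b -> f x = 0) -> itg a b f = 0.
Proof.
by move=> ab h; rewrite (itg_eq h) itg_cst // mul0r.
Qed.

Lemma itg_support f a b u v : continuous f -> a <= u -> u <= v -> v <= b ->
  (forall x, ~~ (u < x < v) -> f x = 0) -> itg a b f = itg u v f.
Proof.
move=> cf au uv vb h; have av := le_trans au uv.
rewrite (itg_cat cf av vb) (itg_cat cf au uv).
rewrite (itg_zero au) ?(itg_zero vb) ?add0r ?addr0 //.
- by move=> x /andP[h1 h2]; apply: h; rewrite negb_and -!leNgt h1 orbT.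
- by move=> x /andP[h1 h2]; apply: h; rewrite negb_and -!leNgt h2.
Qed.

Lemma sym_sin t m : \sum_(i < (m + m).+1) sin ((i%:R - m%:R) * t) = 0.
Proof.
elim: m => [|m ih].
  by rewrite big_ord_recr big_ord0 /= subrr mul0r sin0 addr0.
by rewrite (symsumS (fun x => sin (x * t))) ih mulNr sinN subrr addr0.
Qed.

Lemma sym_cos A t m : \sum_(i < (m + m).+1) cos (A - (i%:R - m%:R) * t) =
  \sum_(i < (m + m).+1) cos A * cos ((i%:R - m%:R) * t).
Proof.
under eq_bigr do rewrite cosB.
by rewrite big_split /= -!mulr_sumr sym_sin mulr0 addr0.
Qed.

End LipSupport.

(** * Exponential sums by Poisson summation in x *)

Section Exponential.
Context {R : realType}.
Variables (w w1 w2 : R -> R) (a b M : R).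
Hypotheses (hw : bumpC2 w w1 w2 a b M) (a0 : 0 < a).
Implicit Types (T al k x : R) (h m n : nat).

(** The shifts [al = 0] and [al = - (pi / 2)] give the cosine and sine parts of the terms
    [w(x / T^2) e(h x^(3/2))]. *)
Definition expfun (h : nat) (T al x : R) : R :=
  w (x / T ^+ 2) * cos (2 * pi * h%:R * (x * Num.sqrt x) + al).

Let ab := bump_ab hw.
Let cw := bump_cont hw.
Let M0 := bump_M hw.
Let b0 : 0 < b := lt_trans a0 ab.

Lemma expfun_Lip h T al : 0 < T ->
  exists L, forall y z, `|expfun h T al y - expfun h T al z| <= L * `|y - z|.
Proof.
move=> T0; have T2 : 0 < T ^+ 2 by rewrite exprn_gt0.
pose L := M / T ^+ 2 + M * (2 * pi * h%:R * (3 / 2 * Num.sqrt (b * T ^+ 2))).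
exists L; apply: (@lip_support _ _ (fun x => w1 (x / T ^+ 2) / T ^+ 2
    * cos (2 * pi * h%:R * (x * Num.sqrt x) + al) - w (x / T ^+ 2) *
    ((2 * pi * h%:R * (3 / 2 * Num.sqrt x)) * sin (2 * pi * h%:R * (x * Num.sqrt x) + al)))
    (a * T ^+ 2) (b * T ^+ 2)).
- by rewrite ler_pM2r // ltW.
- move=> x /andP[ax _]; have x0 : 0 < x by apply: lt_le_trans ax; rewrite mulr_gt0.
  have h1 := der_xsqrt x0.
  have h2 : has_der (fun x => w (x / T ^+ 2)) x (w1 (x / T ^+ 2) * (T ^+ 2)^-1).
    apply: (der_comp (f := w) (g := fun x => x / T ^+ 2)); first exact: (bump_der1 hw).
    by der; ring.
  by rewrite /expfun; der; move: (cos _) (sin _) => C S; ring.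
- move=> x /andP[ax xb]; apply: norm_add_le.
    rewrite -[leRHS]mulr1; apply: norm_mul_le; last exact: cos_max.
    rewrite normrM normfV (gtr0_norm T2) ler_wpM2r ?invr_ge0 ?(ltW T2) //.
    exact: (bump_le1 hw).
  rewrite normrN; apply: norm_mul_le; first exact: (bump_le0 hw).
  rewrite -[leRHS]mulr1; apply: norm_mul_le; last exact: sin_max.
  have p0 := pi_ge0 R.
  rewrite ger0_norm; last by rewrite !mulr_ge0 // sqrtr_ge0.
  rewrite ler_wpM2l ?mulr_ge0 // ler_wpM2l //; exact: ler_wsqrtr.
- move=> x; rewrite -(ltr_pdivlMr _ _ T2) -(ltr_pdivrMr _ _ T2) => hx.
  by rewrite /expfun (bump_out0 hw) // mul0r.
Qed.

Definition expint (h : nat) (T al k : R) : R :=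
  itg a b (fun x => w x * cos (phase (2 * pi * h%:R * T ^+ 3) (k / (h%:R * T)) 0 al x)).

(** A single [fourier_int] contains a product of two cosines. Over a symmetric range of frequencies
    the sine products cancel ([sym_cos]), so each product may be replaced by one cosine of the
    combined phase. *)
Lemma expfun_fourier h T al n m : (0 < h)%N -> 0 < T -> b * T ^+ 2 <= n%:R ->
  \sum_(i < (m + m).+1) fourier_int (expfun h T al) n (i%:R - m%:R) =
  T ^+ 2 * \sum_(i < (m + m).+1) expint h T al (i%:R - m%:R).
Proof.
move=> h0 T0 hn; have T2 : 0 < T ^+ 2 by rewrite exprn_gt0.
have h0' : 0 < h%:R :> R by rewrite ltr0n.
pose L := 2 * pi * h%:R * T ^+ 3.
pose G k x := w x * (cos (L * (x * Num.sqrt x) + al) * cos (k * (2 * pi * T ^+ 2 * x))).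
have cG k : continuous (G k).
  by apply: cont_mul => //; have := @sqrt_continuous R => cs; cont.
have [Lp hL] := expfun_Lip h al T0.
have cg := lip_continuous hL.
have e k : fourier_int (expfun h T al) n k = T ^+ 2 * itg a b (G k).
  rewrite /fourier_int (@itg_support _ _ _ _ (a * T ^+ 2) (b * T ^+ 2)).
  - have cF : continuous (fun x => expfun h T al x * cos (k * (2 * pi * x))) by cont.
    have := itg_affine 0 cF T2 (ltW ab); rewrite !addr0 (mulrC (T ^+ 2) a) (mulrC (T ^+ 2) b).
    move=> /(congr1 (fun z => T ^+ 2 * z)); rewrite mulVKf ?gt_eqF // => <-.
    congr (_ * _); apply: itg_eq => x /andP[ax _].
    have x0 : 0 <= x by apply: le_trans ax; exact: ltW.
    rewrite addr0 /expfun /G -mulrA; congr (w _ * (cos (_ + _) * cos _)).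
    + by field; rewrite gt_eqF.
    + rewrite sqrtrM ?(ltW T2) // sqrtr_sqr (gtr0_norm T0) /L; ring.
    + ring.
  - by cont.
  - have : 0 <= a * T ^+ 2 by rewrite mulr_ge0 // ltW.
    have := ler0n R n; lra.
  - by rewrite ler_pM2r // ltW.
  - lra.
  - move=> x; rewrite -(ltr_pdivlMr _ _ T2) -(ltr_pdivrMr _ _ T2) => hx.
    by rewrite /expfun (bump_out0 hw) // !mul0r.
rewrite (eq_bigr _ (fun i _ => e _)) -mulr_sumr; congr (_ * _).
rewrite -(@itg_sum _ _ (fun i => G (i%:R - m%:R))) ?(ltW ab) //.
rewrite -(@itg_sum _ _ (fun i x => w x * cos (phase L ((i%:R - m%:R) / (h%:R * T)) 0 al x))) ?(ltW ab) //; last first.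
  by move=> i; cont.
apply: itg_eq => x _; rewrite /G -[in LHS]mulr_sumr -sym_cos mulr_sumr.
apply: eq_bigr => i _; congr (_ * cos _); rewrite /phase /L; field.
by rewrite !gt_eqF.
Qed.

Lemma expint_tail h T al k : (0 < h)%N -> 0 < T -> 3 * Num.sqrt b * (h%:R * T) <= `|k| ->
  `|expint h T al k| <= tail_const a b M / T ^+ 4 / k ^+ 2.
Proof.
move=> h0 T0 hk; have h0' : 0 < h%:R :> R by rewrite ltr0n.
have hT : 0 < h%:R * T by rewrite mulr_gt0.
have p2 := pi_ge2 R; have p0 := pi_gt0 R.
have L0 : 0 < 2 * pi * h%:R * T ^+ 3 by rewrite !mulr_gt0 // exprn_gt0.
have k0 : 0 < `|k|.
  by apply: lt_le_trans hk; rewrite !mulr_gt0 // sqrtr_gt0.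
have kn : k != 0 by rewrite -normr_gt0.
apply: le_trans (phase_tail 0 al hw a0 L0 _) _.
  by rewrite normrM normfV (gtr0_norm hT) ler_pdivlMr.
have tc : 0 <= tail_const a b M.
  have := phase_tail (be := 3 * Num.sqrt b) 0 al hw a0 L0 (ler_norm _).
  move=> /(le_trans (normr_ge0 _)); rewrite pmulr_lge0 // invr_gt0 exprn_gt0 //.
  by rewrite !mulr_gt0 ?exprn_gt0 // sqrtr_gt0.
rewrite -[leRHS]mulrA ler_wpM2l // -invfM lef_pV2 ?posrE.
- rewrite (_ : 2 * pi * h%:R * T ^+ 3 * (k / (h%:R * T)) = 2 * pi * T ^+ 2 * k); last first.
    by field; rewrite !gt_eqF.
  rewrite (_ : T ^+ 4 * k ^+ 2 = 1 * (T ^+ 2 * k) ^+ 2); last by ring.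
  rewrite (_ : (2 * pi * T ^+ 2 * k) ^+ 2 = (2 * pi) ^+ 2 * (T ^+ 2 * k) ^+ 2); last by ring.
  rewrite ler_wpM2r ?sqr_ge0 // -[1](expr1n _ 2) lerXn2r ?nnegrE ?mulr_ge0 ?(ltW p0) //; lra.
- rewrite exprn_even_gt0 //= !mulf_neq0 ?invr_neq0 ?mulf_neq0 ?expf_neq0 //; by rewrite gt_eqF.
- by apply: mulr_gt0; [exact: exprn_gt0|rewrite exprn_even_gt0].
Qed.

(** Separates the additive phase, which moves fast with the frequency, from two amplitudes that move
    slowly; the shift [- (pi / 2)] produces the sine integral. *)
Lemma statint_split L al be : statint w a b L al be =
  cos al * statint w a b L 0 be - sin al * statint w a b L (- (pi / 2)) be.
Proof.
rewrite /statint -!itgZ; [|by cont..].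
rewrite -itgB; [|by cont..].
apply: itg_eq => x _.
have e z : phase L be (4 / 27 * be ^+ 3) z x = phase L be (4 / 27 * be ^+ 3) 0 x + z.
  by rewrite /phase addr0.
rewrite (e al) (e (- (pi / 2))) cosBpihalf cosD.
move: (cos _) (sin _) (cos _) (sin _) => c1 s1 c2 s2; ring.
Qed.

Lemma expint_statint h T al k : (0 < h)%N -> 0 < T ->
  expint h T al k = statint w a b (2 * pi * h%:R * T ^+ 3)
    (al - 2 * pi * (4 * k ^+ 3 / (27 * h%:R ^+ 2))) (k / (h%:R * T)).
Proof.
move=> h0 T0; have h0' : 0 < h%:R :> R by rewrite ltr0n.
apply: itg_eq => x _; congr (_ * cos _); rewrite /phase; field.
by rewrite !gt_eqF.
Qed.

End Exponential.

Section ExponentialBound.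
Context {R : realType}.
Variables (w w1 w2 : R -> R) (a b M : R).
Hypotheses (hw : bumpC2 w w1 w2 a b M) (a0 : 0 < a).
Implicit Types (T al k x y t : R) (h m n l r : nat).

Let ab := bump_ab hw.
Let M0 := bump_M hw.
Let b0 : 0 < b := lt_trans a0 ab.
Let B0 : R := 3 * Num.sqrt b.
Let V0 : R := osc_const a b * (M + M).
Let V1 : R := lip_const a b M B0.

(** From one term of the class to the next [be] moves by [3 / T], so the amplitudes move by at most
    [3 V1 / (T Num.sqrt L)]. A class has at most [Q T] terms, hence their total variation is at most
    [3 V1 Q / Num.sqrt L], comparable with their size, and Abel summation costs only a constant. The
    bound on [m] keeps [|be| <= B0], where this Lipschitz constant is valid. *)
Lemma expint_class h T al m l r Q : (0 < h)%N -> 0 < T ->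
  m%:R <= B0 * (h%:R * T) ->
  (forall j, (j < l)%N = (r + 3 * h * j < (m + m).+1)%N) ->
  B0 * T + 1 <= Q * T ->
  `|\sum_(j < l) expint w a b h T al ((r + 3 * h * j)%N%:R - m%:R)| <=
   2 * ((Q * T + 12 * h%:R) * square_weight h (r + m * (3 * h - 1))) *
   ((V0 + 3 * V1 * Q) / Num.sqrt (2 * pi * h%:R * T ^+ 3)).
Proof.
move=> h0 T0 hm hl hQ; have h0' : 0 < h%:R :> R by rewrite ltr0n.
have h1' : 1 <= h%:R :> R by rewrite ler1n.
have hT : 0 < h%:R * T by rewrite mulr_gt0.
have p0 := pi_gt0 R.
set L := 2 * pi * h%:R * T ^+ 3.
have L0 : 0 < L by rewrite /L !mulr_gt0 // exprn_gt0.
have sL : 0 < Num.sqrt L by rewrite sqrtr_gt0.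
have B00 : 0 <= B0 by rewrite mulr_ge0 // sqrtr_ge0.
have V0_0 : 0 <= V0.
  have := statint_bound 0 0 hw a0 L0 => /(le_trans (normr_ge0 _)).
  by rewrite pmulr_lge0 // invr_gt0.
have V1_0 : 0 <= V1.
  have hB : `|0 : R| <= B0 by rewrite normr0.
  have := dstatint_bound 0 hw a0 L0 hB => /(le_trans (normr_ge0 _)).
  by rewrite pmulr_lge0 // invr_gt0.
pose kp : R := r%:R - m%:R.
pose A0 := al - 2 * pi * (4 * kp ^+ 3 / (27 * h%:R ^+ 2)).
pose t := 2 * pi * (4 * kp ^+ 2 / (3 * h%:R)).
pose be (j : nat) : R := (kp + 3 * h%:R * j%:R) / (h%:R * T).
pose Vc j := statint w a b L 0 (be j).
pose Vs j := statint w a b L (- (pi / 2)) (be j).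
(* A natural number congruent to [r - m] modulo [3 h]. *)
pose kap := (r + m * (3 * h - 1))%N.
have h3 : (0 < 3 * h)%N by rewrite muln_gt0.
have ekap : kp = kap%:R - 3 * h%:R * m%:R.
  by rewrite /kp /kap natrD natrM natrB // natrM; ring.
pose z : int := - (8 * kap * m)%:Z + (12 * h * m ^ 2)%:Z.
have et : t = 2 * pi * (z%:~R + (4 * kap ^ 2)%N%:R / (3 * h)%N%:R).
  rewrite /t ekap /z intrD mulrNz -!pmulrn !natrM ?natrX; field.
  by rewrite gt_eqF.
have phase_red j : exists2 y : R, y = - A0 + j%:R * t &
    expint w a b h T al ((r + 3 * h * j)%N%:R - m%:R) = cos y * Vc j + sin y * Vs j.
  exists (- A0 + j%:R * t) => //.
  rewrite (expint_statint _ _ _ _ _ h0 T0) -/L (statint_split hw).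
  have -> : (r + 3 * h * j)%N%:R - m%:R = kp + 3 * h%:R * j%:R :> R.
    by rewrite natrD !natrM /kp; ring.
  rewrite -/(be j) -/(Vc j) -/(Vs j).
  (* In [4 (kp + 3 h j)^3 / (27 h^2)] the terms of degree two and three in [j] are the integers
     [4 kp j^2] and [4 h j^3]. *)
  pose zz : int := - (4 * (r%:Z - m%:Z) * j%:Z ^+ 2 + 4 * h%:Z * j%:Z ^+ 3).
  have -> : al - 2 * pi * (4 * (kp + 3 * h%:R * j%:R) ^+ 3 / (27 * h%:R ^+ 2)) =
      - (- A0 + j%:R * t) + zz%:~R * (2 * pi).
    rewrite /A0 /t /zz /kp mulrNz intrD !intrM intrB -!pmulrn; field.
    by rewrite gt_eqF.
  move: (- A0 + _) => y.
  have -> : sin (- y + zz%:~R * (2 * pi)) = sin (- y).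
    by rewrite -!cosBpihalf addrAC cos_intperiod.
  by rewrite cos_intperiod cosN sinN mulNr opprK.
have hbe j : (j < l)%N -> `|be j| <= B0.
  rewrite hl ltnS => hj.
  rewrite /be normrM normfV (gtr0_norm hT) ler_pdivrMr //; apply: le_trans hm.
  have : (r + 3 * h * j)%N%:R <= (m + m)%N%:R :> R by rewrite ler_nat.
  rewrite natrD !natrM natrD /kp ler_norml => hj'.
  have := ler0n R r; have : 0 <= 3 * h%:R * j%:R :> R by rewrite !mulr_ge0.
  by move=> h4 h5; apply/andP; split; lra.
have hlQ : l%:R <= Q * T.
  apply: le_trans hQ; case: l hl hbe => [|l'] hl hbe.
    by rewrite addr_ge0 // mulr_ge0 // ltW.
  have := hl l'; rewrite ltnSn ltnS => /esym hj.
  have : (3 * h * l')%N%:R <= (m + m)%N%:R :> R.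
    by rewrite ler_nat; apply: leq_trans hj; rewrite leq_addl.
  rewrite !natrM natrD => hj'; rewrite -natr1 lerD2r.
  rewrite -(@ler_pM2l _ (3 * h%:R)) ?mulr_gt0 //; apply: le_trans hj' _.
  have : 0 <= B0 * (h%:R * T) by rewrite mulr_ge0 // ltW.
  lra.
have Q0 : 0 <= Q * T by exact: le_trans (ler0n _ _) hlQ.
have Q1 : 0 <= Q by rewrite -(pmulr_lge0 _ T0).
set W := square_weight h kap.
have W0 : 0 <= W by exact: square_weight_ge0.
have dif j : be j.+1 - be j = 3 / T.
  by rewrite /be -natr1; field; rewrite !gt_eqF.
have S0 : 0 <= (Q * T + 12 * h%:R) * W.
  by rewrite mulr_ge0 // addr_ge0 // mulr_ge0 // ltW.
have geo y l' : (l' <= l)%N -> `|\sum_(j < l') cos (y + j%:R * t)| <= (Q * T + 12 * h%:R) * W.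
  move=> ll; apply: le_trans (square_geometric l' y h0 et) _.
  rewrite ler_wpM2r // lerD2r; apply: le_trans hlQ; by rewrite ler_nat.
have part y al' : `|\sum_(j < l) cos (y + j%:R * t) * statint w a b L al' (be j)| <=
    (Q * T + 12 * h%:R) * W * ((V0 + 3 * V1 * Q) / Num.sqrt L).
  have V2 : 0 <= V1 / Num.sqrt L * (3 / T).
    by rewrite mulr_ge0 // divr_ge0 // ltW.
  have := @abel_bound R (fun j => cos (y + j%:R * t)) (fun j => statint w a b L al' (be j)) l
    ((Q * T + 12 * h%:R) * W) (V0 / Num.sqrt L) (V1 / Num.sqrt L * (3 / T)) S0.
  move=> /(_ (divr_ge0 V0_0 (ltW sL)) V2 (geo y)) hab.
  apply: le_trans (hab _ _) _.
  - by move=> j _; exact: statint_bound hw a0 L0.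
  - move=> j hj; apply: le_trans (statint_Lip _ hw a0 L0 (hbe j (ltnW hj)) (hbe j.+1 hj)) _.
    by rewrite dif ger0_norm // divr_ge0 // ltW.
  - rewrite ler_wpM2l // (mulrDl V0) lerD2l.
    apply: (@le_trans _ _ (Q * T * (V1 / Num.sqrt L * (3 / T)))); first by rewrite ler_wpM2r.
    rewrite le_eqVlt; apply/orP; left; apply/eqP; field.
    by rewrite !gt_eqF.
have -> : \sum_(j < l) expint w a b h T al ((r + 3 * h * j)%N%:R - m%:R) =
    \sum_(j < l) cos (- A0 + j%:R * t) * Vc j +
    \sum_(j < l) cos (- A0 - pi / 2 + j%:R * t) * Vs j.
  rewrite -big_split /=; apply: eq_bigr => j _.
  have [y ey ->] := phase_red j.
  by rewrite -ey (addrAC (- A0)) -ey cosBpihalf.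
rewrite -mulrA [leRHS]mulr_natl mulr2n; apply: norm_add_le; exact: part.
Qed.

End ExponentialBound.

Section ExponentialSum.
Context {R : realType}.
Variables (w w1 w2 : R -> R) (a b M : R).
Hypotheses (hw : bumpC2 w w1 w2 a b M) (a0 : 0 < a).
Implicit Types (T al k x y t Q : R) (h m n l r : nat).

Let B0 : R := 3 * Num.sqrt b.
Let V0 : R := osc_const a b * (M + M).
Let V1 : R := lip_const a b M B0.
Let tc : R := tail_const a b M.

Lemma expint_main h T al m Q : (0 < h)%N -> 0 < T ->
  m%:R <= B0 * (h%:R * T) -> B0 * T + 1 <= Q * T ->
  `|\sum_(i < (m + m).+1) expint w a b h T al (i%:R - m%:R)| <=
   2 * (Q * T + 12 * h%:R) * ((V0 + 3 * V1 * Q) / Num.sqrt (2 * pi * h%:R * T ^+ 3))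
     * square_sum h.
Proof.
move=> h0 T0 hm hQ; have h3 : (0 < 3 * h)%N by rewrite muln_gt0.
rewrite (@sum_classes _ (fun i => expint w a b h T al (i%:R - m%:R)) _ _ h3).
apply: le_trans (ler_norm_sum _ _ _) _.
(* The index [i] stands for the frequency [i - m]; the resulting shift of the residues drops out
   over a full period. *)
rewrite /square_sum -(@sum_periodic R _ _ (m * (3 * h - 1)) (@square_weight_period R h)) mulr_sumr.
apply: ler_sum => r _.
have [l hl ->] := sum_class (fun i => expint w a b h T al (i%:R - m%:R)) (m + m).+1 h3 (ltn_ord r).
apply: le_trans (expint_class hw a0 al h0 T0 hm hl hQ) _.
rewrite le_eqVlt; apply/orP; left; apply/eqP.
move: (square_weight _ _) (_ / _) => W Z; ring.
Qed.

Lemma tail_const_ge0 : 0 <= tc.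
Proof.
have L0 : 0 < (1 : R) by [].
have := phase_tail (be := 3 * Num.sqrt b) 0 0 hw a0 L0 (ler_norm _).
move=> /(le_trans (normr_ge0 _)); rewrite pmulr_lge0 // invr_gt0 exprn_gt0 //.
rewrite mul1r mulr_gt0 // sqrtr_gt0; exact: lt_trans (bump_ab hw).
Qed.

(** Up to [B0 h T] the residue classes are used; each later pair of frequencies has no stationary
    point and adds [O(T^-4 k^-2)]. *)
Lemma expint_all h T al m Q : (0 < h)%N -> 0 < T -> B0 * T + 1 <= Q * T ->
  `|\sum_(i < (m + m).+1) expint w a b h T al (i%:R - m%:R)| <=
   2 * (Q * T + 12 * h%:R) * ((V0 + 3 * V1 * Q) / Num.sqrt (2 * pi * h%:R * T ^+ 3))
     * square_sum h + 4 * tc / T ^+ 4.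
Proof.
move=> h0 T0 hQ; set P := _ * square_sum h.
have h0' : 0 < h%:R :> R by rewrite ltr0n.
have tc0 := tail_const_ge0.
have T4 : 0 < T ^+ 4 by rewrite exprn_gt0.
have D0 : 0 <= 4 * tc / T ^+ 4 by exact: (divr_ge0 (mulr_ge0 (ler0n R 4) tc0) (ltW T4)).
(* The sharpened bound makes the induction close, since [2 / x^2 <= 4 (1 / x - 1 / (x + 1))] at
   [x = m + 1]. *)
suff : `|\sum_(i < (m + m).+1) expint w a b h T al (i%:R - m%:R)| <=
   P + 4 * tc / T ^+ 4 * (1 - m.+1%:R^-1).
  move=> hs; apply: le_trans hs _; rewrite lerD2l ler_piMr // lerBlDr lerDl //.
elim: m => [|m ih].
  rewrite invr1 subrr mulr0 addr0; apply: expint_main => //.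
  by rewrite !mulr_ge0 ?sqrtr_ge0 // ltW.
have [hm|hm] := leP (m.+1%:R) (B0 * (h%:R * T)).
  apply: le_trans (expint_main al h0 T0 hm hQ) _; rewrite -/P lerDl mulr_ge0 //.
  by rewrite subr_ge0 invf_le1 ?ltr0n // ler1n.
have m0 : 0 < m.+1%:R :> R by rewrite ltr0n.
have tl s : `|s| = m.+1%:R -> `|expint w a b h T al s| <= tc / T ^+ 4 / m.+1%:R ^+ 2.
  move=> es; rewrite -es (real_normK (num_real _)).
  by apply: (expint_tail hw a0) => //; rewrite es; exact: ltW.
rewrite (symsumS (expint w a b h T al)).
apply: le_trans (norm_add_le ih (norm_add_le (tl _ _) (tl _ _))) _.
- by rewrite ger0_norm.
- by rewrite normrN ger0_norm.
rewrite -addrA lerD2l -mulrDl.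
have -> : 4 * tc / T ^+ 4 * (1 - m.+2%:R^-1) = 4 * tc / T ^+ 4 * (1 - m.+1%:R^-1)
    + 4 * tc / T ^+ 4 * (m.+1%:R^-1 - m.+2%:R^-1) by ring.
rewrite lerD2l -mulr2n -[_ *+ 2]mulr_natl.
have -> : 2 * (tc / T ^+ 4) / m.+1%:R ^+ 2 = tc / T ^+ 4 * (2 / m.+1%:R ^+ 2) by ring.
have -> : 4 * tc / T ^+ 4 * (m.+1%:R^-1 - m.+2%:R^-1) =
   tc / T ^+ 4 * (4 * (m.+1%:R^-1 - m.+2%:R^-1)) by ring.
rewrite ler_wpM2l //; first exact: (divr_ge0 tc0 (ltW T4)).
have m1 : 1 <= m.+1%:R :> R by rewrite ler1n.
rewrite -[m.+2%:R]natr1; move: (m.+1%:R : R) m0 m1 => x x0 x1.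
have x2 : 0 < x + 1 by rewrite addr_gt0.
have -> : x^-1 - (x + 1)^-1 = (x * (x + 1))^-1 by field; rewrite !gt_eqF.
rewrite ler_pdivrMr ?exprn_gt0 //.
rewrite -mulrA -(@ler_pM2r _ (x + 1)) // (_ : 4 * _ * _ = 4 * x); last by field; rewrite !gt_eqF.
lra.
Qed.

Theorem exponential_sum T0 : 0 < T0 -> exists2 C : R, 0 < C &
  forall h T al n, (0 < h)%N -> T0 <= T -> b * T ^+ 2 <= n%:R ->
  `|\sum_(i < (n + n).+1) expfun w h T al (i%:R - n%:R)| <=
    C * (Num.sqrt (T / h%:R) * (T + h%:R) * square_sum h).
Proof.
(* For [T >= T0] this [Q T] exceeds [B0 T + 1], which bounds the number of relevant frequencies in a
   class modulo [3 h]. *)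
move=> T00; pose Q := B0 + T0^-1.
have sb0 : 0 <= Num.sqrt b := sqrtr_ge0 _.
have B00 : 0 <= B0 by rewrite mulr_ge0.
have Q0 : 0 <= Q by rewrite addr_ge0 // invr_ge0 ltW.
have tc0 := tail_const_ge0.
pose C := 2 * (Q + 12) * `|V0 + 3 * V1 * Q| + 4 * tc / T0 ^+ 3 + 1.
have C0 : 0 < C.
  apply: ltr_wpDl => //; apply: addr_ge0.
    by apply: mulr_ge0 => //; apply: mulr_ge0 => //; exact: addr_ge0.
  by apply: divr_ge0; [exact: mulr_ge0|exact: exprn_ge0 (ltW T00)].
exists C => // h T al n h0 TT hn.
have T_0 : 0 < T by exact: lt_le_trans TT.
have h0' : 0 < h%:R :> R by rewrite ltr0n.
have h1' : 1 <= h%:R :> R by rewrite ler1n.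
have p2 := pi_ge2 R; have p0 := pi_gt0 R.
have hQ : B0 * T + 1 <= Q * T.
  by rewrite /Q mulrDl lerD2l mulrC ler_pdivlMr // mul1r.
have [Lp hL] := expfun_Lip hw a0 h al T_0.
have cg := lip_continuous hL.
have := @poisson_bound R (expfun w h T al) Lp n 0 (C * (Num.sqrt (T / h%:R) * (T + h%:R) * square_sum h)) cg hL.
rewrite subr0; apply => m; rewrite subr0 (expfun_fourier hw a0 al m h0 T_0 hn).
have T2 : 0 < T ^+ 2 by rewrite exprn_gt0.
rewrite normrM (gtr0_norm T2).
apply: le_trans (ler_wpM2l (ltW T2) (expint_all al m h0 T_0 hQ)) _.
set L := 2 * pi * h%:R * T ^+ 3; set E := square_sum h.
have L0 : 0 < L by rewrite /L !mulr_gt0 // exprn_gt0.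
have sL : 0 < Num.sqrt L by rewrite sqrtr_gt0.
have E1 : 1 <= E by exact: square_sum_ge1.
have E0 : 0 <= E by exact: le_trans E1.
have Th : 0 <= T / h%:R by rewrite divr_ge0 // ltW.
have Th0 : 0 <= T + h%:R by rewrite addr_ge0 // ltW.
have s0 : 0 <= Num.sqrt (T / h%:R) := sqrtr_ge0 _.
have key : T ^+ 2 / Num.sqrt L <= Num.sqrt (T / h%:R).
  rewrite ler_pdivrMr // -sqrtrM // -[T ^+ 2](gtr0_norm T2) -sqrtr_sqr ler_wsqrtr //.
  rewrite /L (_ : T / h%:R * _ = (T ^+ 2) ^+ 2 * (2 * pi)); last by field; rewrite gt_eqF.
  rewrite ler_peMr ?sqr_ge0 //; lra.
have X0 : 0 <= Num.sqrt (T / h%:R) * (T + h%:R) * E.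
  by apply: mulr_ge0 => //; exact: mulr_ge0.
have -> : C * (Num.sqrt (T / h%:R) * (T + h%:R) * E) =
    2 * (Q + 12) * `|V0 + 3 * V1 * Q| * (Num.sqrt (T / h%:R) * (T + h%:R) * E)
    + 4 * tc / T0 ^+ 3 * (Num.sqrt (T / h%:R) * (T + h%:R) * E)
    + Num.sqrt (T / h%:R) * (T + h%:R) * E by rewrite /C; ring.
rewrite (mulrDr (T ^+ 2)) -[leLHS]addr0; apply: lerD => //; apply: lerD.
  apply: (@le_trans _ _ (2 * (Q * T + 12 * h%:R) * `|V0 + 3 * V1 * Q| * (T ^+ 2 / Num.sqrt L) * E)).
    rewrite -subr_ge0 (_ : _ - _ = 2 * (Q * T + 12 * h%:R) * (T ^+ 2 / Num.sqrt L) * E *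
      (`|V0 + 3 * V1 * Q| - (V0 + 3 * V1 * Q))); last by ring.
    rewrite mulr_ge0 ?subr_ge0 ?ler_norm // !mulr_ge0 ?invr_ge0 ?exprn_ge0 ?(ltW sL) ?(ltW T_0) //.
    by rewrite addr_ge0 ?mulr_ge0 // ltW.
  rewrite (_ : 2 * (Q + 12) * `|V0 + 3 * V1 * Q| * (Num.sqrt (T / h%:R) * (T + h%:R) * E) =
    2 * ((Q + 12) * (T + h%:R)) * `|V0 + 3 * V1 * Q| * Num.sqrt (T / h%:R) * E); last by ring.
  rewrite ler_wpM2r //; apply: ler_pM => //.
  - rewrite !mulr_ge0 // addr_ge0 ?mulr_ge0 // ltW //.
  - by rewrite divr_ge0 // ltW.
  rewrite ler_wpM2r // ler_wpM2l //.
  have h1 : 0 <= Q * h%:R by rewrite mulr_ge0.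
  lra.
(* Absorbs the tail: [T^-2 <= T / T0^3], and [T] is below the main bound because
   [T h <= (T + h)^2]. *)
have hT : T <= Num.sqrt (T / h%:R) * (T + h%:R) * E.
  apply: (@le_trans _ _ (Num.sqrt (T / h%:R) * (T + h%:R))); last by rewrite ler_peMr // mulr_ge0.
  rewrite -[leLHS](gtr0_norm T_0) -sqrtr_sqr -[X in _ * X](ger0_norm Th0) -sqrtr_sqr -sqrtrM //.
  rewrite ler_wsqrtr // mulrAC ler_pdivlMr // expr2 -!mulrA ler_wpM2l ?(ltW T_0) //.
  have := sqr_ge0 T; have := sqr_ge0 (h%:R : R); have := mulr_gt0 T_0 h0'; lra.
apply: (@le_trans _ _ (4 * tc / T0 ^+ 3 * T)); last first.
  apply: ler_wpM2l => //; apply: divr_ge0; [exact: mulr_ge0|exact: exprn_ge0 (ltW T00)].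
rewrite (_ : T ^+ 2 * (4 * tc / T ^+ 4) = 4 * tc * (T ^+ 2)^-1); last by field; rewrite gt_eqF.
rewrite -[leRHS]mulrA; apply: ler_wpM2l; first exact: mulr_ge0.
rewrite mulrC ler_pdivlMr ?exprn_gt0 // ler_pdivrMl ?exprn_gt0 //.
have : T0 ^+ 3 <= T ^+ 3 by rewrite lerXn2r ?nnegrE // ltW.
by rewrite [T ^+ 3]exprS mulrC.
Qed.

End ExponentialSum.

(** * Averages over the frequency *)

Section DivisorBound.
Local Open Scope nat_scope.

(** A divisor [d] of [m n] is the product of [gcdn d m] and a cofactor, and the cofactor divides
    [n], being coprime to [m / gcdn d m]. *)
Lemma size_divisorsM m n : 0 < m -> 0 < n ->
  size (divisors (m * n)) <= size (divisors m) * size (divisors n).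
Proof.
move=> m0 n0; have mn0 : 0 < m * n by rewrite muln_gt0 m0.
rewrite -(size_allpairs muln); apply: uniq_leq_size; first exact: divisors_uniq.
move=> d; rewrite -dvdn_divisors // => hd.
have d0 : 0 < d by exact: dvdn_gt0 hd.
have g0 : 0 < gcdn d m by rewrite gcdn_gt0 d0.
apply/allpairsP; exists (gcdn d m, d %/ gcdn d m); split => /=.
- by rewrite -dvdn_divisors // dvdn_gcdr.
- rewrite -dvdn_divisors //.
  have cop : coprime (d %/ gcdn d m) (m %/ gcdn d m).
    by rewrite /coprime -(eqn_pmul2r g0) muln_gcdl !divnK ?dvdn_gcdl ?dvdn_gcdr // mul1n.
  rewrite -(Gauss_dvdr _ cop) -(dvdn_pmul2r g0) divnK ?dvdn_gcdl //.
  by rewrite mulnAC divnK ?dvdn_gcdr.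
- by rewrite mulnC divnK // dvdn_gcdl.
Qed.

Lemma size_divisors_pfactor p e : prime p -> size (divisors (p ^ e)) <= e.+1.
Proof.
move=> pp; rewrite -[X in _ <= X](size_iota 0) -[X in _ <= X](size_map (expn p)).
apply: uniq_leq_size; first exact: divisors_uniq.
move=> d; rewrite -dvdn_divisors ?expn_gt0 ?prime_gt0 // => /(dvdn_pfactor d e pp) [m me ->].
by apply/mapP; exists m => //; rewrite mem_iota.
Qed.

Lemma prime_part n p : prime p -> 0 < n ->
  exists2 m, n = m * p ^ logn p n & 0 < m /\ ~~ (p %| m).
Proof.
move=> pp n0; have [m cpm e] := pfactor_coprime pp n0.
exists m => //; split; last by rewrite -prime_coprime.
by rewrite lt0n; apply: contraTneq n0 => m0; rewrite e m0.
Qed.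

End DivisorBound.

Section PowerSums.
Context {R : realType}.
Implicit Types (x y e d : R) (m n k N p : nat).

Lemma powR_natX p k e : ((p ^ k)%N%:R : R) `^ e = (p%:R `^ e) ^+ k.
Proof.
elim: k => [|k ih]; first by rewrite expn0 powR1 expr0.
by rewrite expnS natrM powRM // ih exprS.
Qed.

Lemma bernoulli_bound x : 1 < x ->
  exists2 B : R, 1 <= B & forall k, k.+1%:R <= B * x ^+ k.
Proof.
move=> x1; pose d := x - 1; have d0 : 0 < d by rewrite subr_gt0.
have hB k : 1 + k%:R * d <= x ^+ k.
  elim: k => [|k ih]; first by rewrite mul0r addr0 expr0.
  rewrite exprS (_ : x = 1 + d); last by rewrite /d addrC subrK.
  have h1 : 0 <= 1 + d by rewrite addr_ge0 // ltW.
  rewrite -(_ : x = 1 + d) in h1 *; last by rewrite /d addrC subrK.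
  apply: le_trans (ler_wpM2l h1 ih).
  have h2 : 0 <= k%:R * d ^+ 2 by rewrite mulr_ge0 // sqr_ge0.
  have -> : x = 1 + d by rewrite /d addrC subrK.
  by rewrite -natr1; lra.
exists (1 + d^-1); first by rewrite lerDl invr_ge0 ltW.
move=> k; apply: le_trans (ler_wpM2l _ (hB k)); last by rewrite addr_ge0 // invr_ge0 ltW.
rewrite mulrDr mulr1 mulrDl mul1r mulrCA mulVf ?gt_eqF // mulr1 -natr1.
have h1 : 0 <= k%:R * d by rewrite mulr_ge0 // ltW.
have h2 : 0 < d^-1 by rewrite invr_gt0.
lra.
Qed.

(** A prime with [p^e >= 2] costs nothing, as [l + 1 <= 2^l <= p^(e l)]. Each prime below [P0], just
    above [2^(1/e)], costs the factor [B] of [bernoulli_bound]. *)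
Lemma divisor_bound e : 0 < e ->
  exists2 C : R, 0 < C & forall n, (0 < n)%N -> (size (divisors n))%:R <= C * n%:R `^ e.
Proof.
move=> e0.
pose x : R := 2 `^ e.
have x1 : 1 < x.
  by have := @gt0_ltr_powR R e e0 1 2; rewrite powR1; apply; rewrite ?nnegrE ?ltr1n.
have [B B1 hB] := bernoulli_bound x1.
have B0 : 0 < B by exact: lt_le_trans B1.
pose P0 := (Num.truncn (2 `^ e^-1 : R)).+1.
have hP0 p : (P0 <= p)%N -> 2 <= p%:R `^ e :> R.
  move=> hp; have h : 2 `^ e^-1 <= p%:R :> R.
    by apply: le_trans (ltW (truncnS_gt _)) _; rewrite ler_nat.
  have := @ge0_ler_powR R e (ltW e0) (2 `^ e^-1) p%:R.
  rewrite !nnegrE powR_ge0 ler0n => /(_ isT isT h); apply: le_trans.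
  by rewrite -powRrM mulVf ?gt_eqF // powRr1.
exists (B ^+ P0); first by rewrite exprn_gt0.
(* Raising [k] by one admits one more candidate [q] as a prime factor of [n]; its full power is
   split off. *)
suff hs k n : (0 < n)%N -> (forall p, prime p -> (p %| n)%N -> (P0 - k <= p)%N) ->
    (size (divisors n))%:R <= B ^+ k * n%:R `^ e.
  by move=> n n0; apply: hs => // p _ _; rewrite subnn.
elim: k n => [|k ih] n n0 hn.
  rewrite expr0 mul1r; elim/ltn_ind: n n0 hn => n ihn n0 hn.
  have [n1|n1] := leqP n 1.
    have -> : n = 1%N by apply/eqP; rewrite eqn_leq n1.
    by rewrite powR1.
  have pp := pdiv_prime n1; set p := pdiv n in pp.
  have pn : (p %| n)%N by exact: pdiv_dvd.
  have [m em [m0 pm]] := prime_part pp n0.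
  have l0 : (0 < logn p n)%N by rewrite logn_gt0 mem_primes pp n0 pn.
  have mn : (m < n)%N.
    rewrite [X in (_ < X)%N]em ltn_Pmulr // -(exp1n (logn p n)) ltn_exp2r //; exact: prime_gt1.
  have mdn q : (q %| m)%N -> (q %| n)%N.
    by move=> qm; rewrite em; exact: dvdn_mulr.
  have hm := ihn m mn m0 (fun q pq qm => hn q pq (mdn q qm)).
  have hp := hP0 p; rewrite subn0 in hn; have {}hp := hp (hn p pp pn).
  have pe0 : (0 < p ^ logn p n)%N by rewrite expn_gt0 prime_gt0.
  have hsz : (size (divisors n) <= size (divisors m) * (logn p n).+1)%N.
    rewrite {1}em; apply: leq_trans (size_divisorsM m0 pe0) _.
    by rewrite leq_mul2l size_divisors_pfactor ?orbT.
  apply: (@le_trans _ _ ((size (divisors m))%:R * (logn p n).+1%:R)).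
    by rewrite -natrM ler_nat.
  rewrite [in leRHS]em natrM powRM // powR_natX; apply: ler_pM => //.
  apply: (@le_trans _ _ (2 ^+ logn p n)).
    by rewrite -natrX ler_nat ltn_expl.
  by rewrite lerXn2r // ?nnegrE // powR_ge0.
have [hk|hk] := leqP P0 k.
  have {}hn p : prime p -> (p %| n)%N -> (P0 - k <= p)%N.
    by move=> _ _; rewrite (eqP hk).
  apply: le_trans (ih n n0 hn) _; rewrite ler_wpM2r ?powR_ge0 // exprS.
  by rewrite ler_peMl // exprn_ge0 // ltW.
set q := (P0 - k.+1)%N in hn.
have eq1 : (P0 - k = q.+1)%N by rewrite /q subnSK.
have [pq|npq] := boolP (prime q); last first.
  have {}hn p : prime p -> (p %| n)%N -> (P0 - k <= p)%N.
    move=> pp pn; rewrite eq1 ltn_neqAle hn // andbT.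
    by apply: contraNneq npq => ->.
  apply: le_trans (ih n n0 hn) _; rewrite ler_wpM2r ?powR_ge0 // exprS.
  by rewrite ler_peMl // exprn_ge0 // ltW.
have [m em [m0 pm]] := prime_part pq n0.
have hm : (size (divisors m))%:R <= B ^+ k * m%:R `^ e.
  apply: ih => // p pp pdm; rewrite eq1 ltn_neqAle hn ?andbT //.
    by apply: contraNneq pm => ->.
  by rewrite em; exact: dvdn_mulr.
have qe0 : (0 < q ^ logn q n)%N by rewrite expn_gt0 prime_gt0.
have hsz : (size (divisors n) <= size (divisors m) * (logn q n).+1)%N.
  rewrite {1}em; apply: leq_trans (size_divisorsM m0 qe0) _.
  by rewrite leq_mul2l size_divisors_pfactor ?orbT.
apply: (@le_trans _ _ ((size (divisors m))%:R * (logn q n).+1%:R)).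
  by rewrite -natrM ler_nat.
rewrite [in leRHS]em natrM powRM // powR_natX exprS.
rewrite (mulrC B) mulrACA.
apply: ler_pM => //; apply: le_trans (hB _) _; rewrite ler_pM2l //.
rewrite lerXn2r // ?nnegrE ?powR_ge0 //.
apply: (@ge0_ler_powR R e (ltW e0)); rewrite ?nnegrE //.
by rewrite ler_nat prime_gt1.
Qed.

Lemma der_powR x e : 0 < x -> has_der (fun y => y `^ e) x (e * x `^ (e - 1)).
Proof. by move=> x0; exact: is_derive1_powR. Qed.

(** Comparison with the primitive [- y^(-d) / d] of the decreasing function [y^(-1-d)], in
    telescoping form; only a bound uniform in [N] is wanted. *)
Lemma zeta_bound d : 0 < d -> exists2 Z : R, 0 < Z &
  forall N, \sum_(n < N) n.+1%:R `^ (- (1 + d)) <= Z.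
Proof.
move=> d0; have di : 0 < d^-1 by rewrite invr_gt0.
exists (1 + d^-1); first by rewrite addr_gt0.
suff h N : \sum_(n < N.+1) n.+1%:R `^ (- (1 + d)) <= 1 + d^-1 * (1 - N.+1%:R `^ (- d)).
  case=> [|N]; first by rewrite big_ord0 addr_ge0 // ltW.
  apply: le_trans (h N) _; rewrite lerD2l ler_piMr ?(ltW di) // gerBl; exact: powR_ge0.
elim: N => [|N ih].
  by rewrite big_ord_recr big_ord0 /= !powR1 subrr mulr0 addr0 add0r.
rewrite big_ord_recr /=.
set u := N.+2%:R `^ (- (1 + d)).
suff hu : u <= d^-1 * (N.+1%:R `^ (- d) - N.+2%:R `^ (- d)).
  apply: le_trans (lerD ih hu) _; rewrite le_eqVlt; apply/orP; left; apply/eqP; ring.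
rewrite ler_pdivlMl //.
have h0 : N.+1%:R <= N.+2%:R :> R by rewrite ler_nat.
have pos y : N.+1%:R <= y -> 0 < y by apply: lt_le_trans; rewrite ltr0n.
have := @der_mono R (fun y => - (y `^ (- d)) - d * u * y)
  (fun y => d * y `^ (- d - 1) - d * u) N.+1%:R N.+2%:R h0.
have hd y : N.+1%:R <= y <= N.+2%:R ->
    has_der (fun y => - (y `^ (- d)) - d * u * y) y (d * y `^ (- d - 1) - d * u).
  by move=> /andP[hy _]; have h1 := der_powR (- d) (pos y hy); der; ring.
move=> /(_ hd) hh.
have : forall x0 : R, N.+1%:R <= x0 <= N.+2%:R -> 0 <= d * x0 `^ (- d - 1) - d * u.
  move=> y /andP[hy1 hy2]; rewrite -mulrBr mulr_ge0 ?(ltW d0) // subr_ge0 /u.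
  rewrite -opprD addrC !powRN lef_pV2 ?posrE ?powR_gt0 ?ltr0n ?pos //.
  apply: ge0_ler_powR; rewrite ?nnegrE ?(ltW (pos y hy1)) //.
  by rewrite addr_ge0 // ltW.
move=> /hh; rewrite -[N.+2%:R]natr1; lra.
Qed.

End PowerSums.

Section SquareSeries.
Context {R : realType}.
Implicit Types (e d x y : R) (h k l n v Y : nat).

Lemma count_multiples Y v : (0 < v)%N ->
  (\sum_(h < Y) (3 * h.+1 %| v) <= size (divisors v))%N.
Proof.
move=> v0; rewrite -(big_mkcond (fun h : 'I_Y => 3 * h.+1 %| v)%N (fun=> 1%N)).
rewrite sum1_card cardE -(size_map (fun h : 'I_Y => (3 * h.+1)%N)).
apply: uniq_leq_size.
  rewrite map_inj_uniq ?enum_uniq // => i j /eqP; rewrite eqn_pmul2l // eqSS => /eqP.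
  exact: val_inj.
move=> d /mapP [h]; rewrite mem_enum => hd ->; by rewrite -dvdn_divisors.
Qed.

Lemma single_le_sum n (F : 'I_n -> R) (i : 'I_n) : (forall j, 0 <= F j) -> F i <= \sum_(j < n) F j.
Proof. by move=> F0; rewrite (bigD1 i) //= lerDl sumr_ge0. Qed.

(** The number of signs for which [4 k^2 + l] or [4 k^2 - l] is a multiple of [3 h]. *)
Definition near_square h k l : nat :=
  ((3 * h %| 4 * k ^ 2 + l) + (4 * k ^ 2 == l %[mod 3 * h]))%N.

(** The offsets [l = r] and [l = 3 h - r] account for the two reciprocals, [l = 0] for the case
    [r = 0], which is why [2 / (l + 1)] stands for [1 / l]. With [k] and [l] fixed, [h] occurs only
    in a divisibility condition, ready for a divisor count. *)
Lemma square_weight_le h k : (0 < h)%N -> square_weight h k <=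
  \sum_(l < (3 * h)%N) 2 / l.+1%:R * (near_square h k l)%:R :> R.
Proof.
move=> h0; have h3 : (0 < 3 * h)%N by rewrite muln_gt0.
have t0 (l : nat) (b : bool) : 0 <= 2 / l.+1%:R * b%:R :> R by rewrite mulr_ge0 ?divr_ge0.
under eq_bigr do rewrite /near_square natrD mulrDr.
rewrite big_split /= /square_weight; case: eqVneq => [r0|r0].
  apply: (@le_trans _ _ (2 + 0)); first by rewrite addr0 ler1n.
  apply: lerD; last by apply: sumr_ge0.
  have := @single_le_sum _ (fun l : 'I_(3 * h) => 2 / l.+1%:R * (3 * h %| 4 * k ^ 2 + l)%:R)
    (Ordinal h3) (fun _ => t0 _ _).
  by rewrite /= addn0 divr1 /dvdn -/(square_res h k) r0 mulr1.
have rq : (square_res h k < 3 * h)%N by exact: ltn_pmod.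
have rgt : (0 < square_res h k)%N by rewrite lt0n.
set r := square_res h k in r0 rq rgt *.
have sq : (3 * h - r < 3 * h)%N by rewrite ltn_subrL rgt.
have inv2 (l : nat) : (0 < l)%N -> l%:R^-1 <= 2 / l.+1%:R :> R.
  move=> l0; rewrite ler_pdivlMr ?ltr0n // mulrC ler_pdivrMr ?ltr0n //.
  by rewrite -natrM ler_nat mul2n -addnn -addn1 leq_add2l.
rewrite [leLHS]addrC; apply: lerD.
  have := @single_le_sum _ (fun l : 'I_(3 * h) => 2 / l.+1%:R * (3 * h %| 4 * k ^ 2 + l)%:R)
    (Ordinal sq) (fun _ => t0 _ _).
  move=> /= hs; apply: le_trans hs => /=.
  have -> : (3 * h %| 4 * k ^ 2 + (3 * h - r))%N.
    rewrite /dvdn -modnDml -/(square_res h k) -/r subnKC ?modnn //; exact: ltnW.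
  by rewrite mulr1 inv2 // subn_gt0.
have := @single_le_sum _ (fun l : 'I_(3 * h) => 2 / l.+1%:R * (4 * k ^ 2 == l %[mod 3 * h])%:R)
  (Ordinal rq) (fun _ => t0 _ _).
move=> /= hs; apply: le_trans hs => /=.
by rewrite /r /square_res modn_mod eqxx mulr1 inv2.
Qed.

Lemma powR_antitone x y e : 0 < y -> y <= x -> 0 <= e -> x `^ (- e) <= y `^ (- e).
Proof.
move=> y0 yx e0; have x0 : 0 < x by exact: lt_le_trans yx.
rewrite !powRN lef_pV2 ?posrE ?powR_gt0 //.
by apply: (@ge0_ler_powR R e e0); rewrite ?nnegrE // ltW.
Qed.

Lemma powR_add x e d : 0 < x -> x `^ e * x `^ d = x `^ (e + d).
Proof. by move=> x0; rewrite powRD //; apply/implyP => _; exact: lt0r_neq0. Qed.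

(** As [k, l < 3 h], the weight [h^(-1-e)] is at most a constant times
    [(k+1)^(-1-e/2) (l+1)^(-e/2)]. The number of admissible [h] is at most a constant times
    [v^(e/8)], which returns only [(k+1)^(e/4) (l+1)^(e/8)]. *)
Lemma multiples_power_sum e C k l v Y (P : pred nat) : 0 < e ->
  (forall n, (0 < n)%N -> (size (divisors n))%:R <= C * n%:R `^ (e / 8)) ->
  (0 < v)%N -> (v <= 4 * (k.+1 ^ 2 * l.+1))%N ->
  (forall h, P h -> (3 * h.+1 %| v)%N) ->
  \sum_(h < Y | ((k < 3 * h.+1) && (l < 3 * h.+1))%N) h.+1%:R `^ (- (1 + e)) * (P h)%:R
   <= 3 `^ (1 + e) * C * 4 `^ (e / 8) * (k.+1%:R `^ (- (1 + e / 4)) * l.+1%:R `^ (- (e / 4))).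
Proof.
move=> e0 hC v0 hv hP.
have e8 : 0 <= e / 8 by rewrite divr_ge0 // ltW.
have k0 : 0 < k.+1%:R :> R by rewrite ltr0n.
have l0 : 0 < l.+1%:R :> R by rewrite ltr0n.
have C0 : 0 <= C.
  have := hC 1%N isT; rewrite powR1 mulr1; apply: le_trans; exact: ler0n.
pose A : R := 3 `^ (1 + e) * (k.+1%:R `^ (- (1 + e / 2)) * l.+1%:R `^ (- (e / 2))).
have A0 : 0 <= A by rewrite !mulr_ge0 ?powR_ge0.
apply: (@le_trans _ _ (\sum_(h < Y) A * (3 * h.+1 %| v)%N%:R)).
  rewrite big_mkcond; apply: ler_sum => h _; case: ifP => [/andP[hk hl]|_]; last first.
    by rewrite mulr_ge0.
  have [Ph|_] := boolP (P h); last by rewrite mulr0 mulr_ge0.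
  rewrite (hP _ Ph) !mulr1 /A.
  have H0 : 0 < (3 * h.+1)%N%:R :> R by rewrite ltr0n.
  have -> : h.+1%:R `^ (- (1 + e)) = 3 `^ (1 + e) * (3 * h.+1)%N%:R `^ (- (1 + e)).
    rewrite natrM powRM // mulrA (powRN 3) mulfV ?mul1r // gt_eqF // powR_gt0 //.
  rewrite ler_wpM2l ?powR_ge0 // (_ : - (1 + e) = - (1 + e / 2) + - (e / 2)); last by field.
  rewrite -powR_add //; apply: ler_pM; rewrite ?powR_ge0 //.
    by apply: powR_antitone; rewrite ?ler_nat // addr_ge0 // divr_ge0 // ltW.
  by apply: powR_antitone; rewrite ?ler_nat // divr_ge0 // ltW.
rewrite -mulr_sumr -natr_sum.
apply: (@le_trans _ _ (A * (C * v%:R `^ (e / 8)))).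
  rewrite ler_wpM2l //; apply: le_trans (hC v v0); rewrite ler_nat; exact: count_multiples.
have hv' : v%:R `^ (e / 8) <= 4 `^ (e / 8) * (k.+1%:R `^ (e / 8) * k.+1%:R `^ (e / 8) * l.+1%:R `^ (e / 8)) :> R.
  rewrite -!powRM // -?natrM; apply: (@ge0_ler_powR R _ e8); rewrite ?nnegrE //.
  by rewrite ler_nat mulnn.
apply: (@le_trans _ _ (A * (C * (4 `^ (e / 8) *
    (k.+1%:R `^ (e / 8) * k.+1%:R `^ (e / 8) * l.+1%:R `^ (e / 8)))))).
  by rewrite ler_wpM2l // ler_wpM2l.
have hk : k.+1%:R `^ (- (1 + e / 2)) * (k.+1%:R `^ (e / 8) * k.+1%:R `^ (e / 8)) =
    k.+1%:R `^ (- (1 + e / 4)) :> R.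
  by rewrite !powR_add //; congr powR; field.
have hl : l.+1%:R `^ (- (e / 2)) * l.+1%:R `^ (e / 8) <= l.+1%:R `^ (- (e / 4)) :> R.
  by rewrite powR_add //; apply: ler_powR; [rewrite ler1n|lra].
rewrite /A; apply: (@le_trans _ _ (3 `^ (1 + e) * C * 4 `^ (e / 8) *
   (k.+1%:R `^ (- (1 + e / 4)) * (l.+1%:R `^ (- (e / 2)) * l.+1%:R `^ (e / 8))))).
  rewrite -hk le_eqVlt; apply/orP; left; apply/eqP.
  move: (3 `^ (1 + e)) (4 `^ (e / 8)) (k.+1%:R `^ (- (1 + e / 2))) (k.+1%:R `^ (e / 8)) (l.+1%:R `^ (- (e / 2))) (l.+1%:R `^ (e / 8)) => x1 x2 x3 x4 x5 x6.
  ring.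
by rewrite ler_wpM2l ?mulr_ge0 ?powR_ge0 // ler_wpM2l ?powR_ge0.
Qed.

(** The divisor bound fails exactly when [4 k^2 + l] or [4 k^2 - l] is 0, a multiple of every [3 h].
    This forces [l = 4 k^2], where the convergence of the series over [h] is used instead. *)
Lemma near_square_sum e : 0 < e -> exists2 K : R, 0 < K & forall k l Y,
  \sum_(h < Y | ((k < 3 * h.+1) && (l < 3 * h.+1))%N)
     h.+1%:R `^ (- (1 + e)) * (near_square h.+1 k l)%:R
   <= K * (k.+1%:R `^ (- (1 + e / 4)) * l.+1%:R `^ (- (e / 4)) + (l == 4 * k ^ 2)%N%:R).
Proof.
move=> e0; have [C C0 hC] := divisor_bound (divr_gt0 e0 (ltr0n R 8)).
have [Z Z0 hZ] := zeta_bound e0.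
pose A : R := 3 `^ (1 + e) * C * 4 `^ (e / 8).
have A0 : 0 < A by rewrite !mulr_gt0 ?powR_gt0.
exists (2 * A + 2 * Z); first by rewrite addr_gt0 ?mulr_gt0.
move=> k l Y; set p := _ * l.+1%:R `^ _.
have p0 : 0 <= p by rewrite mulr_ge0 ?powR_ge0.
under eq_bigr do rewrite /near_square natrD mulrDr.
rewrite big_split /=.
have bnd : (4 * k ^ 2 + l <= 4 * (k.+1 ^ 2 * l.+1))%N.
  rewrite !expnS !expn0; nia.
have ztriv (P : pred nat) :
    \sum_(h < Y | ((k < 3 * h.+1) && (l < 3 * h.+1))%N) h.+1%:R `^ (- (1 + e)) * (P h)%:R <= Z.
  apply: le_trans (hZ Y); rewrite big_mkcond; apply: ler_sum => h _.
  by case: ifP => _; rewrite ?powR_ge0 // ler_piMr ?powR_ge0 //; case: (P h).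
have main (P : pred nat) v : (v <= 4 * (k.+1 ^ 2 * l.+1))%N ->
    ((0 < v)%N || (l == 4 * k ^ 2)%N) -> (forall h, P h -> (3 * h.+1 %| v)%N) ->
    \sum_(h < Y | ((k < 3 * h.+1) && (l < 3 * h.+1))%N) h.+1%:R `^ (- (1 + e)) * (P h)%:R
      <= (A + Z) * (p + (l == 4 * k ^ 2)%N%:R).
  move=> hv v0 hP; case: eqVneq v0 => [_ _|_]; last first.
    rewrite orbF addr0 => v0; apply: le_trans (multiples_power_sum _ e0 hC v0 hv hP) _.
    by rewrite -/A -/p mulrDl lerDl mulr_ge0 // ltW.
  apply: le_trans (ztriv P) _; rewrite mulrDr mulr1.
  have h1 : 0 <= (A + Z) * p by rewrite mulr_ge0 // ltW // addr_gt0.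
  lra.
have -> : 2 * A + 2 * Z = (A + Z) + (A + Z) by ring.
rewrite mulrDl; apply: lerD.
  apply: (main (fun h => (3 * h.+1 %| 4 * k ^ 2 + l)%N) _ bnd) => //.
  by case: l {p p0 bnd ztriv main} => [|l]; [case: k|rewrite addnS].
have [hle|hlt] := leqP l (4 * k ^ 2).
  apply: (main (fun h => (4 * k ^ 2 == l %[mod 3 * h.+1])%N) (4 * k ^ 2 - l)%N).
  - by apply: leq_trans bnd; lia.
  - by move: hle; rewrite subn_gt0 leq_eqVlt orbC.
  - by move=> h; rewrite eqn_mod_dvd.
apply: (main (fun h => (4 * k ^ 2 == l %[mod 3 * h.+1])%N) (l - 4 * k ^ 2)%N).
- by apply: leq_trans bnd; rewrite leq_subLR; lia.
- by rewrite subn_gt0 hlt.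
- by move=> h; rewrite eq_sym eqn_mod_dvd // ltnW.
Qed.

(** After exchanging the sums, the factor [2 / (l + 1)] makes the series over [l] converge, and on
    the exceptional diagonal [l = 4 k^2] it leaves [O((k+1)^-2)]. *)
Lemma square_sum_series e : 0 < e -> exists2 C : R, 0 < C & forall Y,
  \sum_(h < Y) h.+1%:R `^ (- (1 + e)) * square_sum h.+1 <= C.
Proof.
move=> e0; have [K K0 hK] := near_square_sum e0.
have e4 : 0 < e / 4 by rewrite divr_gt0.
have [Z Z0 hZ] := zeta_bound e4.
have [Z1 Z10 hZ1] := zeta_bound (@ltr01 R).
exists (2 * K * (Z * Z) + 4 * K * Z1); first by rewrite addr_gt0 // !mulr_gt0.
move=> Y.
(* The ranges of [k] and [l] are made independent of [h], with the old ranges kept as a condition,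
   so that the sums can be exchanged. *)
have widen (h : 'I_Y) : h.+1%:R `^ (- (1 + e)) * square_sum h.+1 <=
   \sum_(k < 3 * Y) \sum_(l < 3 * Y) 2 / l.+1%:R *
     (if ((k < 3 * h.+1) && (l < 3 * h.+1))%N then h.+1%:R `^ (- (1 + e)) * (near_square h.+1 k l)%:R else 0).
  have hY : (3 * h.+1 <= 3 * Y)%N by rewrite leq_mul2l ltn_ord.
  rewrite /square_sum (big_ord_widen _ (fun k => square_weight h.+1 k) hY) big_mkcond mulr_sumr.
  apply: ler_sum => k _; case: ifP => hk /=; last first.
    by rewrite mulr0; apply: sumr_ge0 => l _; rewrite mulr0.
  apply: le_trans (ler_wpM2l (powR_ge0 _ _) (@square_weight_le h.+1 k isT)) _.
  rewrite (big_ord_widen _ (fun l => 2 / l.+1%:R * (near_square h.+1 k l)%:R : R) hY).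
  rewrite big_mkcond mulr_sumr; apply: ler_sum => l _; case: ifP => hl; last by rewrite !mulr0.
  by rewrite mulrCA.
apply: le_trans (ler_sum _ (fun i _ => widen i)) _.
rewrite exchange_big /=; under eq_bigr do rewrite exchange_big /=.
apply: (@le_trans _ _ (\sum_(k < 3 * Y) \sum_(l < 3 * Y)
   (2 * K * (k.+1%:R `^ (- (1 + e / 4)) * l.+1%:R `^ (- (1 + e / 4)))
    + (if (l == 4 * k ^ 2 :> nat)%N then 4 * K * k.+1%:R `^ (- (1 + 1)) else 0)))).
  apply: ler_sum => k _; apply: ler_sum => l _.
  have l0 : 0 < l.+1%:R :> R by rewrite ltr0n.
  have k0 : 0 < k.+1%:R :> R by rewrite ltr0n.
  rewrite -mulr_sumr -big_mkcond.
  apply: le_trans (ler_wpM2l _ (hK k l Y)) _; first by rewrite divr_ge0.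
  rewrite !mulrDr; apply: lerD.
    have -> : l.+1%:R `^ (- (1 + e / 4)) = l.+1%:R^-1 * l.+1%:R `^ (- (e / 4)) :> R.
      by rewrite -(powR_inv1 (ltW l0)) powR_add // opprD.
    by rewrite le_eqVlt; apply/orP; left; apply/eqP; ring.
  case: eqP => [el|_]; last by rewrite !mulr0.
  have -> : k.+1%:R `^ (- (1 + 1)) = (k.+1%:R ^+ 2)^-1 :> R by rewrite powRN -(powR_mulrn 2).
  rewrite mulr1 (mulrC _ K) (mulrC 4) -mulrA ler_pM2l // ler_pdivrMr // mulrAC.
  rewrite ler_pdivlMr ?exprn_gt0 // -natrX -!natrM ler_nat el !expnS !expn0; nia.
under eq_bigr do rewrite big_split /=.
rewrite big_split /=; apply: lerD.
  under eq_bigr do (under eq_bigr do rewrite mulrA; rewrite -mulr_sumr).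
  apply: (@le_trans _ _ (\sum_(k < 3 * Y) (2 * K * Z) * k.+1%:R `^ (- (1 + e / 4)))).
    apply: ler_sum => k _.
    have c0 : 0 <= 2 * K * k.+1%:R `^ (- (1 + e / 4)).
      by rewrite mulr_ge0 ?powR_ge0 // mulr_ge0 // ltW.
    by apply: le_trans (ler_wpM2l c0 (hZ _)) _; rewrite mulrAC.
  rewrite -mulr_sumr mulrA ler_wpM2l ?hZ //.
  by apply: mulr_ge0; [apply: mulr_ge0 => //|]; exact: ltW.
apply: (@le_trans _ _ (\sum_(k < 3 * Y) 4 * K * k.+1%:R `^ (- (1 + 1)))).
  apply: ler_sum => k _; rewrite -big_mkcond /=.
  have c0 : 0 <= 4 * K * k.+1%:R `^ (- (1 + 1)) by rewrite mulr_ge0 ?powR_ge0 // mulr_ge0 // ltW.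
  case: (ltnP (4 * k ^ 2) (3 * Y)) => hkY.
    by rewrite (big_pred1 (Ordinal hkY)).
  rewrite big_pred0 // => l; apply/negbTE; rewrite neq_ltn (leq_trans (ltn_ord l) hkY) //.
by rewrite -mulr_sumr ler_wpM2l // mulr_ge0 // ltW.
Qed.

End SquareSeries.

(** * The double sum *)

Section DoubleSum.
Context {R : realType}.
Implicit Types (T H al x y u s e : R) (h n m i j N : nat).

Lemma even_symsum (F : R -> R) m : (forall x, F (- x) = F x) ->
  \sum_(i < (m + m).+1) F (i%:R - m%:R) = F 0 + 2 * \sum_(h < m) F h.+1%:R.
Proof.
move=> hF; elim: m => [|m ih].
  by rewrite big_ord_recr !big_ord0 /= subrr mulr0 add0r addr0.
by rewrite (symsumS F) ih hF big_ord_recr /=; move: (\sum_(h < m) _) => S; ring.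
Qed.

Lemma fourier_int_even (g : R -> R) n x : fourier_int g n (- x) = fourier_int g n x.
Proof. by apply: itg_eq => y _; rewrite mulNr cosN. Qed.

Section Coefficients.
Variables (v v1 v2 : R -> R) (c d M' : R).
Hypothesis hv : bumpC2 v v1 v2 c d M'.

(** The trivial bound and two integrations by parts give [min(1, (H / h)^2)], which is below every
    power with exponent between 0 and 2. The choice of [s] is left to [slice_term]. *)
Lemma fourier_coef_bound H h al s : 0 < H -> (0 < h)%N -> 0 <= s <= 2 ->
  `|itg c d (fun u => v u * cos (2 * pi * h%:R / H * u + al))| <= M' * (d - c) * (H / h%:R) `^ s.
Proof.
move=> H0 h0 /andP[s0 s2]; have cd := bump_ab hv; have cv := bump_cont hv.
have M0 := bump_M hv.
have h0' : 0 < h%:R :> R by rewrite ltr0n.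
have p2 := pi_ge2 R; have p0 := pi_gt0 R.
have A0 : 0 <= M' * (d - c) by rewrite mulr_ge0 // subr_ge0 ltW.
have q0 : 0 < H / h%:R by rewrite divr_gt0.
have [hq|hq] := leP (H / h%:R) 1.
  have L0 : 0 < 2 * pi * h%:R / H by rewrite divr_gt0 // !mulr_gt0.
  apply: le_trans (fourier_decay al hv L0) _; rewrite ler_wpM2l //.
  apply: (@le_trans _ _ ((H / h%:R) ^+ 2)); last first.
    by rewrite -powR_mulrn ?(ltW q0) //; apply: ger_powR => //; rewrite q0.
  rewrite -exprVn lerXn2r ?nnegrE ?invr_ge0 ?(ltW L0) ?(ltW q0) //.
  rewrite invf_div ler_pM2l // lef_pV2 ?posrE // ?mulr_gt0 //.
  rewrite ler_peMl ?(ltW h0') //; lra.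
apply: (@le_trans _ _ (M' * (d - c))).
  apply: itg_bound; [exact: ltW|by cont|] => u _.
  by rewrite -[M']mulr1; apply: norm_mul_le; [exact: (bump_le0 hv)|exact: cos_max].
rewrite ler_peMr //; have := @ge0_ler_powR R s s0 1 (H / h%:R).
by rewrite powR1 !nnegrE ler01 (ltW q0) => /(_ isT isT (ltW hq)).
Qed.

Lemma bump_Lip y z : `|v y - v z| <= M' * `|y - z|.
Proof.
have := @der_lip R v v1 (Num.min y z) (Num.max y z) M' z y; apply.
- by move=> x _; exact: (bump_der1 hv).
- by move=> x _; exact: (bump_le1 hv).
- by rewrite ge_min le_max lexx !orbT.
- by rewrite ge_min le_max lexx.
Qed.

End Coefficients.

Section Weights.
Variables (w w1 w2 : R -> R) (a b M : R) (v v1 v2 : R -> R) (c d M' : R).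
Hypotheses (hw : bumpC2 w w1 w2 a b M) (a0 : 0 < a) (hv : bumpC2 v v1 v2 c d M').

(** Poisson summation: the integral is the frequency 0, and the frequency [h] contributes
    [O(T^-2 h^-2)]. *)
Lemma bump_riemann T0 : 0 < T0 -> exists2 C : R, 0 < C & forall T n, T0 <= T ->
  b * T ^+ 2 <= n%:R ->
  `|\sum_(i < (n + n).+1) w ((i%:R - n%:R) / T ^+ 2) - T ^+ 2 * itg a b w| <= C.
Proof.
move=> T00; have ab := bump_ab hw; have cw := bump_cont hw; have M0 := bump_M hw.
have [Z Z0 hZ] := zeta_bound (@ltr01 R).
pose D := M * (b - a) / T0 ^+ 2.
have D0 : 0 <= D.
  apply: divr_ge0; first by rewrite mulr_ge0 // subr_ge0 ltW.
  by rewrite exprn_ge0 // ltW.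
exists (2 * (D * Z) + 1); first by apply: ltr_wpDl => //; apply: mulr_ge0 => //; apply: mulr_ge0 => //; exact: ltW.
move=> T n TT hn; have T_0 : 0 < T by exact: lt_le_trans TT.
have T2 : 0 < T ^+ 2 by rewrite exprn_gt0.
pose g x := w (x / T ^+ 2).
have hL y z : `|g y - g z| <= M / T ^+ 2 * `|y - z|.
  apply: le_trans (bump_Lip hw _ _) _.
  by rewrite -mulrBl normrM normfV (gtr0_norm T2) mulrA mulrAC.
have cg := lip_continuous hL.
have e k : fourier_int g n k = T ^+ 2 * itg a b (fun x => w x * cos (2 * pi * k * T ^+ 2 * x + 0)).
  rewrite /fourier_int (@itg_support _ _ _ _ (a * T ^+ 2) (b * T ^+ 2)).
  - have cF : continuous (fun x => g x * cos (k * (2 * pi * x))) by cont.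
    have := itg_affine 0 cF T2 (ltW ab); rewrite !addr0 (mulrC (T ^+ 2) a) (mulrC (T ^+ 2) b).
    move=> /(congr1 (fun z => T ^+ 2 * z)); rewrite mulVKf ?gt_eqF // => <-.
    congr (_ * _); apply: itg_eq => x _; rewrite !addr0 /g; congr (w _ * cos _).
      by rewrite mulrC mulKf // gt_eqF.
    by ring.
  - by cont.
  - have : 0 <= a * T ^+ 2 by rewrite mulr_ge0 // ltW.
    have := ler0n R n; lra.
  - by rewrite ler_pM2r // ltW.
  - lra.
  - move=> x; rewrite -(ltr_pdivlMr _ _ T2) -(ltr_pdivrMr _ _ T2) => hx.
    by rewrite /g (bump_out0 hw) // mul0r.
have p2 := pi_ge2 R; have p0 := pi_gt0 R.
have := @poisson_bound R g _ n (T ^+ 2 * itg a b w) (2 * (D * Z) + 1) cg hL; apply => m.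
rewrite (even_symsum _ (fourier_int_even g n)).
have -> : fourier_int g n 0 = T ^+ 2 * itg a b w.
  by rewrite e; congr (_ * _); apply: itg_eq => x _; rewrite mulr0 !mul0r addr0 cos0 mulr1.
rewrite addrAC subrr add0r normrM (ger0_norm (ler0n _ 2)).
apply: (@le_trans _ _ (2 * (D * Z))); last by rewrite lerDl.
rewrite ler_pM2l //; apply: le_trans (ler_norm_sum _ _ _) _.
apply: (@le_trans _ _ (D * \sum_(h < m) h.+1%:R `^ (- (1 + 1)))); last by rewrite ler_wpM2l.
rewrite mulr_sumr; apply: ler_sum => h _; rewrite e.
have k0 : 0 < h.+1%:R :> R by rewrite ltr0n.
have L0 : 0 < 2 * pi * h.+1%:R * T ^+ 2 by rewrite !mulr_gt0.
rewrite normrM (gtr0_norm T2).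
apply: le_trans (ler_wpM2l (ltW T2) (fourier_decay 0 hw L0)) _.
have -> : h.+1%:R `^ (- (1 + 1)) = (h.+1%:R ^+ 2)^-1 :> R by rewrite powRN -(powR_mulrn 2) // ltW.
have MM : 0 <= M * (b - a) by rewrite mulr_ge0 // subr_ge0 ltW.
have -> : T ^+ 2 * (M * (b - a) / (2 * pi * h.+1%:R * T ^+ 2) ^+ 2) =
    M * (b - a) * (((2 * pi) ^+ 2 * T ^+ 2)^-1 * (h.+1%:R ^+ 2)^-1).
  have pp0 : 0 < 2 * pi :> R by rewrite mulr_gt0.
  by move: (h.+1%:R : R) (2 * pi : R) k0 pp0 => k P k0 P0; field; rewrite !gt_eqF.
rewrite /D -[leRHS]mulrA; apply: ler_wpM2l => //; apply: ler_wpM2r.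
  by rewrite invr_ge0 exprn_ge0 // ltW.
have T02 : 0 < T0 ^+ 2 by rewrite exprn_gt0.
have pp : 1 <= (2 * pi) ^+ 2 :> R by apply: exprn_ege1; lra.
rewrite lef_pV2 ?posrE //; last by apply: mulr_gt0 => //; exact: lt_le_trans pp.
apply: (@le_trans _ _ (T ^+ 2)); last by rewrite ler_peMl // ltW.
by rewrite lerXn2r // nnegrE ltW.
Qed.

(** [S(T, H)] of the overview, cut to [|x| <= n], [|y| <= N] and reindexed by [x = i - n],
    [y = j - N]. *)
Definition dsum T H n N : R := \sum_(i < (n + n).+1) \sum_(j < (N + N).+1)
  w ((i%:R - n%:R) / T ^+ 2) *
  v (H * (j%:R - N%:R - (i%:R - n%:R) * Num.sqrt (i%:R - n%:R))).

Definition dsum_slice T H n x : R := \sum_(i < (n + n).+1)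
  w ((i%:R - n%:R) / T ^+ 2) * v (H * (x - (i%:R - n%:R) * Num.sqrt (i%:R - n%:R))).

Lemma dsum_slice_Lip T H n : 0 < H -> exists L, forall y z,
  `|dsum_slice T H n y - dsum_slice T H n z| <= L * `|y - z|.
Proof.
move=> H0; exists ((n + n).+1%:R * (M * (M' * H))) => y z.
rewrite /dsum_slice -sumrB; apply: le_trans (ler_norm_sum _ _ _) _.
have -> : (n + n).+1%:R * (M * (M' * H)) * `|y - z| =
    \sum_(i < (n + n).+1) M * (M' * H) * `|y - z|.
  by rewrite sumr_const card_ord -mulrA mulr_natl.
apply: ler_sum => i _.
rewrite -mulrBr -mulrA; apply: norm_mul_le; first exact: (bump_le0 hw).
apply: le_trans (bump_Lip hv _ _) _; rewrite -mulrBr opprB addrA subrK.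
by rewrite normrM (gtr0_norm H0) mulrA.
Qed.

(* [N] is large enough for [v (H (x - m^(3/2)))] to vanish for [|x| > N + 1/2]
   and every [m] in the support of [w (m / T^2)]. *)
Definition wide T H N := b * T ^+ 2 * Num.sqrt (b * T ^+ 2) + (`|c| + `|d|) / H <= N%:R.

(** The substitution [u = H (y - x^(3/2))] and the addition theorem separate the Fourier
    coefficients of [v] from the exponential sums over [x]. *)
Lemma dsum_slice_fourier T H n N h : 0 < T -> 0 < H -> wide T H N ->
  fourier_int (dsum_slice T H n) N h%:R = H^-1 *
    (itg c d (fun u => v u * cos (2 * pi * h%:R / H * u + 0)) *
       (\sum_(i < (n + n).+1) expfun w h T 0 (i%:R - n%:R))
     - itg c d (fun u => v u * cos (2 * pi * h%:R / H * u + - (pi / 2))) *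
       (\sum_(i < (n + n).+1) expfun w h T (- (pi / 2)) (i%:R - n%:R))).
Proof.
move=> T_0 H0 hN; have cd := bump_ab hv; have cv := bump_cont hv.
have T2 : 0 < T ^+ 2 by rewrite exprn_gt0.
have p0 := pi_gt0 R.
pose x_ (i : nat) : R := i%:R - n%:R.
pose y_ (i : nat) : R := x_ i * Num.sqrt (x_ i).
pose F (i : nat) (x : R) : R := w (x_ i / T ^+ 2) * v (H * (x - y_ i)) * cos (h%:R * (2 * pi * x)).
have cF i : continuous (F i).
  apply: cont_mul; last by cont.
  apply: cont_mul; first exact: cont_cst.
  apply: (cont_comp cv); apply: cont_mul; first exact: cont_cst.
  by apply: cont_add; [exact: cont_id|exact: cont_cst].
have lN : - (N%:R + 1 / 2) <= N%:R + 1 / 2 :> R by have := ler0n R N; lra.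
transitivity (\sum_(i < (n + n).+1) itg (- (N%:R + 1 / 2)) (N%:R + 1 / 2) (F i)).
  rewrite -itg_sum //; apply: itg_eq => x _.
  by rewrite /dsum_slice mulr_suml.
rewrite !mulr_sumr -sumrB mulr_sumr; apply: eq_bigr => i _.
rewrite -/(x_ i); have [hx|hx] := boolP (a < x_ i / T ^+ 2 < b); last first.
  rewrite /expfun (bump_out0 hw hx) !mul0r !mulr0 subrr mulr0.
  by apply: itg_zero => // x _; rewrite /F (bump_out0 hw hx) !mul0r.
have /andP[hx1 hx2] := hx.
have x0 : 0 <= x_ i.
  have : 0 < x_ i / T ^+ 2 by exact: lt_trans hx1.
  by rewrite pmulr_lgt0 ?invr_gt0 // => /ltW.
have xb : x_ i <= b * T ^+ 2 by rewrite -ler_pdivrMr // ltW.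
have y0 : 0 <= y_ i by rewrite mulr_ge0 // sqrtr_ge0.
have yb : y_ i <= b * T ^+ 2 * Num.sqrt (b * T ^+ 2).
  by apply: ler_pM; rewrite ?sqrtr_ge0 ?ler_wsqrtr.
have Hi : 0 < H^-1 by rewrite invr_gt0.
rewrite (@itg_support _ (F i) _ _ (H^-1 * c + y_ i) (H^-1 * d + y_ i)) //; last 4 first.
- have : - (`|c| / H) <= H^-1 * c.
    by rewrite [leRHS]mulrC -mulNr ler_pM2r // lerNl -normrN ler_norm.
  move: hN; rewrite /wide mulrDl.
  have : 0 <= `|d| / H by rewrite divr_ge0 // ltW.
  have : 0 <= b * T ^+ 2 * Num.sqrt (b * T ^+ 2) by exact: le_trans yb.
  have := ler0n R N; lra.
- by rewrite lerD2r ler_pM2l // ltW.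
- have : H^-1 * d <= `|d| / H by rewrite [leLHS]mulrC ler_pM2r // ler_norm.
  move: hN; rewrite /wide mulrDl.
  have : 0 <= `|c| / H by rewrite divr_ge0 // ltW.
  lra.
- move=> x hx'; rewrite /F (bump_out0 hv) ?mulr0 ?mul0r //.
  apply: contra hx' => /andP[h1 h2].
  by apply/andP; split; [rewrite -ltrBrDr|rewrite -ltrBlDr];
    rewrite -(ltr_pM2l H0) mulrA mulfV ?gt_eqF // mul1r.
have ha := itg_affine (y_ i) (cF i) Hi (ltW cd).
rewrite invrK in ha.
have -> : itg (H^-1 * c + y_ i) (H^-1 * d + y_ i) (F i) =
    H^-1 * itg c d (fun x => F i (H^-1 * x + y_ i)) by rewrite ha mulKf // gt_eqF.
congr (_ * _).
have cg al : continuous (fun u => v u * cos (2 * pi * h%:R / H * u + al)) by cont.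
rewrite ![_ * expfun _ _ _ _ _]mulrC -!itgZ // -itgB; [|exact: cont_mul (@cont_cst _ _) (cg _)..].
apply: itg_eq => u _; rewrite /F /expfun addrK mulVKf ?gt_eqF // -/(y_ i) addr0.
rewrite addr0 !cosBpihalf.
have -> : h%:R * (2 * pi * (H^-1 * u + y_ i)) = 2 * pi * h%:R * y_ i + 2 * pi * h%:R / H * u.
  by field; rewrite gt_eqF.
rewrite cosD; move: (cos _) (cos _) (sin _) (sin _) (w _) (v _) => c1 c2 s1 s2 W V; ring.
Qed.

End Weights.
End DoubleSum.

Section DoubleSumAsymptotics.
Context {R : realType}.
Variables (w w1 w2 : R -> R) (a b M : R) (v v1 v2 : R -> R) (c d M' : R).
Hypotheses (hw : bumpC2 w w1 w2 a b M) (a0 : 0 < a) (hv : bumpC2 v v1 v2 c d M').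
Implicit Types (T H al x y u s e : R) (h n m i j N : nat) (CA : R).

(** The part [T^(3/2) h^(-1/2)] is paired with the exponent [s = 1/2 + e], the part
    [T^(1/2) h^(1/2)] with [s = 3/2 + e]; both leave [h^(-1-e)]. The condition [e <= 1/2] is
    [s <= 2]. *)
Lemma slice_term T H e h n CA : 0 < T -> 0 < H -> (0 < h)%N -> 0 <= e <= 1 / 2 -> 0 <= CA ->
  (forall al, `|\sum_(i < (n + n).+1) expfun w h T al (i%:R - n%:R)| <=
    CA * (Num.sqrt (T / h%:R) * (T + h%:R) * square_sum h)) ->
  forall N, wide b c d T H N -> `|fourier_int (dsum_slice w v T H n) N h%:R| <=
    H^-1 * (2 * (M' * (d - c)) * CA * (Num.sqrt T * (T * H `^ (1 / 2 + e) + H `^ (3 / 2 + e)))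
     * (h%:R `^ (- (1 + e)) * square_sum h)).
Proof.
move=> T_0 H0 h0 /andP[e0 e1] CA0 hA N hN.
have h0' : 0 < h%:R :> R by rewrite ltr0n.
have Hi : 0 < H^-1 by rewrite invr_gt0.
have cd := bump_ab hv; have M0 := bump_M hv.
have D0 : 0 <= M' * (d - c) by rewrite mulr_ge0 // subr_ge0 ltW.
set D := M' * (d - c) in D0 *.
have E0 : 0 <= square_sum h :> R by exact: le_trans ler01 (square_sum_ge1 h0).
set E := square_sum h in E0 hA *.
rewrite (dsum_slice_fourier hw a0 hv n h T_0 H0 hN) normrM (gtr0_norm Hi) ler_pM2l //.
have sE : Num.sqrt (T / h%:R) = Num.sqrt T * h%:R `^ (- (1 / 2)).
  by rewrite div1r powRN powR12_sqrt ?(ltW h0') // sqrtrM ?(ltW T_0) // sqrtrV ?(ltW h0').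
have coef al s : 0 <= s <= 2 ->
    `|itg c d (fun u => v u * cos (2 * pi * h%:R / H * u + al))| <= D * (H `^ s * h%:R `^ (- s)).
  move=> hs; apply: le_trans (fourier_coef_bound hv al H0 h0 hs) _.
  by rewrite powRM ?invr_ge0 ?(ltW H0) ?(ltW h0') // -/D -powR_inv1 ?(ltW h0') // -powRrM mulN1r.
have part al bt : `|itg c d (fun u => v u * cos (2 * pi * h%:R / H * u + al)) *
      (\sum_(i < (n + n).+1) expfun w h T bt (i%:R - n%:R))| <=
    D * CA * (Num.sqrt T * (T * H `^ (1 / 2 + e) + H `^ (3 / 2 + e))) * (h%:R `^ (- (1 + e)) * E).
  rewrite normrM; set c0 := `|itg _ _ _|.
  have c1 : c0 <= D * (H `^ (1 / 2 + e) * h%:R `^ (- (1 / 2 + e))).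
    by apply: coef; apply/andP; split; lra.
  have c2 : c0 <= D * (H `^ (3 / 2 + e) * h%:R `^ (- (3 / 2 + e))).
    by apply: coef; apply/andP; split; lra.
  apply: le_trans (ler_wpM2l (normr_ge0 _) (hA bt)) _; rewrite -/c0 sE.
  have st0 : 0 <= Num.sqrt T := sqrtr_ge0 _.
  have k0 : 0 <= CA * (Num.sqrt T * h%:R `^ (- (1 / 2)) * T * E).
    by rewrite mulr_ge0 // mulr_ge0 // mulr_ge0 ?(ltW T_0) // mulr_ge0 ?powR_ge0.
  have k1 : 0 <= CA * (Num.sqrt T * h%:R `^ (- (1 / 2)) * h%:R * E).
    by rewrite mulr_ge0 // mulr_ge0 // mulr_ge0 ?(ltW h0') // mulr_ge0 ?powR_ge0.
  have := lerD (ler_wpM2r k0 c1) (ler_wpM2r k1 c2).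
  have p1 : h%:R `^ (- (1 / 2 + e)) * h%:R `^ (- (1 / 2)) = h%:R `^ (- (1 + e)) :> R.
    by rewrite powR_add //; congr powR; field.
  have p2 : h%:R `^ (- (3 / 2 + e)) * h%:R `^ (- (1 / 2)) * h%:R = h%:R `^ (- (1 + e)) :> R.
    by rewrite -{3}(powRr1 (ltW h0')) !powR_add //; congr powR; field.
  have -> : D * (H `^ (1 / 2 + e) * h%:R `^ (- (1 / 2 + e))) *
      (CA * (Num.sqrt T * h%:R `^ (- (1 / 2)) * T * E)) = D * CA * Num.sqrt T * T * H `^ (1 / 2 + e) *
      (h%:R `^ (- (1 / 2 + e)) * h%:R `^ (- (1 / 2))) * E.
    move: (H `^ _) (h%:R `^ _) (h%:R `^ _) (Num.sqrt T) => x1 x2 x3 x4; ring.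
  have -> : D * (H `^ (3 / 2 + e) * h%:R `^ (- (3 / 2 + e))) *
      (CA * (Num.sqrt T * h%:R `^ (- (1 / 2)) * h%:R * E)) = D * CA * Num.sqrt T * H `^ (3 / 2 + e) *
      (h%:R `^ (- (3 / 2 + e)) * h%:R `^ (- (1 / 2)) * h%:R) * E.
    move: (H `^ _) (h%:R `^ _) (h%:R `^ _) (Num.sqrt T) => x1 x2 x3 x4; ring.
  rewrite p1 p2 => hh; apply: le_trans (le_trans _ hh) _; rewrite le_eqVlt; apply/orP; left; apply/eqP.
    move: (h%:R `^ _) (Num.sqrt T) => x3 x4; ring.
  move: (H `^ _) (H `^ _) (h%:R `^ _) (Num.sqrt T) => x1 x2 x3 x4; ring.
apply: le_trans (ler_normB _ _) _; apply: le_trans (lerD (part _ _) (part _ _)) _.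
rewrite le_eqVlt; apply/orP; left; apply/eqP.
by move: (Num.sqrt T * _) (h%:R `^ _ * E) => Y Z; ring.
Qed.

(** Frequency 0 in [y] yields the main term up to [O(1 / H)] by [bump_riemann]; the other
    frequencies are summed by [square_sum_series]. *)
Theorem dsum_asymptotic e T0 : 0 < e -> e <= 1 / 2 -> 0 < T0 -> exists2 C : R, 0 < C &
  forall T H n N, T0 <= T -> 0 < H -> b * T ^+ 2 <= n%:R -> wide b c d T H N ->
  `|dsum w v T H n N - T ^+ 2 / H * (itg a b w * itg c d v)| <=
    C * (H^-1 * (1 + Num.sqrt T * (T * H `^ (1 / 2 + e) + H `^ (3 / 2 + e)))).
Proof.
move=> e0 e1 T00.
have [CA CA0 hA] := exponential_sum hw a0 T00.
have [CE CE0 hE] := @square_sum_series R _ e0.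
have [CR CR0 hR] := bump_riemann hw a0 T00.
have cd := bump_ab hv; have M0 := bump_M hv; have cv := bump_cont hv.
have D0 : 0 <= M' * (d - c) by rewrite mulr_ge0 // subr_ge0 ltW.
set D := M' * (d - c) in D0.
pose C := 2 * (2 * D * CA * CE) + CR * `|itg c d v| + 1.
have DC0 : 0 <= 2 * (2 * D * CA * CE).
  exact: (mulr_ge0 (ler0n R 2) (mulr_ge0 (mulr_ge0 (mulr_ge0 (ler0n R 2) D0) (ltW CA0)) (ltW CE0))).
have C0 : 0 < C.
  by apply: ltr_wpDl => //; apply: addr_ge0 => //; rewrite mulr_ge0 // ltW.
exists C => // T H n N TT H0 hn hN.
have T_0 : 0 < T by exact: lt_le_trans TT.
have Hi : 0 < H^-1 by rewrite invr_gt0.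
have he : 0 <= e <= 1 / 2 by rewrite (ltW e0).
pose g := dsum_slice w v T H n.
have [L hL] := dsum_slice_Lip hw hv T n H0.
have cg := lip_continuous hL.
have -> : dsum w v T H n N = \sum_(j < (N + N).+1) g (j%:R - N%:R).
  by rewrite /dsum exchange_big.
set W := Num.sqrt T * (T * H `^ (1 / 2 + e) + H `^ (3 / 2 + e)).
have W0 : 0 <= W.
  by rewrite mulr_ge0 ?sqrtr_ge0 // addr_ge0 ?powR_ge0 // mulr_ge0 ?powR_ge0 // ltW.
have F0 : fourier_int g N 0 = H^-1 * (itg c d v * \sum_(i < (n + n).+1) w ((i%:R - n%:R) / T ^+ 2)).
  rewrite (dsum_slice_fourier hw a0 hv n 0 T_0 H0 hN).
  congr (_ * _).
  rewrite (_ : itg c d (fun u => v u * cos (2 * pi * 0%:R / H * u + - (pi / 2))) = 0); last first.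
    rewrite -[RHS](mul0r (d - c)) -itg_cst ?(ltW cd) //; apply: itg_eq => u _.
    by rewrite mulr0 !mul0r cosBpihalf sin0 mulr0.
  rewrite mul0r subr0; congr (_ * _).
    by apply: itg_eq => u _; rewrite mulr0 !mul0r addr0 cos0 mulr1.
  apply: eq_bigr => i _; rewrite /expfun mulr0 mul0r addr0 cos0 mulr1 //.
have hP : `|\sum_(j < (N + N).+1) g (j%:R - N%:R) - fourier_int g N 0| <=
    H^-1 * (2 * (2 * D * CA * CE) * W).
  apply: (poisson_bound cg hL) => m.
  rewrite (even_symsum _ (fourier_int_even g N)) addrAC subrr add0r normrM (ger0_norm (ler0n _ 2)).
  rewrite -(mulrA 2) mulrCA ler_pM2l //; apply: le_trans (ler_norm_sum _ _ _) _.
  have tm (h : nat) : `|fourier_int g N h.+1%:R| <=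
      H^-1 * (2 * D * CA * W) * (h.+1%:R `^ (- (1 + e)) * square_sum h.+1).
    have := slice_term T_0 H0 (ltn0Sn h) he (ltW CA0) (fun al => hA h.+1 T al n isT TT hn) hN.
    by move=> hs; rewrite -(mulrA H^-1); exact: hs.
  apply: le_trans (ler_sum _ (fun (k : 'I_m) _ => tm k)) _.
  rewrite -mulr_sumr.
  have K0 : 0 <= H^-1 * (2 * D * CA * W).
    exact: (mulr_ge0 (ltW Hi) (mulr_ge0 (mulr_ge0 (mulr_ge0 (ler0n R 2) D0) (ltW CA0)) W0)).
  apply: le_trans (ler_wpM2l K0 (hE m)) _.
  by rewrite le_eqVlt; apply/orP; left; apply/eqP; ring.
have hQ : `|fourier_int g N 0 - T ^+ 2 / H * (itg a b w * itg c d v)| <= H^-1 * (CR * `|itg c d v|).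
  rewrite F0 (_ : _ - _ = H^-1 * (itg c d v *
    (\sum_(i < (n + n).+1) w ((i%:R - n%:R) / T ^+ 2) - T ^+ 2 * itg a b w))); last by ring.
  rewrite normrM (gtr0_norm Hi) ler_pM2l // normrM mulrC ler_wpM2r //; exact: hR.
have -> : \sum_(j < (N + N).+1) g (j%:R - N%:R) - T ^+ 2 / H * (itg a b w * itg c d v) =
  (\sum_(j < (N + N).+1) g (j%:R - N%:R) - fourier_int g N 0) +
  (fourier_int g N 0 - T ^+ 2 / H * (itg a b w * itg c d v)) by ring.
apply: le_trans (norm_add_le hP hQ) _.
rewrite -mulrDr (mulrCA C) ler_pM2l // /C.
have h1 : 0 <= CR * `|itg c d v| by rewrite mulr_ge0 // ltW.
have h2 := mulr_ge0 h1 W0; lra.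
Qed.

End DoubleSumAsymptotics.

(** * Bump data for smooth functions, and majorants *)

Section SmoothBump.
Context {R : realType}.
Implicit Types (w : R -> R) (lo hi x t K D : R).

Lemma fun_support_out w x : ~ fun_support w x -> \forall y \near x, w y = 0.
Proof.
move=> hx; have oc : open (~` fun_support w) by apply: closed_openC; exact: closed_closure.
have : nbhs x (~` fun_support w) by exact: open_nbhs_nbhs.
apply: filterS => y hy; apply: contrapT => wy; apply: hy; apply: subset_closure.
by apply/eqP.
Qed.

Lemma derive1_out w x : ~ fun_support w x -> derive1 w x = 0.
Proof.
move=> /fun_support_out h.
rewrite derive1E (near_eq_derive (g := cst 0)) ?derive_cst ?oner_neq0 //.
Qed.

Lemma derive1_support w : fun_support (derive1 w) `<=` fun_support w.
Proof.
have hc : closed (fun_support w) by exact: closed_closure.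
rewrite [X in _ `<=` X](closure_id _).1 //; apply: closure_subset => x /= hx.
by apply: contrapT => /derive1_out h; rewrite h eqxx in hx.
Qed.

Lemma cont_bounded w lo hi : lo <= hi -> continuous w ->
  (forall x, ~~ (lo < x < hi) -> w x = 0) -> exists2 K, 0 <= K & forall x, `|w x| <= K.
Proof.
move=> lh cw h0.
have [c _ hc] := @EVT_max R (fun x => `|w x|) lo hi lh
  (continuous_subspaceT (fun x => continuous_comp (cw x) (@norm_continuous _ _ (w x)))).
exists `|w c| => // x; have [hx|hx] := boolP (lo < x < hi).
  by apply: hc; rewrite in_itv /=; case/andP: hx => h1 h2; rewrite !ltW.
by rewrite h0 // normr0.
Qed.

(** The third derivative makes the second continuous, hence bounded on the compact interval. *)
Lemma smooth_bump w lo hi : smooth w -> lo < hi -> fun_support w `<=` `]lo, hi[ ->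
  exists M, bumpC2 w (derive1 w) (derive1 (derive1 w)) lo hi M.
Proof.
move=> sw lh hs.
have h1 x : has_der w x (derive1 w x).
  by rewrite derive1E; apply/derivableP; exact: (sw 0%N).
have h2 x : has_der (derive1 w) x (derive1 (derive1 w) x).
  by rewrite [X in has_der _ _ X]derive1E; apply/derivableP; have := sw 1%N x; rewrite derive1n1.
have h3 x : has_der (derive1 (derive1 w)) x (derive1 (derive1 (derive1 w)) x).
  rewrite [X in has_der _ _ X]derive1E; apply/derivableP.
  by have := sw 2%N x; rewrite derive1nS derive1n1.
have nin x : ~~ (lo < x < hi) -> ~ fun_support w x.
  by move=> hx /hs /=; rewrite in_itv /= => h; rewrite h in hx.
have o0 x : ~~ (lo < x < hi) -> w x = 0.
  by move=> /nin hx; apply: contrapT => wx; apply: hx; apply: subset_closure; apply/eqP.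
have o1 x : ~~ (lo < x < hi) -> derive1 w x = 0 by move=> /nin /derive1_out.
have o2 x : ~~ (lo < x < hi) -> derive1 (derive1 w) x = 0.
  by move=> /nin hx; apply: derive1_out => /derive1_support.
have [K0 K00 hK0] := cont_bounded (ltW lh) (cont_der h1) o0.
have [K1 K10 hK1] := cont_bounded (ltW lh) (cont_der h2) o1.
have [K2 K20 hK2] := cont_bounded (ltW lh) (cont_der h3) o2.
exists (K0 + K1 + K2); split=> // x.
- by apply: le_trans (hK0 x) _; lra.
- by apply: le_trans (hK1 x) _; lra.
- by apply: le_trans (hK2 x) _; lra.
Qed.

Lemma support_interval w : compactly_supported w ->
  exists2 K, 0 < K & fun_support w `<=` `]- K, K[.
Proof.
move=> /compact_bounded /= hb.
have [K [K0 hK]] := hb.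
exists (`|K| + 2); first by rewrite ltr_wpDl.
move=> x hx; have := hK (`|K| + 1) _ x hx; rewrite /= in_itv /= => hh.
rewrite -ltr_norml; apply: le_lt_trans (hh _) _; last by rewrite ltrD2l ltr1n.
by apply: le_lt_trans (ler_norm K) _; rewrite ltrDl.
Qed.

Lemma support_pos_interval w : compactly_supported w -> fun_support w `<=` [set x | 0 < x] ->
  exists lo hi, [/\ 0 < lo, lo < hi & fun_support w `<=` `]lo, hi[].
Proof.
move=> cw pw; have [K K0 hK] := support_interval cw.
have n0 : ~ fun_support w 0 by move=> /pw /=; rewrite ltxx.
have [e e0 he] : exists2 e : R, 0 < e & forall y, `|y| < e -> ~ fun_support w y.
  have oc : open (~` fun_support w) by apply: closed_openC; exact: closed_closure.
  have : nbhs (0 : R) (~` fun_support w) by exact: open_nbhs_nbhs.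
  move=> /nbhs_ballP [e /= e0 he]; exists e => // y hy.
  by apply: he; rewrite /ball /= sub0r normrN.
(* Points of the support are at least [e], so half the minimum is strictly below them and below
   [K]. *)
exists (Num.min e K / 2), K.
have m0 : 0 < Num.min e K by rewrite lt_min e0.
have mK : Num.min e K <= K by rewrite ge_min lexx orbT.
have me : Num.min e K <= e by rewrite ge_min lexx.
split; [by rewrite divr_gt0|lra|move=> x hx /=; rewrite in_itv /=].
have x0 := pw _ hx; rewrite /= in x0.
have /= := hK _ hx; rewrite in_itv /= => /andP[_ ->]; rewrite andbT.
rewrite ltNge; apply/negP => hle; apply: (he x) => //.
rewrite gtr0_norm //; lra.
Qed.

Definition pos (t : R) : R := Num.max 0 t.

Lemma der_pos2 t : has_der (fun t => pos t ^+ 2) t (2 * pos t).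
Proof.
apply: (@der_quad _ _ _ _ 1) => s _; rewrite mul1r /pos.
have hn (x y : R) : - y <= x -> x <= y -> `|x| <= y by move=> h1 h2; rewrite ler_norml h1.
case: (leP 0 t) => ht; case: (leP 0 (t + s)) => hts; apply: hn.
- nra.
- nra.
- nra.
- nra.
- nra.
- nra.
- nra.
- nra.
Qed.

Lemma der_pos3 t : has_der (fun t => t * pos t ^+ 2) t (3 * pos t ^+ 2).
Proof.
have h := der_pos2 t; der.
have -> : t * (2 * pos t) = 2 * pos t ^+ 2; last by ring.
rewrite /pos; case: (leP 0 t) => _; ring.
Qed.

(* A multiple of the cube of the positive part of [(x - lo) (hi - x)]. *)
Lemma bump_majorant lo hi lo' hi' K : lo < lo' -> lo' <= hi' -> hi' < hi -> 0 <= K ->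
  exists w w1 w2 M, [/\ bumpC2 w w1 w2 lo hi M, forall x, 0 <= w x
    & forall x, lo' <= x <= hi' -> K <= w x].
Proof.
move=> h1 h2 h3 K0.
pose q x := (x - lo) * (hi - x).
pose q' x := lo + hi - 2 * x.
(* A lower bound for [q] on [[lo', hi']], so that [ka q^3 >= K] there. *)
pose m := (lo' - lo) * (hi - hi').
have m0 : 0 < m by rewrite mulr_gt0 ?subr_gt0.
pose ka := K / m ^+ 3.
have ka0 : 0 <= ka by rewrite divr_ge0 // exprn_ge0 // ltW.
pose D := hi - lo; have D0 : 0 <= D by rewrite subr_ge0; lra.
pose w x := ka * (q x * pos (q x) ^+ 2).
pose w1 x := ka * (3 * pos (q x) ^+ 2 * q' x).
pose w2 x := ka * (6 * pos (q x) * q' x ^+ 2 - 6 * pos (q x) ^+ 2).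
have dq x : has_der q x (q' x) by rewrite /q /q'; der; ring.
have dq' x : has_der q' x (- 2) by rewrite /q'; der; ring.
have d1 x : has_der w x (w1 x).
  have := der_comp (g := q) (der_pos3 (q x)) (dq x) => h.
  by rewrite /w /w1; der; ring.
have d2 x : has_der w1 x (w2 x).
  have := der_comp (g := q) (der_pos2 (q x)) (dq x) => h; have h' := dq' x.
  by rewrite /w1 /w2; der; ring.
have dich x : (pos (q x) = 0 /\ q x * pos (q x) ^+ 2 = 0) \/ [/\ lo < x < hi, `|q' x| <= D, pos (q x) = q x & 0 <= q x <= D ^+ 2].
  have [hq|hq] := leP (q x) 0.
    by left; rewrite /pos max_l // expr0n mulr0.
  right; have hx : lo < x < hi.
    move: hq; rewrite /q; case: (ltP lo x) => hl /=; case: (ltP x hi) => hh //=; nra.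
  split=> //.
  - by move/andP: hx => [h4 h5]; rewrite /q' /D ler_norml; apply/andP; split; lra.
  - by rewrite /pos max_r // ltW.
  - rewrite (ltW hq) /q /D; move/andP: hx => [h4 h5]; nra.
pose M := ka * (D ^+ 6) + ka * (3 * D ^+ 5) + ka * (12 * D ^+ 4).
have k6 : 0 <= ka * D ^+ 6 by rewrite mulr_ge0 // exprn_ge0.
have k5 : 0 <= ka * (3 * D ^+ 5) by apply: mulr_ge0 => //; apply: mulr_ge0 => //; exact: exprn_ge0.
have k4 : 0 <= ka * (12 * D ^+ 4) by apply: mulr_ge0 => //; apply: mulr_ge0 => //; exact: exprn_ge0.
have M0 : 0 <= M by rewrite addr_ge0 // addr_ge0.
exists w, w1, w2, M; split.
- split=> //; first lra.
  + move=> x; rewrite /w; have [[_ ->]|[hx hq' -> /andP[q0 qD]]] := dich x.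
      by rewrite mulr0 normr0.
    apply: (@le_trans _ _ (ka * D ^+ 6)); last by rewrite /M; lra.
    rewrite -exprS normrM (ger0_norm ka0) ler_wpM2l // ger0_norm ?exprn_ge0 //.
    by rewrite (exprM D 2 3) lerXn2r ?nnegrE // sqr_ge0.
  + move=> x; rewrite /w1; have [[-> _]|[hx hq' -> /andP[q0 qD]]] := dich x.
      by rewrite expr0n /= mulr0 mul0r mulr0 normr0.
    apply: (@le_trans _ _ (ka * (3 * D ^+ 5))); last by rewrite /M; lra.
    rewrite normrM (ger0_norm ka0) ler_wpM2l // (_ : 3 * D ^+ 5 = 3 * (D ^+ 2) ^+ 2 * D); last by ring.
    have hq : `|q x| <= D ^+ 2 by rewrite ger0_norm.
    apply: norm_mul_le => //; apply: norm_mul_le; first by rewrite ger0_norm.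
    by rewrite normrX lerXn2r ?nnegrE // sqr_ge0.
  + move=> x; rewrite /w2; have [[-> _]|[hx hq' -> /andP[q0 qD]]] := dich x.
      by rewrite expr0n /= !mulr0 mul0r subr0 mulr0 normr0.
    apply: (@le_trans _ _ (ka * (12 * D ^+ 4))); last by rewrite /M; lra.
    rewrite normrM (ger0_norm ka0) ler_wpM2l // (_ : 12 * D ^+ 4 = 6 * D ^+ 2 * D ^+ 2 + 6 * (D ^+ 2) ^+ 2); last by ring.
    have hq : `|q x| <= D ^+ 2 by rewrite ger0_norm.
    apply: norm_add_le.
      apply: norm_mul_le; last by rewrite normrX lerXn2r ?nnegrE.
      by apply: norm_mul_le => //; rewrite ger0_norm.
    rewrite normrN; apply: norm_mul_le; first by rewrite ger0_norm.
    by rewrite normrX lerXn2r ?nnegrE // sqr_ge0.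
  + by move=> x hx; rewrite /w; have [[_ ->]|[hx' _ _ _]] := dich x; [rewrite mulr0|rewrite hx' in hx].
  + move=> x hx; rewrite /w1; have [[-> _]|[hx' _ _ _]] := dich x; last by rewrite hx' in hx.
    by rewrite expr0n /= mulr0 mul0r mulr0.
- move=> x; rewrite /w; have [[_ ->]|[hx hq' -> /andP[q0 qD]]] := dich x; first by rewrite mulr0.
  by rewrite mulr_ge0 // -exprS exprn_ge0.
- move=> x /andP[hx1 hx2].
  have mq : m <= q x by rewrite /m /q; apply: ler_pM; rewrite ?subr_ge0; lra.
  have q0 : 0 < q x by exact: lt_le_trans mq.
  rewrite /w /pos max_r ?(ltW q0) // -exprS /ka mulrAC ler_pdivlMr ?exprn_gt0 //.
  by rewrite ler_wpM2l // lerXn2r // nnegrE ltW.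
Qed.

End SmoothBump.

(** * The double sum for large [H] *)

Section DoubleSumUpper.
Context {R : realType}.
Variables (w w1 w2 : R -> R) (a b M : R) (v v1 v2 : R -> R) (c d M' : R).
Hypotheses (hw : bumpC2 w w1 w2 a b M) (a0 : 0 < a) (hv : bumpC2 v v1 v2 c d M').
Implicit Types (T H x y z e : R) (n N i j : nat).

(* For [H >= T] the weight [v (H z)] is dominated by a majorant at scale [T]. *)
Theorem dsum_upper e T0 : 0 < e -> e <= 1 / 2 -> 0 < T0 ->
  exists C bs cs ds : R, [/\ 0 < C, 0 < bs & forall T H n N, T0 <= T -> T <= H ->
    bs * T ^+ 2 <= n%:R -> wide bs cs ds T T N ->
    `|dsum w v T H n N| <= C * T `^ (1 + e)].
Proof.
move=> e0 e1 T00; have ab := bump_ab hw; have cd := bump_ab hv.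
have b0 : 0 < b := lt_trans a0 ab.
pose Rr := `|c| + `|d| + 1.
have Rr0 : 0 < Rr by rewrite ltr_wpDl.
have [||||w' [w1' [w2' [K [hw' w'0 w'M]]]]] := @bump_majorant R (a / 2) (2 * b) a b M.
- by rewrite ltr_pdivrMr // ltr_pMr // ltr1n.
- exact: ltW.
- by rewrite ltr_pMl // ltr1n.
- exact: bump_M hw.
have [||||v' [v1' [v2' [K' [hv' v'0 v'M]]]]] := @bump_majorant R (- (Rr + 1)) (Rr + 1) (- Rr) Rr M'.
- lra.
- lra.
- lra.
- exact: bump_M hv.
have a2 : 0 < a / 2 by rewrite divr_gt0.
have [C C0 hC] := dsum_asymptotic hw' a2 hv' e0 e1 T00.
set I := _ * itg _ _ v' in hC.
(* For [T >= T0] these constants absorb [T^-1] and the main term of order [T] into [T^(1+e)]. *)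
pose q := T0 `^ (- (2 + e)); pose q1 := T0 `^ (- e).
have q0 : 0 < q by rewrite powR_gt0.
have q10 : 0 < q1 by rewrite powR_gt0.
exists (`|I| * q1 + C * q + 2 * C + 1), (2 * b), (- (Rr + 1)), (Rr + 1); split.
- apply: ltr_wpDl => //; apply: addr_ge0; last by rewrite mulr_ge0 // ltW.
  by apply: addr_ge0; apply: mulr_ge0 => //; exact: ltW.
- by rewrite mulr_gt0.
move=> T H n N TT TH hn hN.
have T_0 : 0 < T by exact: lt_le_trans TT.
have H0 : 0 < H by exact: lt_le_trans TH.
have wle x : `|w x| <= w' x.
  have [hx|hx] := boolP (a < x < b); last by rewrite (bump_out0 hw hx) normr0.
  apply: le_trans (bump_le0 hw x) _; apply: w'M.
  by case/andP: hx => h1 h2; rewrite !ltW.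
(* Where [v (H z)] is nonzero, [|T z| <= |H z| <= Rr], and [v'] exceeds the bound of [v] on
   [[-Rr, Rr]]. *)
have vle z : `|v (H * z)| <= v' (T * z).
  have [hx|hx] := boolP (c < H * z < d); last by rewrite (bump_out0 hv hx) normr0.
  apply: le_trans (bump_le0 hv _) _; apply: v'M; rewrite -ler_norml.
  apply: (@le_trans _ _ `|H * z|).
    by rewrite !normrM (gtr0_norm T_0) (gtr0_norm H0) ler_wpM2r.
  case/andP: hx => h1 h2; rewrite ler_norml /Rr.
  have := ler_norm d; have := ler_norm (- c); rewrite normrN.
  have := normr_ge0 c; have := normr_ge0 d => h3 h4 h5 h6.
  by apply/andP; split; lra.
have dom : `|dsum w v T H n N| <= dsum w' v' T T n N.
  apply: le_trans (ler_norm_sum _ _ _) _; apply: ler_sum => i _.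
  apply: le_trans (ler_norm_sum _ _ _) _; apply: ler_sum => j _.
  by apply: norm_mul_le.
apply: le_trans dom _.
have := hC T T n N TT T_0 hn hN; move: (dsum _ _ _ _ _ _) => S.
have -> : T ^+ 2 / T = T by field; rewrite gt_eqF.
have sT : Num.sqrt T = T `^ (1 / 2) by rewrite -powR12_sqrt ?(ltW T_0) // div1r.
have -> : T^-1 * (1 + Num.sqrt T * (T * T `^ (1 / 2 + e) + T `^ (3 / 2 + e))) =
    T^-1 + 2 * T `^ (1 + e).
  have e3 : T `^ (3 / 2 + e) = T * T `^ (1 / 2 + e).
    by rewrite -{2}(powRr1 (ltW T_0)) powR_add //; congr powR; field.
  have e4 : T `^ (1 / 2) * T `^ (1 / 2 + e) = T `^ (1 + e).
    by rewrite powR_add //; congr powR; field.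
  rewrite e3 sT -e4; move: (T `^ _) (T `^ _) => x1 x2; field.
  by rewrite gt_eqF.
move=> hS.
have hT1 : T <= q1 * T `^ (1 + e).
  rewrite /q1 -{1}(powRr1 (ltW T_0)) powRN mulrC ler_pdivlMr ?powR_gt0 //.
  rewrite -powR_add // ler_wpM2l ?powR_ge0 //.
  by apply: (@ge0_ler_powR R e (ltW e0)); rewrite ?nnegrE // ltW.
have hT2 : T^-1 <= q * T `^ (1 + e).
  rewrite /q powRN mulrC ler_pdivlMr ?powR_gt0 // mulrC ler_pdivrMr //.
  rewrite -{2}(powRr1 (ltW T_0)) powR_add // (_ : 1 + e + 1 = 2 + e); last by ring.
  have e2 : 0 <= 2 + e by rewrite addr_ge0 // ltW.
  by apply: (@ge0_ler_powR R (2 + e) e2); rewrite ?nnegrE // ltW.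
have P0 : 0 <= T `^ (1 + e) := powR_ge0 _ _.
have hS2 : S <= `|T * I| + C * (T^-1 + 2 * T `^ (1 + e)).
  have := ler_norm (T * I); have := le_trans (ler_norm _) hS; lra.
apply: le_trans hS2 _; rewrite normrM (gtr0_norm T_0).
have k1 := ler_wpM2r (normr_ge0 I) hT1.
have k2 := ler_wpM2l (ltW C0) hT2.
lra.
Qed.

End DoubleSumUpper.

(** * The Moebius function and zeta(5) *)

Section Moebius.
Implicit Types (m n d p D : nat).

Lemma perm_primesM p d : prime p -> (0 < d)%N -> ~~ (p %| d)%N ->
  perm_eq (primes (p * d)) (p :: primes d).
Proof.
move=> pp d0 pd; have p0 := prime_gt0 pp; apply: uniq_perm.
- exact: primes_uniq.
- by rewrite /= primes_uniq mem_primes (negbTE pd) !andbF.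
- by move=> q; rewrite primesM // primes_prime // !inE.
Qed.

Lemma moebiusM p d : prime p -> (0 < d)%N -> ~~ (p %| d)%N -> moebius (p * d) = - moebius d.
Proof.
move=> pp d0 pd; have hp := perm_primesM pp d0 pd; have p0 := prime_gt0 pp.
rewrite /moebius (perm_all _ hp) (perm_size hp) /= lognM // logn_prime // eqxx.
rewrite (lognE p d) pp d0 (negbTE pd) addn0 eqxx /=.
under (@eq_in_all _ (fun q => logn q (p * d) == 1%N) (fun q => logn q d == 1%N)).
  move=> q; rewrite mem_primes => /and3P[qp _ qd]; rewrite lognM // logn_prime //.
  by have [e|_] := eqVneq q p; [rewrite -e qd in pd|].
by case: ifP => _; rewrite ?oppr0 // exprS mulN1r.
Qed.

Lemma moebius_norm n : `|moebius n| <= 1.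
Proof. by rewrite /moebius; case: ifP => _; rewrite ?normr0 // normrX normrN1 expr1n. Qed.

Lemma moebius_neq0_dvd p d : prime p -> (p %| d)%N -> (0 < d)%N -> moebius d != 0 ->
  ~~ (p %| d %/ p)%N.
Proof.
move=> pp pd d0; rewrite /moebius; case: ifP => [/allP h _|_]; last by rewrite eqxx.
have /eqP l1 : logn p d == 1%N by apply: h; rewrite mem_primes pp d0.
by rewrite -(dvdn_pmul2r (prime_gt0 pp)) divnK // -(expnSr p 1) pfactor_dvdn // l1.
Qed.

(* Toggling the factor [pdiv m] is a sign-reversing involution of the squarefree
   divisors of [m]. *)
Lemma moebius_divisors m : (0 < m)%N -> \sum_(d <- divisors m) moebius d = (m == 1%N)%:R.
Proof.
move=> m0; have [->|m1] := eqVneq m 1%N; first by rewrite big_seq1.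
have pp : prime (pdiv m) by apply: pdiv_prime; rewrite ltn_neqAle eq_sym m1.
have pm := pdiv_dvd m; set p := pdiv m in pp pm *.
have p0 := prime_gt0 pp.
pose s := [seq d <- divisors m | moebius d != 0].
pose f d := if (p %| d)%N then (d %/ p)%N else (p * d)%N.
have hs d : d \in s -> [/\ (0 < d)%N, (d %| m)%N & moebius d != 0].
  rewrite mem_filter -dvdn_divisors // => /andP[h1 h2]; split => //.
  exact: dvdn_gt0 h2.
have sI d : (d %| m)%N -> moebius d != 0 -> d \in s.
  by move=> h1 h2; rewrite mem_filter h2 -dvdn_divisors.
have fs d : d \in s -> [/\ f d \in s, f (f d) = d & moebius (f d) = - moebius d].
  move=> /hs[d0 dm md]; rewrite /f; case: ifP => pd.
    have pd' := moebius_neq0_dvd pp pd d0 md; rewrite (negbTE pd').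
    have q0 : (0 < d %/ p)%N by rewrite divn_gt0 // dvdn_leq.
    have e := moebiusM pp q0 pd'; rewrite mulnC divnK // in e.
    rewrite mulnC divnK // e opprK; split => //; apply: sI.
      by apply: dvdn_trans dm; rewrite -{2}(divnK pd) dvdn_mulr.
    by rewrite e oppr_eq0 in md.
  rewrite dvdn_mulr // mulKn // moebiusM ?pd //; split => //; apply: sI.
    by rewrite Gauss_dvd ?prime_coprime ?pd // pm.
  by rewrite moebiusM ?pd // oppr_eq0.
have su : uniq s by rewrite filter_uniq // divisors_uniq.
have inj : {in s &, injective f}.
  by move=> x y /fs[_ hx _] /fs[_ hy _] e; rewrite -hx -hy e.
have hp : perm_eq [seq f d | d <- s] s.
  apply: uniq_perm => //; first by rewrite map_inj_in_uniq.
  move=> x; apply/mapP/idP => [[y /fs[h _ _] ->] //|/fs[h1 h2 _]].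
  by exists (f x).
have e1 : \sum_(d <- divisors m) moebius d = \sum_(d <- s) moebius d.
  rewrite big_filter [RHS]big_mkcond; apply: eq_bigr => d _.
  by case: ifP => // /negbFE/eqP.
have e2 : \sum_(d <- s) moebius d = - \sum_(d <- s) moebius d.
  rewrite -{1}(perm_big _ hp) big_map -sumrN big_seq [RHS]big_seq.
  by apply: eq_bigr => d /fs[_ _].
by rewrite e1; move: e2; move: (\sum_(d <- s) _) => S; lia.
Qed.

Lemma moebius_dvdn_sum D m : (0 < m)%N -> (m <= D)%N ->
  \sum_(1 <= d < D.+1 | (d %| m)%N) moebius d = (m == 1%N)%:R.
Proof.
move=> m0 mD; rewrite -moebius_divisors // -big_filter; apply: perm_big.
apply: uniq_perm; rewrite ?filter_uniq ?iota_uniq ?divisors_uniq // => d.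
rewrite mem_filter mem_index_iota -dvdn_divisors // ltnS.
by case: (boolP (d %| m)%N) => // dm; rewrite (dvdn_gt0 m0 dm) (leq_trans (dvdn_leq m0 dm) mD).
Qed.

End Moebius.

Section MoebiusZeta.
Context {R : realType}.
Implicit Types (d n m D : nat).

Definition moebius5 D : R := \sum_(i < D) (moebius i.+1)%:~R * i.+1%:R ^- 5.

(** Grouped by the product [m <= D], the inner sums run over all divisors of [m], since neither a
    divisor nor its cofactor exceeds [D]; they vanish unless [m = 1]. *)
Lemma moebius_convolution D (g : nat -> R) : (0 < D)%N ->
  \sum_(i < D) \sum_(j < D) ((i.+1 * j.+1 <= D)%N)%:R * ((moebius i.+1)%:~R * g (i.+1 * j.+1)%N) = g 1%N.
Proof.
move=> D0; transitivity (\sum_(1 <= m < D.+1) g m * (\sum_(1 <= d < D.+1 | (d %| m)%N) moebius d)%:~R).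
  under [RHS]eq_bigr => m _ do rewrite (raddf_sum intr) mulr_sumr big_mkcond.
  rewrite [RHS]exchange_big [RHS]big_add1 big_mkord /=; apply: eq_bigr => i _.
  have ip : (0 < i.+1)%N by [].
  transitivity (\sum_(j < D) \sum_(1 <= m < D.+1 | (m == i.+1 * j.+1)%N) g m * (moebius i.+1)%:~R).
    apply: eq_bigr => j _; have [h|h] := leqP (i.+1 * j.+1) D.
      by rewrite big_nat1_eq ltnS h mul1r mulrC.
    by rewrite big_nat1_eq ltnS [in RHS](leqNgt _ D) h mul0r.
  under [LHS]eq_bigr => j _ do rewrite big_mkcond.
  rewrite [LHS]exchange_big !big_nat; apply: eq_bigr => m /andP[m1 mD].
  rewrite -big_mkcond /=; case: ifP => [/dvdnP[k mk]|im]; last first.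
    by rewrite big1 // => j /eqP e; rewrite e dvdn_mulr in im.
  have kD : (k.-1 < D)%N by nia.
  rewrite (big_pred1 (Ordinal kD)) // => j /=.
  rewrite mk [LHS]eq_sym mulnC eqn_pmul2r //.
  by rewrite -val_eqE /=; apply/eqP/eqP; lia.
rewrite big_nat (eq_bigr (fun m => if m == 1%N then g m else 0)); last first.
  move=> m /andP[m1 mD]; rewrite moebius_dvdn_sum //.
  by case: eqP => _; rewrite ?mulr1 ?mulr0.
by rewrite -big_nat -big_mkcond big_nat1_eq (ltnS 1 D) D0.
Qed.

Definition zeta5 D : R := \sum_(j < D) j.+1%:R ^- 5.

(* The terms with [d n > D] of the product are at most [d^-2 n^-2 / D]. *)
Lemma moebius5_zeta5 : exists2 K : R, 0 <= K & forall D, (0 < D)%N ->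
  `|moebius5 D * zeta5 D - 1| <= K / D%:R.
Proof.
have [Z Z0 hZ] := zeta_bound (ltr01 : 0 < 1 :> R).
exists (Z ^+ 2) => [|D D0]; first exact: sqr_ge0.
have D0' : 0 < D%:R :> R by rewrite ltr0n.
have -> : moebius5 D * zeta5 D = \sum_(i < D) \sum_(j < D)
    (moebius i.+1)%:~R * (i.+1 * j.+1)%N%:R ^- 5.
  rewrite /moebius5 /zeta5 mulr_suml; apply: eq_bigr => i _; rewrite mulr_sumr; apply: eq_bigr => j _.
  rewrite (natrM _ i.+1 j.+1) -mulrA; congr (_ * _).
  by move: (i.+1%:R : R) (j.+1%:R : R) => x y; rewrite (exprMn _ x y) (invfM (x ^+ 5)) .
have := moebius_convolution (fun k => k%:R ^- 5 : R) D0; rewrite expr1n invr1 => e1.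
rewrite -[X in _ - X]e1 -sumrB.
have hz n : n.+1%:R `^ (- (1 + 1)) = n.+1%:R ^- 2 :> R by rewrite powRN -powR_mulrn.
apply: (@le_trans _ _ (\sum_(i < D) \sum_(j < D) i.+1%:R ^- 2 * j.+1%:R ^- 2 / D%:R)); last first.
  under eq_bigr => i _ do rewrite -mulr_suml -mulr_sumr.
  rewrite -mulr_suml -mulr_suml ler_pM2r ?invr_gt0 // expr2.
  have h := hZ D; rewrite (eq_bigr (fun n : 'I_D => n.+1%:R ^- 2)) in h => [|n _]; last exact: hz.
  have h0 : 0 <= \sum_(i < D) i.+1%:R ^- 2 :> R.
    by apply: sumr_ge0 => i _; rewrite invr_ge0 exprn_ge0.
  exact: ler_pM.
apply: le_trans (ler_norm_sum _ _ _) _; apply: ler_sum => i _; rewrite -sumrB.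
apply: le_trans (ler_norm_sum _ _ _) _; apply: ler_sum => j _.
have ij0 : 0 < i.+1%:R * j.+1%:R :> R by rewrite mulr_gt0 // ltr0n.
have [h|h] := leqP (i.+1 * j.+1) D.
  rewrite mul1r subrr normr0 !mulr_ge0 // ?invr_ge0 ?exprn_ge0 //.
rewrite mul0r subr0 normrM -[leRHS]mul1r.
have hm : `|(moebius i.+1)%:~R| <= 1 :> R by rewrite -intr_norm lerz1 moebius_norm.
apply: ler_pM => //; rewrite natrM; set t := _ * _ in ij0 *.
have ht : D%:R <= t by rewrite /t -natrM ler_nat ltnW.
rewrite -invfM -exprMn -/t ger0_norm ?invr_ge0 ?exprn_ge0 ?(ltW ij0) //.
rewrite -invfM lef_pV2 ?posrE ?mulr_gt0 ?exprn_gt0 //.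
have t1 : 1 <= t by rewrite /t -natrM ler1n muln_gt0.
have e5 : t ^+ 5 = t ^+ 2 * t * t ^+ 2 by ring.
rewrite e5; apply: (@le_trans _ _ (t ^+ 2 * t)).
  by rewrite ler_pM2l ?exprn_gt0.
by rewrite ler_peMr ?exprn_ege1 // mulr_ge0 ?exprn_ge0 // ltW.
Qed.

(** [zeta] is a [limn], so convergence of the partial sums has to be shown: they increase and are
    bounded by [zeta_bound]. *)
Lemma zeta5_cvg : zeta5 @ \oo --> zeta (5 : R).
Proof.
have e : series (fun n => n.+1%:R `^ (- 5)) = zeta5.
  apply/funext => D; rewrite /series /= big_mkord; apply: eq_bigr => j _.
  by rewrite powRN -powR_mulrn.
rewrite /zeta e.
have [Z Z0 hZ] := zeta_bound (ltr0n R 4 : 0 < 4%:R :> R).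
apply: nondecreasing_is_cvgn.
  apply/nondecreasing_seqP => n; rewrite /zeta5 big_ord_recr lerDl.
  by rewrite invr_ge0 exprn_ge0.
exists Z => _ [D _ <-]; rewrite -e /series /= big_mkord.
apply: le_trans (hZ D); apply: ler_sum => j _.
by have -> : 1 + 4%:R = 5 :> R by ring.
Qed.

Lemma zeta5_ge1 : 1 <= zeta (5 : R).
Proof.
rewrite -(cvg_lim _ zeta5_cvg) //; apply: limr_ge; first by apply/cvg_ex; exists (zeta 5); exact: zeta5_cvg.
near=> D; rewrite /zeta5; have D0 : (0 < D)%N by near: D; exists 1%N.
rewrite (bigD1 (Ordinal D0)) //= expr1n invr1 lerDl.
by apply: sumr_ge0 => i _; rewrite invr_ge0 exprn_ge0.
Unshelve. all: by end_near. Qed.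

Lemma moebius5_cvg : moebius5 @ \oo --> (zeta (5 : R))^-1.
Proof.
have z0 : zeta (5 : R) != 0 by rewrite gt_eqF // (lt_le_trans ltr01) // zeta5_ge1.
have [K K0 hK] := moebius5_zeta5.
have h1 : (fun D => moebius5 D * zeta5 D) @ \oo --> (1 : R).
  apply/cvgrPdist_le => e e0; near=> D.
  have D0 : (0 < D)%N by near: D; exists 1%N.
  rewrite distrC; apply: le_trans (hK _ D0) _.
  rewrite ler_pdivrMr ?ltr0n // mulrC -ler_pdivrMr //.
  by near: D; exact: nbhs_infty_ger.
have h2 : (fun D => moebius5 D * zeta5 D / zeta5 D) @ \oo --> (zeta (5 : R))^-1.
  by rewrite -[X in _ --> X]mul1r; exact: cvgM h1 (cvgV z0 zeta5_cvg).
apply: (cvg_trans _ h2); apply: near_eq_cvg; near=> D.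
have D0 : (0 < D)%N by near: D; exists 1%N.
rewrite /= mulfK // gt_eqF // /zeta5 (bigD1 (Ordinal D0)) //= expr1n invr1.
by rewrite ltr_pwDl // sumr_ge0 // => i _; rewrite invr_ge0 exprn_ge0.
Unshelve. all: by end_near. Qed.

End MoebiusZeta.

(** * Decomposition over common divisors *)

Section IntegerBoxes.
Implicit Types (B D d k : nat) (x y : int).

Definition box B : seq int := [seq i%:Z - B%:Z | i <- iota 0 (B + B).+1].

Lemma box_uniq B : uniq (box B).
Proof. by rewrite map_inj_uniq ?iota_uniq // => i j /addIr[]. Qed.

Lemma mem_box B x : (x \in box B) = (`|x| <= B)%N.
Proof.
apply/mapP/idP => [[i]|h]; first by rewrite mem_iota => h ->; lia.
by exists (absz (x + B%:Z)); [rewrite mem_iota|]; lia.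
Qed.

Lemma box_sum (V : zmodType) (F : int -> V) B :
  \sum_(x <- box B) F x = \sum_(i < (B + B).+1) F (i%:Z - B%:Z).
Proof. by rewrite big_map -(big_mkord xpredT (fun i => F (i%:Z - B%:Z))) /index_iota subn0. Qed.

(** The right side keeps the whole box instead of [|x| <= B / k], as [F] vanishes at the surplus
    points [k x]. One box thus serves every common divisor. *)
Lemma box_multiples (V : zmodType) (F : int -> V) k B : (0 < k)%N ->
  (forall x, (B < `|x|)%N -> F x = 0) ->
  \sum_(x <- box B | (k%:Z %| x)%Z) F x = \sum_(x <- box B) F (k%:Z * x).
Proof.
move=> k0 F0; transitivity (\sum_(x <- box B) \sum_(y <- box B | y == k%:Z * x) F y); last first.
  apply: eq_bigr => x _; have [h|h] := leqP `|k%:Z * x| B.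
    by rewrite -big_filter filter_pred1_uniq ?box_uniq ?mem_box // big_seq1.
  rewrite F0 // big_seq_cond big1 // => y /andP[+ /eqP e].
  by rewrite mem_box e leqNgt h.
rewrite (exchange_big_dep xpredT) //= big_mkcond /=; apply: eq_big_seq => y.
rewrite mem_box => yB; case: ifP => [/dvdzP[z ez]|yk]; last first.
  by rewrite big1 // => x /eqP e; rewrite e dvdz_mulr in yk.
rewrite (eq_bigl (pred1 z)) => [|x /=]; last first.
  have kn : k%:Z != 0 by rewrite eqz_nat -lt0n.
  by rewrite ez mulrC (inj_eq (mulfI kn)) eq_sym.
rewrite -big_filter filter_pred1_uniq ?box_uniq ?big_seq1 // mem_box.
by apply: leq_trans yB; rewrite ez abszM leq_pmulr.
Qed.

Lemma PoszX d k : (d ^ k)%N%:Z = d%:Z ^+ k.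
Proof. by elim: k => // k ih; rewrite expnS exprS PoszM ih. Qed.

(** For positive [x], [d^2 | x] gives [d <= d^2 <= x <= D], so the index set is finite and lies in a
    range independent of [x] and [y]. *)
Lemma moebius_sumE D x y : (0 < x) -> (`|x| <= D)%N ->
  moebius_sum x y = \sum_(i < D | ((i.+1 ^ 2)%N%:Z %| x)%Z && ((i.+1 ^ 3)%N%:Z %| y)%Z) moebius i.+1.
Proof.
move=> x0 xD; pose P d := ((d ^ 2)%N%:Z %| x)%Z && ((d ^ 3)%N%:Z %| y)%Z.
rewrite -(big_mkord (fun i => P i.+1) (fun i => moebius i.+1)).
rewrite -(big_add1 _ _ 0 D.+1 P moebius) -big_filter fsbig_seq ?filter_uniq ?iota_uniq //.
apply: eq_fsbigl; apply/seteqP; split => d /=; rewrite mem_filter mem_index_iota ltnS /P !PoszX.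
  case=> d0 h2 h3; rewrite h2 h3 d0 /=.
  have : (d ^ 2 <= `|x|)%N.
    by apply: dvdn_leq; [lia|rewrite -PoszX dvdzE in h2].
  by move=> h; apply: leq_trans xD; apply: leq_trans h; rewrite -mulnn leq_pmulr.
by move=> /andP[/andP[h2 h3] /andP[d0 _]].
Qed.

End IntegerBoxes.

Section Decomposition.
Context {R : realType}.
Implicit Types (N X : R) (B D d k n m : nat).

Lemma powR_three_half (x : R) : 0 < x -> x `^ (3 / 2) = x * Num.sqrt x.
Proof.
move=> x0; rewrite -powR12_sqrt ?ltW // -{2}(powRr1 (ltW x0)) powR_add //; congr (_ `^ _).
by field.
Qed.

Variables (w1 w2 : R -> R) (a b c d : R).
Hypotheses (a_gt0 : 0 < a) (w1_out : forall x, ~~ (a < x < b) -> w1 x = 0)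
  (w2_out : forall x, ~~ (c < x < d) -> w2 x = 0).

Let term N X (x y : int) : R := w1 (x%:~R / N `^ (2 / 3)) *
  w2 (N / X * (y%:~R - x%:~R `^ (3 / 2))).

Lemma term_pos N X x y : 0 < N -> term N X x y != 0 ->
  [/\ 0 < x, w1 (x%:~R / N `^ (2 / 3)) != 0, x%:~R < b * N `^ (2 / 3)
    & w2 (N / X * (y%:~R - x%:~R `^ (3 / 2))) != 0].
Proof.
move=> N0; rewrite /term mulf_eq0 negb_or => /andP[h1 h2]; have M0 := powR_gt0 (2 / 3) N0.
have /andP[h3 h4] : a < x%:~R / N `^ (2 / 3) < b by apply: contraNT h1 => /w1_out/eqP.
split=> //; last by rewrite -ltr_pdivrMr.
rewrite -(ltr0z R); rewrite ltr_pdivlMr // in h3; apply: le_lt_trans h3.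
by rewrite mulr_ge0 ?ltW.
Qed.

Lemma term_outl N X B x y : 0 < N -> b * N `^ (2 / 3) <= B%:R -> (B < `|x|)%N ->
  term N X x y = 0.
Proof.
move=> N0 hB xB; apply/eqP; apply: contraTT xB => /(term_pos N0)[x0 _ h _]; rewrite -leqNgt.
have {}h := ltW (lt_le_trans h hB); by rewrite -(ler_nat R) natr_absz gtr0_norm.
Qed.

Lemma term_outr N X B x y : 0 < N -> 0 < X ->
  b * N `^ (2 / 3) * Num.sqrt (b * N `^ (2 / 3)) + (`|c| + `|d|) / (N / X) <= B%:R ->
  (B < `|y|)%N -> term N X x y = 0.
Proof.
move=> N0 X0 hB yB; apply/eqP; apply: contraTT yB => /(term_pos N0)[x0 _ h h2]; rewrite -leqNgt.
rewrite -(ler_nat R) natr_absz.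
have Z0 : 0 < N / X by rewrite divr_gt0.
have x0' : 0 < x%:~R :> R by rewrite ltr0z.
have /andP[h3 h4] : c < N / X * (y%:~R - x%:~R `^ (3 / 2)) < d.
  by apply: contraNT h2 => /w2_out/eqP.
apply: le_trans hB; set q := x%:~R `^ (3 / 2) in h3 h4 *.
have q0 : 0 <= q by exact: powR_ge0.
have hq : q <= b * N `^ (2 / 3) * Num.sqrt (b * N `^ (2 / 3)).
  rewrite /q powR_three_half //; apply: ler_pM; [exact: ltW|exact: sqrtr_ge0|exact: ltW|].
  by apply: ler_wsqrtr; exact: ltW.
have hy : `|y%:~R - q| <= (`|c| + `|d|) / (N / X).
  rewrite ler_pdivlMr // -{1}(gtr0_norm Z0) -normrM mulrC.
  have := ler_norm d; have := ler_norm (- c); rewrite normrN.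
  have := normr_ge0 c; have := normr_ge0 d; rewrite ler_norml; lra.
rewrite intr_norm -[y%:~R](subrK q); apply: le_trans (ler_normD _ _) _.
by rewrite (ger0_norm q0) addrC; apply: lerD.
Qed.

Lemma term_scale N X k (x y : int) : (0 < k)%N -> 0 < N -> 0 < X ->
  let T := N `^ (1 / 3) / k%:R in let H := N / X * k%:R ^+ 3 in
  term N X ((k ^ 2)%N%:Z * x) ((k ^ 3)%N%:Z * y) =
  w1 (x%:~R / T ^+ 2) * w2 (H * (y%:~R - x%:~R * Num.sqrt x%:~R)).
Proof.
move=> k0 N0 X0 T H; have k0' : 0 < k%:R :> R by rewrite ltr0n.
have U0 : 0 < N `^ (1 / 3) by rewrite powR_gt0.
have eM : N `^ (2 / 3) = N `^ (1 / 3) ^+ 2.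
  by rewrite -powR_mulrn ?powR_ge0 // -powRrM; congr (_ `^ _); field.
rewrite /term eM !intrM -!pmulrn !natrX.
have -> : k%:R ^+ 2 * x%:~R / N `^ (1 / 3) ^+ 2 = x%:~R / T ^+ 2.
  rewrite /T; move: (x%:~R : R) (k%:R : R) k0' (N `^ (1 / 3)) U0 => u v v0 z z0.
  by field; rewrite !gt_eqF.
have T0 : 0 < T by rewrite divr_gt0.
(* For [x <= 0] both sides vanish through [w1]; for [x > 0] the power [3 / 2] agrees with
   [x * Num.sqrt x]. *)
have [x0|x0] := lerP x%:~R (0 : R).
  rewrite w1_out ?mul0r // negb_and -leNgt; apply/orP; left.
  by apply: le_trans (ltW a_gt0); rewrite pmulr_lle0 // invr_gt0 exprn_gt0.
congr (_ * w2 _); rewrite /H powR_three_half ?mulr_gt0 ?exprn_gt0 // sqrtrM ?exprn_ge0 ?ltW //.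
rewrite sqrtr_sqr gtr0_norm //; move: (x%:~R : R) (k%:R : R) (y%:~R : R) => u v z.
by move: (Num.sqrt u) (N / X) => s t; ring.
Qed.

(** The box contains every pair with a nonzero term and is kept for all [d], so the sum over [d] can
    be moved outside. By [B1 <= D] no common divisor is missed. *)
Lemma C_S_dsum N X B1 B2 D : 0 < N -> 0 < X -> b * N `^ (2 / 3) <= B1%:R ->
  b * N `^ (2 / 3) * Num.sqrt (b * N `^ (2 / 3)) + (`|c| + `|d|) / (N / X) <= B2%:R ->
  (B1 <= D)%N ->
  C_S w1 w2 N X = \sum_(i < D) (moebius i.+1)%:~R *
    dsum w1 w2 (N `^ (1 / 3) / i.+1%:R) (N / X * i.+1%:R ^+ 3) B1 B2.
Proof.
move=> N0 X0 hB1 hB2 BD.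
have outl x y := @term_outl N X B1 x y N0 hB1.
have outr x y := @term_outr N X B2 x y N0 X0 hB2.
pose F (p : int * int) := term N X p.1 p.2 * (moebius_sum p.1 p.2)%:~R.
transitivity (\sum_(x <- box B1) \sum_(y <- box B2) F (x, y)).
  rewrite -(big_allpairs (F := F)) [RHS]bigfs.
  - by apply: eq_fsbigl; apply/seteqP; split.
  - by apply: allpairs_uniq; rewrite ?box_uniq // => -[? ?] [? ?] _ _.
  move=> [x y] _ h; rewrite /F /=; have [hx|hx] := leqP `|x| B1; last by rewrite outl ?mul0r.
  have [hy|hy] := leqP `|y| B2; last by rewrite outr ?mul0r.
  by case/negP: h; apply/allpairsP; exists (x, y); rewrite !mem_box.
transitivity (\sum_(x <- box B1) \sum_(y <- box B2) \sum_(i < D)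
    if ((i.+1 ^ 2)%N%:Z %| x)%Z && ((i.+1 ^ 3)%N%:Z %| y)%Z
    then (moebius i.+1)%:~R * term N X x y else 0).
  apply: eq_big_seq => x; rewrite mem_box => xB; apply: eq_bigr => y _; rewrite /F /=.
  have [t0|t0] := eqVneq (term N X x y) 0.
    by rewrite t0 mul0r big1 // => i _; rewrite mulr0 if_same.
  have [x0 _ _ _] := term_pos N0 t0.
  rewrite (moebius_sumE y x0 (leq_trans xB BD)) rmorph_sum mulr_sumr -big_mkcond /=.
  by apply: eq_bigr => i _; rewrite mulrC.
under eq_bigr => x _ do rewrite exchange_big /=.
rewrite exchange_big /=; apply: eq_bigr => i _.
have i2 : (0 < i.+1 ^ 2)%N by rewrite expn_gt0.
have i3 : (0 < i.+1 ^ 3)%N by rewrite expn_gt0.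
transitivity (\sum_(x <- box B1 | ((i.+1 ^ 2)%N%:Z %| x)%Z)
    (moebius i.+1)%:~R * \sum_(y <- box B2) term N X x ((i.+1 ^ 3)%N%:Z * y)).
  rewrite [RHS]big_mkcond; apply: eq_bigr => x _; case: ifP => hx; last by rewrite big1.
  by rewrite -big_mkcond /= -mulr_sumr (box_multiples i3) // => y; exact: outr.
rewrite -mulr_sumr (box_multiples i2) => [|x hx]; last first.
  by rewrite big1 // => y _; exact: outl.
rewrite /dsum box_sum; congr (_ * _); apply: eq_bigr => n _.
rewrite box_sum; apply: eq_bigr => m _.
by rewrite term_scale // !rmorphB /= -!pmulrn.
Qed.

End Decomposition.

Section DoubleSumError.
Context {R : realType}.
Variables (w w1 w2 : R -> R) (a b M : R) (v v1 v2 : R -> R) (c d M' : R).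
Hypotheses (hw : bumpC2 w w1 w2 a b M) (a0 : 0 < a) (hv : bumpC2 v v1 v2 c d M').
Implicit Types (T H P e : R) (n N : nat).

(** A positive integer [x] has [x / T^2 >= b], any other integer [x / T^2 <= 0 < a]. *)
Lemma dsum_small T H n N : 0 < T -> b * T ^+ 2 <= 1 -> dsum w v T H n N = 0.
Proof.
move=> T0 bT; rewrite /dsum big1 // => i _; rewrite big1 // => j _.
rewrite (bump_out0 hw) ?mul0r // negb_and -!leNgt.
have T20 : 0 < T ^+ 2 by rewrite exprn_gt0.
have [h|h] := leqP i n; apply/orP; [left|right].
  apply: le_trans (ltW a0); rewrite pmulr_lle0 ?invr_gt0 //.
  by rewrite subr_le0 ler_nat.
rewrite ler_pdivlMr //; apply: le_trans bT _.
by rewrite -natrB ?ler1n ?subn_gt0 // ltnW.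
Qed.

(* The three cases are [T < b^(-1/2)], where the sum is empty, [H <= T] and [T < H]. *)
Lemma dsum_error e c0 : 0 < e -> e <= 1 / 2 -> 0 < c0 ->
  exists C bs cs ds T0 : R, [/\ 0 < C, 0 < bs, 0 < T0 & forall T H P n N,
    0 < T -> 0 < H -> c0 / H <= T * Num.sqrt T / Num.sqrt H -> 1 <= P -> T `^ e <= P ->
    b * T ^+ 2 <= n%:R -> wide b c d T H N ->
    bs * T ^+ 2 <= n%:R -> (T0 <= T -> wide bs cs ds T T N) ->
    `|dsum w v T H n N - T ^+ 2 / H * (itg a b w * itg c d v)| <=
    C * (T * Num.sqrt T / Num.sqrt H * P + T `^ (1 + e))].
Proof.
move=> e0 e2 c00; have ab := bump_ab hw; have b0 : 0 < b by exact: lt_trans ab.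
set J := itg a b w * itg c d v.
pose T0 := (Num.sqrt b)^-1.
have T00 : 0 < T0 by rewrite invr_gt0 sqrtr_gt0.
have T02 : b * T0 ^+ 2 = 1 by rewrite exprVn sqr_sqrtr ?ltW // mulfV ?gt_eqF.
have [C1 C10 h1] := dsum_asymptotic hw a0 hv e0 e2 T00.
have [C2 [bs [cs [ds [C20 bs0 h2]]]]] := dsum_upper hw a0 hv e0 e2 T00.
pose C3 := `|J| * T0 ^+ 2 / c0; pose C4 := C1 / c0; pose C5 := `|J| * T0 `^ (- e).
have C30 : 0 <= C3 by apply: divr_ge0; [exact: mulr_ge0 (normr_ge0 _) (sqr_ge0 _)|exact: ltW].
have C40 : 0 <= C4 by rewrite /C4 divr_ge0 ?ltW.
have C50 : 0 <= C5 by rewrite /C5 mulr_ge0 ?powR_ge0.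
have Kp : 0 < C3 + C4 + 2 * C1 + C2 + C5.
  by move: C3 C4 C5 C30 C40 C50 => x3 x4 x5 *; lra.
exists (C3 + C4 + 2 * C1 + C2 + C5), bs, cs, ds, T0; split => //.
move=> T H P n N Tp Hp; set Q := T * _ / _; move=> hQ P1 hP hn hN hn' hN'.
have Q0 : 0 <= Q by rewrite /Q divr_ge0 ?mulr_ge0 ?sqrtr_ge0 ?ltW.
have QP : Q <= Q * P by rewrite ler_peMr.
have E0 : 0 <= T `^ (1 + e) by exact: powR_ge0.
have QP0 : 0 <= Q * P by apply: le_trans QP.
have fin K : 0 <= K -> K <= C3 + C4 + 2 * C1 + C2 + C5 -> forall y, y <= K * (Q * P + T `^ (1 + e)) ->
    y <= (C3 + C4 + 2 * C1 + C2 + C5) * (Q * P + T `^ (1 + e)).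
  move=> K0 hK y hy; apply: le_trans hy _; apply: ler_wpM2r hK; exact: addr_ge0.
(* The form in which the hypothesis relating [N] and [X] acts: errors of order [1 / H] are absorbed
   by [Q]. *)
have iH : H^-1 <= Q / c0 by rewrite ler_pdivlMr // mulrC.
have nJ : `|T ^+ 2 / H * J| = `|J| * (T ^+ 2 / H).
  rewrite normrM (mulrC `|J|) (@ger0_norm _ (T ^+ 2 / H)) //.
  exact: divr_ge0 (sqr_ge0 _) (ltW Hp).
have [hT|hT] := ltP T T0.
  have T2 : T ^+ 2 <= T0 ^+ 2 by rewrite lerXn2r // ?nnegrE ltW.
  rewrite dsum_small // ?sub0r ?normrN; last first.
    by rewrite -T02 ler_pM2l.
  apply: (fin C3) => //; first by lra.
  rewrite nJ.
  have -> : C3 * (Q * P + T `^ (1 + e)) = `|J| * (T0 ^+ 2 * ((Q * P + T `^ (1 + e)) / c0)).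
    by rewrite /C3; ring.
  apply: ler_wpM2l => //; apply: ler_pM T2 _; rewrite ?sqr_ge0 ?invr_ge0 ?(ltW Hp) //.
  apply: le_trans iH _; apply: ler_wpM2r; first by rewrite invr_ge0 ltW.
  by lra.
have [hH|hH] := leP H T.
  apply: (fin (C4 + 2 * C1)); [by lra|by lra|].
  apply: le_trans (h1 _ _ _ _ hT Hp hn hN) _.
  have sH : 0 < Num.sqrt H by rewrite sqrtr_gt0.
  have sHH : H = Num.sqrt H ^+ 2 by rewrite sqr_sqrtr ?ltW.
  have sT : 0 < Num.sqrt T by rewrite sqrtr_gt0.
  have hp1 : H `^ (1 / 2 + e) = Num.sqrt H * H `^ e.
    by rewrite -powR_add // mul1r powR12_sqrt ?ltW.
  have hp3 : H `^ (3 / 2 + e) = H * Num.sqrt H * H `^ e.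
    by rewrite -powR_add // powR_three_half.
  have HeP : H `^ e <= P by apply: le_trans hP; apply: ge0_ler_powR; rewrite ?nnegrE ?(ltW e0) ?(ltW Hp) ?(ltW Tp) ?(ltW T00).
  have He0 : 0 <= H `^ e by exact: powR_ge0.
  have A1 : Q * H `^ e <= Q * P by apply: ler_wpM2l.
  (* Here [H <= T] is used: [T^(1/2) H^(1/2) <= T^(3/2) H^(-1/2)]. *)
  have A2 : Num.sqrt T * Num.sqrt H <= Q.
    rewrite /Q ler_pdivlMr // -mulrA -expr2 -sHH mulrC; exact: (ler_wpM2r (ltW sT) hH).
  have A3 : Num.sqrt T * Num.sqrt H * H `^ e <= Q * P by apply: ler_pM => //; exact: mulr_ge0 (ltW sT) (ltW sH).
  rewrite hp1 hp3.
  have -> : H^-1 * (1 + Num.sqrt T * (T * (Num.sqrt H * H `^ e) + H * Num.sqrt H * H `^ e)) =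
      H^-1 + Q * H `^ e + Num.sqrt T * Num.sqrt H * H `^ e.
    have id (y z t x : R) : y != 0 -> (y ^+ 2)^-1 * (1 + z * (t * (y * x) + y ^+ 2 * y * x)) =
      (y ^+ 2)^-1 + t * z / y * x + z * y * x by move=> y0; field.
    have := id (Num.sqrt H) (Num.sqrt T) T (H `^ e); rewrite -sHH; apply.
    by rewrite gt_eqF.
  rewrite /C4 mulrDl; apply: (@le_trans _ _ (C1 * (Q * P / c0 + Q * P + Q * P))).
    apply: ler_wpM2l; first exact: ltW.
    have : Q / c0 <= Q * P / c0 by rewrite ler_pM2r ?invr_gt0.
    by lra.
  have -> : C1 * (Q * P / c0 + Q * P + Q * P) = C1 / c0 * (Q * P) + 2 * C1 * (Q * P) by ring.
  have X1 : 0 <= C1 / c0 * T `^ (1 + e) by rewrite mulr_ge0.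
  have X2 : 0 <= 2 * C1 * T `^ (1 + e) by rewrite mulr_ge0 //; lra.
  rewrite !(mulrDr _ (Q * P)); lra.
apply: (fin (C2 + C5)); [by lra|by lra|].
have hS := h2 _ _ _ _ hT (ltW hH) hn' (hN' hT).
(* For [H > T] the expected value is [O(T)], itself an error term. *)
have hM : `|T ^+ 2 / H * J| <= C5 * T `^ (1 + e).
  rewrite nJ /C5 -mulrA; apply: ler_wpM2l => //.
  apply: (@le_trans _ _ T).
    by rewrite ler_pdivrMr // expr2 ler_pM2l // ltW.
  rewrite -powR_add // powRr1 ?(ltW Tp) // mulrCA ler_peMr ?(ltW Tp) //.
  rewrite powRN mulrC ler_pdivlMr ?powR_gt0 // mul1r.
  by apply: ge0_ler_powR; rewrite ?nnegrE ?(ltW e0) ?(ltW Hp) ?(ltW Tp) ?(ltW T00).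
apply: le_trans (ler_normB _ _) _; apply: le_trans (lerD hS hM) _.
rewrite -mulrDl; apply: ler_wpM2l; first by lra.
by rewrite lerDr.
Qed.

End DoubleSumError.

(** * Summation of the errors over the common divisor *)

Section Assembly.
Context {R : realType}.
Implicit Types (N X T H U x y e : R) (n m B D k : nat).

Lemma nat_above x : exists n, x <= n%:R.
Proof.
by exists (Num.bound `|x|); apply: le_trans (ler_norm _) (ltW (archi_boundP _)).
Qed.

Lemma fourier_at0_itg (w : R -> R) a b : (forall x, ~~ (a < x < b) -> w x = 0) ->
  fourier_at0 w = itg a b w.
Proof.
move=> h; rewrite /fourier_at0 /itg [RHS]Rintegral_mkcond; congr Rintegral.
apply/funext => x; rewrite patchE; case: ifPn => // /negP xI; apply: h.
by apply: contra_notN xI => /andP[h1 h2]; rewrite inE /= in_itv /= !ltW.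
Qed.

Lemma wide_le (b c d T T' H H' : R) n : 0 <= b -> 0 <= T -> T <= T' -> 0 < H' -> H' <= H ->
  wide b c d T' H' n -> wide b c d T H n.
Proof.
move=> b0 T0 hT H0 hH; apply: le_trans.
have h1 : b * T ^+ 2 <= b * T' ^+ 2.
  by apply: ler_wpM2l => //; rewrite lerXn2r // nnegrE (le_trans T0).
apply: lerD.
  by apply: (ler_pM _ _ h1); [exact: mulr_ge0 b0 (sqr_ge0 _)|exact: sqrtr_ge0|apply: ler_wsqrtr].
apply: ler_wpM2l; first exact: addr_ge0.
by rewrite lef_pV2 // posrE; exact: lt_le_trans hH.
Qed.

Variables (w w1 w2 : R -> R) (a b M : R) (v v1 v2 : R -> R) (c d M' : R).
Hypotheses (hw : bumpC2 w w1 w2 a b M) (a0 : 0 < a) (hv : bumpC2 v v1 v2 c d M').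

(** For the divisor [k] the two errors are [X^(1/2) N^e k^-3] and at most [N^(1/3+e) k^(-1-e)],
    whence [Z1] and [Z2]. The constant is independent of [D], so that [D] may later tend to infinity
    in the truncated series. *)
Lemma C_S_moebius5 e c0 : 0 < e -> e <= 1 / 2 -> 0 < c0 -> exists2 C : R, 0 < C &
  forall N X, 1 <= N -> 0 < X -> c0 * Num.sqrt X <= N -> \forall D \near \oo,
  `|C_S w v N X - X * N `^ (2 / 3) / N * (itg a b w * itg c d v) * moebius5 D| <=
  C * (N `^ (1 / 3 + e) + Num.sqrt X * N `^ e).
Proof.
move=> e0 e2 c00; have ab := bump_ab hw; have b0 : 0 < b by exact: lt_trans ab.
set J := itg a b w * itg c d v.
have [C [bs [cs [ds [T0 [C0 bs0 T00 hC]]]]]] := dsum_error hw a0 hv e0 e2 c00.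
have [Z1 Z10 hZ1] := zeta_bound (ltr0n R 2 : 0 < 2%:R).
have [Z2 Z20 hZ2] := zeta_bound e0.
exists (C * (Z1 + Z2)); first by rewrite mulr_gt0 // addr_gt0.
move=> N X N1 X0 hNX; have N0 : 0 < N by exact: lt_le_trans N1.
pose U := N `^ (1 / 3).
have U0 : 0 < U by exact: powR_gt0.
have UN : U <= N.
  by rewrite -[leRHS]powRr1 ?(ltW N0) //; apply: ler_powR => //; lra.
have eM : N `^ (2 / 3) = U ^+ 2.
  by rewrite -powR_mulrn ?powR_ge0 // -powRrM; congr (_ `^ _); field.
have eN : U ^+ 3 = N.
  by rewrite -powR_mulrn ?powR_ge0 // -powRrM -[RHS]powRr1 ?(ltW N0) //; congr (_ `^ _); field.
have [B1 hB1] := nat_above (b * U ^+ 2 + bs * U ^+ 2).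
have p1 : 0 <= b * U ^+ 2 by exact: mulr_ge0 (ltW b0) (sqr_ge0 _).
have p2 : 0 <= bs * U ^+ 2 by exact: mulr_ge0 (ltW bs0) (sqr_ge0 _).
pose wd (x y z T H : R) := x * T ^+ 2 * Num.sqrt (x * T ^+ 2) + (`|y| + `|z|) / H.
have wd0 (x y z T H : R) : 0 <= x -> 0 < H -> 0 <= wd x y z T H.
  move=> b00 H0; apply: addr_ge0; last exact: divr_ge0 (addr_ge0 _ _) (ltW H0).
  exact: mulr_ge0 (mulr_ge0 b00 (sqr_ge0 _)) (sqrtr_ge0 _).
have Zp : 0 < N / X by exact: divr_gt0.
(* All [k] have [T <= U] and [H >= N / X], which the first summand covers. The second is for the
   majorant sums, where [H] is replaced by [T >= T0]. *)
have [B2 hB2] := nat_above (wd b c d U (N / X) + wd bs cs ds U T0).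
have q1 := wd0 b c d U (N / X) (ltW b0) Zp.
have q2 := wd0 bs cs ds U T0 (ltW bs0) T00.
near=> D.
have BD : (B1 <= D)%N by near: D; exists B1.
rewrite (@C_S_dsum _ w v a b c d a0 (bump_out0 hw) (bump_out0 hv) N X B1 B2 D) ?eM //; last 2 first.
- by lra.
- by rewrite -/(wd b c d U (N / X)); lra.
rewrite -/U /moebius5 mulr_sumr -sumrB.
pose P := N `^ e.
have P1 : 1 <= P by rewrite -(powRr0 N); apply: ler_powR => //; exact: ltW.
apply: (@le_trans _ _ (\sum_(i < D) C * (Num.sqrt X * P * i.+1%:R `^ (- (1 + 2%:R)) +
    U `^ (1 + e) * i.+1%:R `^ (- (1 + e))))).
  apply: le_trans (ler_norm_sum _ _ _) _; apply: ler_sum => i _.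
  set k := i.+1; have k0 : 0 < k%:R :> R by rewrite ltr0n.
  have k1 : 1 <= k%:R :> R by rewrite ler1n.
  have T0' : 0 < U / k%:R by exact: divr_gt0.
  have TU : U / k%:R <= U by rewrite ler_pdivrMr // ler_peMr // ltW.
  have Hp : 0 < N / X * k%:R ^+ 3 by rewrite mulr_gt0 ?exprn_gt0.
  have HZ : N / X <= N / X * k%:R ^+ 3 by rewrite ler_peMr ?exprn_ege1 // ltW.
  have eQ : U / k%:R * Num.sqrt (U / k%:R) / Num.sqrt (N / X * k%:R ^+ 3) = Num.sqrt X / k%:R ^+ 3.
    have sk : 0 < Num.sqrt k%:R :> R by rewrite sqrtr_gt0.
    have sU : 0 < Num.sqrt U by rewrite sqrtr_gt0.
    have sX : 0 < Num.sqrt X by rewrite sqrtr_gt0.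
    have ek : k%:R = Num.sqrt k%:R ^+ 2 :> R by rewrite sqr_sqrtr ?ltW.
    have eU : U = Num.sqrt U ^+ 2 by rewrite sqr_sqrtr ?ltW.
    have eX : X = Num.sqrt X ^+ 2 by rewrite sqr_sqrtr ?ltW.
    rewrite -eN; move: (Num.sqrt k%:R) (Num.sqrt U) (Num.sqrt X) sk sU sX ek eU eX.
    move=> q p r q0 p0 r0 -> -> ->.
    rewrite (_ : p ^+ 2 / q ^+ 2 = (p / q) ^+ 2); last by rewrite expr_div_n.
    rewrite (_ : (p ^+ 2) ^+ 3 / r ^+ 2 * (q ^+ 2) ^+ 3 = (p ^+ 3 * q ^+ 3 / r) ^+ 2); last first.
      by field; rewrite gt_eqF.
    rewrite !sqrtr_sqr !gtr0_norm ?divr_gt0 ?mulr_gt0 ?exprn_gt0 //.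
    by field; rewrite !gt_eqF.
  (* Equivalent to [c0 * Num.sqrt X <= N]. *)
  have hc : c0 / (N / X * k%:R ^+ 3) <= Num.sqrt X / k%:R ^+ 3.
    have k30 : 0 < k%:R ^+ 3 :> R by rewrite exprn_gt0.
    have sX : 0 < Num.sqrt X by rewrite sqrtr_gt0.
    have eX : X = Num.sqrt X ^+ 2 by rewrite sqr_sqrtr ?ltW.
    have -> : c0 / (N / X * k%:R ^+ 3) = c0 * X / N / k%:R ^+ 3.
      by field; rewrite !gt_eqF.
    rewrite ler_pM2r ?invr_gt0 // ler_pdivrMr // {1}eX mulrA.
    by rewrite [leRHS]mulrC ler_pM2r.
  have TP : (U / k%:R) `^ e <= P.
    apply: ge0_ler_powR; rewrite ?nnegrE ?(ltW e0) ?(ltW T0') ?(ltW N0) //.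
    exact: le_trans UN.
  have TT : (U / k%:R) ^+ 2 <= U ^+ 2 by rewrite lerXn2r // nnegrE ltW.
  have := hC (U / k%:R) (N / X * k%:R ^+ 3) P B1 B2 T0' Hp; rewrite eQ => /(_ hc P1 TP).
  have bT : b * (U / k%:R) ^+ 2 <= b * U ^+ 2 by rewrite ler_pM2l.
  have bsT : bs * (U / k%:R) ^+ 2 <= bs * U ^+ 2 by rewrite ler_pM2l.
  have g1 : wide b c d (U / k%:R) (N / X * k%:R ^+ 3) B2.
    apply: (@wide_le _ _ _ _ U _ (N / X)) => //; rewrite ?(ltW b0) ?(ltW T0') //.
    by rewrite /wide -/(wd b c d U (N / X)); lra.
  have g2 : T0 <= U / k%:R -> wide bs cs ds (U / k%:R) (U / k%:R) B2.
    move=> hT; apply: (@wide_le _ _ _ _ U _ T0) => //; rewrite ?(ltW bs0) ?(ltW T0') //.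
    by rewrite /wide -/(wd bs cs ds U T0); lra.
  move=> h; have := h ltac:(lra) g1 ltac:(lra) g2.
  have -> : (U / k%:R) ^+ 2 / (N / X * k%:R ^+ 3) = X * U ^+ 2 / N * k%:R ^- 5.
    by move: (k%:R : R) k0 => z z0; field; rewrite !gt_eqF.
  have -> : k%:R `^ (- (1 + 2%:R)) = k%:R ^- 3 :> R.
    by rewrite powRN -powR_mulrn ?ltW //; congr (_ `^ _)^-1; ring.
  have -> : (U / k%:R) `^ (1 + e) = U `^ (1 + e) * k%:R `^ (- (1 + e)).
    rewrite powRM ?invr_ge0 ?(ltW U0) ?(ltW k0) //; congr (_ * _).
    by rewrite -powR_inv1 ?ltW // -powRrM mulN1r.
  rewrite -/J; set S := dsum _ _ _ _ _ _ => {}h.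
  have -> : (moebius k)%:~R * S - X * U ^+ 2 / N * J * ((moebius k)%:~R * k%:R ^- 5) =
     (moebius k)%:~R * (S - X * U ^+ 2 / N * k%:R ^- 5 * J) by ring.
  have hm : `|(moebius k)%:~R| <= 1 :> R by rewrite -intr_norm lerz1 moebius_norm.
  rewrite normrM; apply: le_trans (ler_piMl (normr_ge0 _) hm) _.
  by apply: le_trans h _; rewrite [Num.sqrt X / _ * P]mulrAC.
rewrite -mulr_sumr -mulrA; apply: ler_wpM2l; first exact: ltW.
rewrite big_split -!mulr_sumr /=.
have UE : U `^ (1 + e) <= N `^ (1 / 3 + e).
  by rewrite -powRrM; apply: ler_powR => //; lra.
have s1 : Num.sqrt X * P * (\sum_(i < D) i.+1%:R `^ (- (1 + 2%:R))) <= Num.sqrt X * P * Z1.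
  by apply: ler_wpM2l; [exact: mulr_ge0 (sqrtr_ge0 _) (powR_ge0 _ _)|exact: hZ1].
have s2 : U `^ (1 + e) * (\sum_(i < D) i.+1%:R `^ (- (1 + e))) <= N `^ (1 / 3 + e) * Z2.
  apply: ler_pM => //; [exact: powR_ge0|].
  by apply: sumr_ge0 => i _; exact: powR_ge0.
apply: le_trans (lerD s1 s2) _.
have t1 : 0 <= Num.sqrt X * P * Z2.
  exact: mulr_ge0 (mulr_ge0 (sqrtr_ge0 _) (powR_ge0 _ _)) (ltW Z20).
have t2 : 0 <= N `^ (1 / 3 + e) * Z1 by exact: mulr_ge0 (powR_ge0 _ _) (ltW Z10).
rewrite -/P mulrDr !mulrDl [Z1 * N `^ _]mulrC [Z1 * (_ * _)]mulrC [Z2 * N `^ _]mulrC [Z2 * (_ * _)]mulrC; lra.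
Unshelve. all: by end_near. Qed.

End Assembly.

Unset Implicit Arguments.

Theorem proposition1p3 (R : realType) (w1 w2 : R -> R)
    (w1_smooth : smooth w1) (w2_smooth : smooth w2)
    (w1_compact : compactly_supported w1)
    (w2_compact : compactly_supported w2)
    (w1_pos : fun_support w1 `<=` [set x | 0 < x])
    (eps c0 : R) (eps_gt0 : 0 < eps) (c0_gt0 : 0 < c0) :
  exists2 C : R, 0 < C &
    forall N X : R, 1 <= N -> 0 < X -> c0 * X `^ (1 / 2) <= N ->
      let M := N `^ (2 / 3) in
      `| C_S w1 w2 N X
         - X * M / N * (fourier_at0 w1 * fourier_at0 w2 / zeta (5 : R)) |
      <= C * (N `^ (1 / 3 + eps) + X `^ (1 / 2) * N `^ eps).
Proof.
have [a [b [a0 ab supp1]]] := support_pos_interval w1_compact w1_pos.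
have [K K0 supp2] := support_interval w2_compact.
have KK : - K < K by rewrite gtrN.
have [M1 hw] := smooth_bump w1_smooth ab supp1.
have [M2 hv] := smooth_bump w2_smooth KK supp2.
(* The exponent [3/2 + e] in [slice_term] must not exceed 2; as [N >= 1], a smaller [e] only
   strengthens the bound. *)
pose e := Num.min eps (1 / 2).
have e0 : 0 < e by rewrite lt_min eps_gt0 divr_gt0.
have e2 : e <= 1 / 2 by rewrite ge_min lexx orbT.
have ee : e <= eps by rewrite ge_min lexx.
have [C C0 hC] := C_S_moebius5 hw a0 hv e0 e2 c0_gt0.
exists C => // N X N1 X0; rewrite (div1r 2) powR12_sqrt ?(ltW X0) // => hNX /=.
have := hC N X N1 X0 hNX.
rewrite -(fourier_at0_itg (bump_out0 hw)) -(fourier_at0_itg (bump_out0 hv)).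
set J := fourier_at0 w1 * _; set A := X * _ / N => near_le.
(* [C_S] does not involve [D], so letting [D] tend to infinity turns the truncated series into
   [1 / zeta(5)] at no cost. *)
have cv : (fun D => `|C_S w1 w2 N X - A * J * moebius5 D|) @ \oo -->
    `|C_S w1 w2 N X - A * (J / zeta (5 : R))|.
  rewrite mulrA; apply: cvg_norm; apply: cvgB; first exact: cvg_cst.
  by apply: cvgM; [exact: cvg_cst|exact: moebius5_cvg].
have le1 : `|C_S w1 w2 N X - A * (J / zeta (5 : R))| <=
    C * (N `^ (1 / 3 + e) + Num.sqrt X * N `^ e).
  rewrite -(cvg_lim _ cv) //; apply: limr_le => //.
  by apply/cvg_ex; eexists; exact: cv.
apply: le_trans le1 _; rewrite ler_pM2l //; apply: lerD.
  by apply: ler_powR => //; rewrite lerD2l.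
by apply: ler_wpM2l; [exact: sqrtr_ge0|exact: ler_powR].
Qed.
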